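(* Let $\overline{M}\times_F\widetilde{N}$ be the warped product manifold of a $2$-dimensional semi-Riemannian manifold $(\overline{M},\overline{g})$ and an $(n-2)$-dimensional semi-Riemannian manifold $(\widetilde{N},\widetilde{g})$, $n\geq 4$, with a warping function $F$, and let $(\widetilde{N},\widetilde{g})$ be a space of constant curvature, provided that $n\geq 5$ (no assumption on $(\widetilde N,\widetilde g)$ if $n=4$). Let $\tau_1$, $\rho$, $\tau_2$ be the functions defined in the context. (i) On the set ${\mathcal U}_C\subset\overline{M}\times_F\widetilde{N}$ the following three conditions are satisfied: $$C\cdot C=-\frac{\rho}{2(n-2)}\,Q(g,C),\qquad R\cdot R-Q(S,R)=L\,Q(g,C),$$ where $$L=-\frac{n-2}{(n-1)\rho}\left(\overline{\kappa}\Big(\tau_1+\frac{\mathrm{tr}(T)}{2F}\Big)+\frac{n-3}{4F^2}\big(\mathrm{tr}(T^2)-(\mathrm{tr}(T))^2\big)\right),$$ and $$C\cdot R+R\cdot C=Q(S,C)+(L+L_C)\,Q(g,C)-\frac{1}{(n-2)^2}\,Q\Big(g,\frac{n-2}{2}\,S\wedge S-\kappa\,g\wedge S+g\wedge S^2\Big)$$ with $L_C=-\frac{\rho}{2(n-2)}$ and the same $L$. (ii) Let $V$ be the set of all points of ${\mathcal U}_S\cap{\mathcal U}_C\subset\overline{M}\times_F\widetilde{N}$ at which $S_{ad}$ is not proportional to $\overline{g}_{ad}$ ($a,d\in\{1,2\}$). Then on $V$ we have $$C=-\frac{(n-1)\rho\tau_2}{(n-3)(n-2)}\left(\frac{n-2}{2}\,S\wedge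 S-\kappa\,g\wedge S+g\wedge S^2-\frac{\mathrm{tr}(S^2)-\kappa^2}{n-1}\,G\right),$$ $$R\cdot C+C\cdot R=Q(S,C)+\left(L-\frac{\rho}{2(n-2)}+\frac{n-3}{(n-2)(n-1)\rho\tau_2}\right)Q(g,C),$$ $$C\cdot R=-\frac{1}{(n-2)^2}\,Q\Big(\big(\tfrac{\rho}{2}+(n-1)\rho\tau_1^2\tau_2\big)S-(n-1)\rho\tau_1\tau_2\,S^2,\,G\Big)-\frac{(n-1)\rho\tau_2}{(n-2)^2}\,g\wedge Q(S,S^2)-\frac{\rho}{2(n-2)}\,Q(g,C),$$ $$R\cdot C=Q(S,C)+\left(L+\frac{n-3}{(n-2)(n-1)\rho\tau_2}\right)Q(g,C)+\frac{(n-1)\rho\tau_2}{(n-2)^2}\,g\wedge Q(S,S^2)+\frac{1}{(n-2)^2}\,Q\Big(\big(\tfrac{\rho}{2}+(n-1)\rho\tau_1^2\tau_2\big)S-(n-1)\rho\tau_1\tau_2\,S^2,\,G\Big).$$ On the set $({\mathcal U}_S\cap{\mathcal U}_C)\setminus V$ the Weyl tensor $C$ is expressed by a linear combination (with functions as coefficients) of the Kulkarni-Nomizu products $S\wedge S$, $g\wedge S$ and $g\wedge g$.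
   Context: All manifolds are connected, paracompact and of class $C^\infty$. For a semi-Riemannian manifold $(M,g)$, $n=\dim M$, with Levi-Civita connection $\nabla$: ${\mathcal R}(X,Y)Z=\nabla_X\nabla_YZ-\nabla_Y\nabla_XZ-\nabla_{[X,Y]}Z$, $R(X_1,X_2,X_3,X_4)=g({\mathcal R}(X_1,X_2)X_3,X_4)$, $S(X,Y)=\mathrm{tr}\{Z\mapsto{\mathcal R}(Z,X)Y\}$, $g({\mathcal S}X,Y)=S(X,Y)$, $S^2(X,Y)=S({\mathcal S}X,Y)$, $\kappa=\mathrm{tr}\,{\mathcal S}$. For symmetric $(0,2)$-tensors, $A^2(X,Y)=A({\mathcal A}X,Y)$ where $g({\mathcal A}X,Y)=A(X,Y)$; traces are taken with the metric. Kulkarni-Nomizu product of a symmetric $(0,2)$-tensor $E$ and a $(0,k)$-tensor $T$, $k\ge2$: $(E\wedge T)(X_1,\dots,X_4,Y_3,\dots,Y_k)=E(X_1,X_4)T(X_2,X_3,Y_3,\dots,Y_k)+E(X_2,X_3)T(X_1,X_4,Y_3,\dots,Y_k)-E(X_1,X_3)T(X_2,X_4,Y_3,\dots,Y_k)-E(X_2,X_4)T(X_1,X_3,Y_3,\dots,Y_k)$. $G=\frac12 g\wedge g$. Weyl tensor: $C=R-\frac1{n-2}g\wedge S+\frac{\kappa}{(n-2)(n-1)}G$. For a $(0,4)$-tensor $B\in\{R,C\}$ define ${\mathcal B}$ by $g({\mathcal B}(X_1,X_2)X_3,X_4)=B(X_1,X_2,X_3,X_4)$; for a $(0,k)$-tensor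 $T$, $(B\cdot T)(X_1,\dots,X_k,X,Y)=-\sum_{i}T(X_1,\dots,{\mathcal B}(X,Y)X_i,\dots,X_k)$. For a symmetric $(0,2)$-tensor $A$, $(X\wedge_AY)Z=A(Y,Z)X-A(X,Z)Y$ and $Q(A,T)(X_1,\dots,X_k,X,Y)=-\sum_iT(X_1,\dots,(X\wedge_AY)X_i,\dots,X_k)$. ${\mathcal U}_S$ is the set of points where $S\neq\frac{\kappa}{n}g$; ${\mathcal U}_C$ is the set of points where $C\ne0$. Warped product: $F$ is a positive smooth function on $\overline M$ and $g=\pi_1^*\overline g+(F\circ\pi_1)\,\pi_2^*\widetilde g$ on $\overline M\times\widetilde N$. In product charts, indices $a,b,c,d\in\{1,2\}$ refer to $\overline M$. Bars/tildes denote objects of $\overline g$/$\widetilde g$; $\overline\kappa,\widetilde\kappa$ are the scalar curvatures. Functions on the factors are regarded as functions on the product. Put $$T_{ab}=\overline\nabla_aF_b-\frac1{2F}F_aF_b,\quad F_a=\partial_aF,\quad \mathrm{tr}(T)=\overline g^{ab}T_{ab},\quad \mathrm{tr}(T^2)=\overline g^{ab}\overline g^{cd}T_{ac}T_{bd},\quad \Delta_1F=\overline g^{ab}F_aF_b,$$ $$\tau_1=\frac{\widetilde\kappa}{(n-2)F}-\frac{\mathrm{tr}(T)}{2F}-(n-3)\frac{\Delta_1F}{4F^2},\qquad \rho=\frac{2(n-3)}{n-1}\left(\frac{\overline\kappa}2+\frac{\widetilde\kappa}{(n-3)(n-2)F}+\frac{\mathrm{tr}(T)}{2F}-\frac{\Delta_1F}{4F^2}\right).$$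 Let $A=S-\tau_1g$. The function $\tau_2$ is defined by $\tau_2=\big(\mathrm{tr}(A^2)-(\mathrm{tr}(A))^2\big)^{-1}$; it is introduced on the set of points of ${\mathcal U}_S$ at which $\mathrm{rank}(A)=2$ (on ${\mathcal U}_S$ this is equivalent to $\mathrm{tr}(A^2)-(\mathrm{tr}(A))^2\ne0$).
   Formalization: In (ii) the term (1/(n-2)^2)Q((rho/2+...)S-...S^2, G) is taken with sign + in C.R and - in R.C, since the printed signs fail (n=4, flat factors, F=(1+x^2/2)^2, x=0); the formulas with tau_2 are asserted at the points of V where rank(A)=2, where tau_2 is defined. *)

(* Defs.v *)
From HB Require Import structures.
From mathcomp Require Import all_boot all_order all_algebra.
From mathcomp Require Import all_classical all_reals all_analysis.
Set Implicit Arguments.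
Unset Strict Implicit.
Unset Printing Implicit Defensive.
Import Order.TTheory GRing.Theory Num.Theory.
Import numFieldNormedType.Exports.
Local Open Scope classical_set_scope.
Local Open Scope ring_scope.

(* Points of R^m and tangent vectors in a chart are row vectors 'rV[R]_m. *)

Section Smoothness.
Context {R : realType} {m : nat}.
Implicit Types (U : set 'rV[R]_m) (f : 'rV[R]_m -> R).

Definition basis_vec (i : 'I_m) : 'rV[R]_m := delta_mx 0 i.

Definition partial (i : 'I_m) f : 'rV[R]_m -> R :=
  fun x => 'D_(basis_vec i) f x.

Fixpoint Ck (k : nat) U f : Prop :=
  (forall x, U x -> {for x, continuous f}) /\
  (if k is k'.+1 then
     forall i, (forall x, U x -> derivable f x (basis_vec i)) /\
               Ck k' U (partial i f)
   else True).

Definition smooth_on U f := forall k, Ck k U f.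

End Smoothness.

(* C^oo structure on a topological space, given by an arbitrary (not         *)
(* necessarily maximal) atlas.  [chart_at p] is a preferred chart around p:  *)
(* the tangent space at p is identified with R^m via the coordinate basis of *)
(* [chart_at p], and tensors at p are given by their components there.       *)
(* [chart_inv c] is only meaningful on the image of c.                       *)
Record smooth_manifold (R : realType) (m : nat) := SmoothManifold {
  carrier :> topologicalType ;
  chart : Type ;
  chart_dom : chart -> set carrier ;
  chart_coord : chart -> carrier -> 'rV[R]_m ;
  chart_inv : chart -> 'rV[R]_m -> carrier ;
  chart_at : carrier -> chart ;
  chart_atP : forall p, chart_dom (chart_at p) p ;
  open_chart_dom : forall c, open (chart_dom c) ;
  open_chart_img : forall c, open (chart_coord c @` chart_dom c) ;
  chart_coordK : forall c p, chart_dom c p -> chart_inv c (chart_coord c p) = p ;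
  chart_coord_cont : forall c p, chart_dom c p -> {for p, continuous (chart_coord c)} ;
  chart_inv_cont : forall c x, (chart_coord c @` chart_dom c) x ->
    {for x, continuous (chart_inv c)} ;
  transition_smooth : forall c d (k : 'I_m),
    smooth_on (chart_coord c @` (chart_dom c `&` chart_dom d))
              (fun x => chart_coord d (chart_inv c x) 0 k)
}.

Section Manifolds.
Context {R : realType} {m : nat}.
Implicit Type M : smooth_manifold R m.

Definition chart_img M (c : chart M) : set 'rV[R]_m := chart_coord c @` chart_dom c.

Lemma open_overlap M (c d : chart M) : open (chart_coord c @` (chart_dom c `&` chart_dom d)).
Proof.
rewrite (_ : _ @` _ = (chart_coord c @` chart_dom c) `&`
    (chart_inv c @^-1` chart_dom d)).
  rewrite openE => x [cx dx]; rewrite /interior.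
  apply: filterI; first by apply: open_nbhs_nbhs; split; [exact: open_chart_img|].
  apply: (chart_inv_cont cx).
  by apply: open_nbhs_nbhs; split; [exact: open_chart_dom|].
rewrite eqEsubset; split=> x.
  by move=> [p [cp dp] <-]; split; [exists p|rewrite /preimage /= chart_coordK].
by move=> [[p cp <-]]; rewrite /preimage /= chart_coordK // => dp; exists p.
Qed.

(* J_ik = d x_d^k / d x_c^i *)
Definition transition_jacobian M (c d : chart M) (p : M) : 'M[R]_m :=
  \matrix_(i, k) partial i (fun x => chart_coord d (chart_inv c x) 0 k) (chart_coord c p).

Definition smooth_fun M (f : M -> R) :=
  forall c : chart M, smooth_on (chart_img c) (f \o chart_inv c).

Definition locally_finite (T : topologicalType) (V : set (set T)) :=
  forall x : T, exists2 W, nbhs x W &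
    finite_set [set A | V A /\ A `&` W !=set0].

Definition paracompact (T : topologicalType) :=
  forall U : set (set T), (forall A, U A -> open A) ->
    (forall x, exists2 A, U A & A x) ->
  exists V : set (set T), [/\ forall B, V B -> open B,
    forall x, exists2 B, V B & B x,
    forall B, V B -> exists2 A, U A & B `<=` A &
    locally_finite V].

Definition manifold_axioms M :=
  [/\ hausdorff_space M, connected [set: M] & paracompact M].

End Manifolds.

(* [metric c p] is the matrix g_ij of the metric at p in the chart c. *)
Record semi_riemannian (R : realType) (m : nat) := SemiRiemannian {
  base :> smooth_manifold R m ;
  metric : chart base -> base -> 'M[R]_m ;
  metric_tr : forall c p, chart_dom c p -> (metric c p)^T = metric c p ;
  metric_nondeg : forall c p, chart_dom c p -> metric c p \in unitmx ;
  metric_smooth : forall c i j,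
    smooth_on (chart_img c) (fun x => metric c (chart_inv c x) i j) ;
  metric_compat : forall c d p, chart_dom c p -> chart_dom d p ->
    metric c p = transition_jacobian c d p *m metric d p
                   *m (transition_jacobian c d p)^T
}.

Section LeviCivita.
Context {R : realType} {m : nat}.
Variable G : 'rV[R]_m -> 'M[R]_m.
Implicit Types X Y Z : 'rV[R]_m -> 'rV[R]_m.

Definition christoffel (x : 'rV[R]_m) (i j k : 'I_m) : R :=
  2^-1 * \sum_l invmx (G x) k l *
    (partial i (fun y => G y j l) x + partial j (fun y => G y i l) x
     - partial l (fun y => G y i j) x).

Definition covariant X Y : 'rV[R]_m -> 'rV[R]_m := fun x =>
  \row_k (\sum_i X x 0 i * partial i (fun y => Y y 0 k) x
          + \sum_i \sum_j X x 0 i * Y x 0 j * christoffel x i j k).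

Definition lie_bracket X Y : 'rV[R]_m -> 'rV[R]_m := fun x =>
  \row_k \sum_i (X x 0 i * partial i (fun y => Y y 0 k) x
                 - Y x 0 i * partial i (fun y => X y 0 k) x).

Definition curvature X Y Z : 'rV[R]_m -> 'rV[R]_m := fun x =>
  covariant X (covariant Y Z) x - covariant Y (covariant X Z) x
  - covariant (lie_bracket X Y) Z x.

End LeviCivita.

(* (0,2)-tensors at a point are matrices of components; (0,4)- and           *)
(* (0,6)-tensors are functions of tangent vectors.                           *)
Section TensorAlgebra.
Context {R : realType} {m : nat}.
Notation V := 'rV[R]_m.
Notation tensor4 := (V -> V -> V -> V -> R).
Implicit Types (A E g : 'M[R]_m) (T : tensor4).

Definition bil A (X Y : V) : R := (X *m A *m Y^T) 0 0.

(* [mtrace g A] = g^ij A_ij,  [msquare g A] = g^kl A_ik A_lj *)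
Definition mtrace g A : R := \tr (A *m invmx g).
Definition msquare g A : 'M[R]_m := A *m invmx g *m A.

Definition kulkarni (E T : V -> V -> R) : tensor4 := fun X1 X2 X3 X4 =>
  E X1 X4 * T X2 X3 + E X2 X3 * T X1 X4
  - E X1 X3 * T X2 X4 - E X2 X4 * T X1 X3.

Definition kn E A : tensor4 := kulkarni (bil E) (bil A).

Definition kn4 E T : V -> V -> V -> V -> V -> V -> R :=
  fun X1 X2 X3 X4 Y3 Y4 =>
    kulkarni (bil E) (fun U W => T U W Y3 Y4) X1 X2 X3 X4.

Definition Gtensor g : tensor4 := fun X1 X2 X3 X4 =>
  2^-1 * kn g g X1 X2 X3 X4.

(* the vector W such that g(W, Y) = T(X1, X2, X3, Y) for all Y *)
Definition raise g T (X1 X2 X3 : V) : V :=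
  (\row_j T X1 X2 X3 (basis_vec j)) *m invmx g.

Definition wedge_op A (X Y Z : V) : V := bil A Y Z *: X - bil A X Z *: Y.

(* Action of the endomorphisms D(X, Y) on a tensor, as a derivation. *)
Definition act2 (D : V -> V -> V -> V) (T : V -> V -> R) : tensor4 :=
  fun X1 X2 X Y => - (T (D X Y X1) X2 + T X1 (D X Y X2)).

Definition act4 (D : V -> V -> V -> V) T : V -> V -> V -> V -> V -> V -> R :=
  fun X1 X2 X3 X4 X Y =>
    - (T (D X Y X1) X2 X3 X4 + T X1 (D X Y X2) X3 X4
       + T X1 X2 (D X Y X3) X4 + T X1 X2 X3 (D X Y X4)).

(* B . T *)
Definition dot g (B T : tensor4) := act4 (raise g B) T.

(* Q(A, T) for T of type (0,2) and (0,4) *)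
Definition Q2 A E := act2 (wedge_op A) (bil E).
Definition Q4 A T := act4 (wedge_op A) T.

End TensorAlgebra.

Section Geometry.
Context {R : realType} {m : nat}.
Variable M : semi_riemannian R m.
Implicit Type p : M.

Definition metric_at p : 'M[R]_m := metric (chart_at p) p.

Definition local_metric (c : chart M) (x : 'rV[R]_m) : 'M[R]_m :=
  metric c (chart_inv c x).

(* The curvature operator on T_p M, computed on the extensions of X, Y, Z to *)
(* vector fields with constant components in [chart_at p].                   *)
Definition Rop p (X Y Z : 'rV[R]_m) : 'rV[R]_m :=
  curvature (local_metric (chart_at p)) (fun=> X) (fun=> Y) (fun=> Z)
            (chart_coord (chart_at p) p).

Definition Riem p (X1 X2 X3 X4 : 'rV[R]_m) : R :=
  bil (metric_at p) (Rop p X1 X2 X3) X4.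

Definition Ric p : 'M[R]_m :=
  \matrix_(i, j) \sum_k Rop p (basis_vec k) (basis_vec i) (basis_vec j) 0 k.

Definition Ric2 p : 'M[R]_m := msquare (metric_at p) (Ric p).

Definition scal p : R := mtrace (metric_at p) (Ric p).

Definition Weyl p (X1 X2 X3 X4 : 'rV[R]_m) : R :=
  Riem p X1 X2 X3 X4
  - (m%:R - 2)^-1 * kn (metric_at p) (Ric p) X1 X2 X3 X4
  + scal p / ((m%:R - 2) * (m%:R - 1)) * Gtensor (metric_at p) X1 X2 X3 X4.

Definition constant_curvature :=
  exists k : R, forall p X1 X2 X3 X4,
    Riem p X1 X2 X3 X4 = k * Gtensor (metric_at p) X1 X2 X3 X4.

Definition U_S : set M :=
  [set p | Ric p <> (scal p / m%:R) *: metric_at p].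

Definition U_C : set M :=
  [set p | exists X1 X2 X3 X4, Weyl p X1 X2 X3 X4 <> 0].

Variable f : M -> R.

(* f_a = d_a f *)
Definition gradient p : 'rV[R]_m :=
  \row_a partial a (f \o chart_inv (chart_at p)) (chart_coord (chart_at p) p).

(* nabla_a f_b = d_a f_b - Gamma_ab^c f_c *)
Definition hessian p : 'M[R]_m :=
  let c := chart_at p in let x := chart_coord c p in
  \matrix_(a, b) (partial a (partial b (f \o chart_inv c)) x
    - \sum_k christoffel (local_metric c) x a b k * gradient p 0 k).

(* T_ab = nabla_a f_b - f_a f_b / (2 f) *)
Definition Ttensor p : 'M[R]_m :=
  hessian p - (2 * f p)^-1 *: ((gradient p)^T *m gradient p).

(* Delta_1 f = g^ab f_a f_b *)
Definition Delta1 p : R :=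
  mtrace (metric_at p) ((gradient p)^T *m gradient p).

Definition trT p : R := mtrace (metric_at p) (Ttensor p).
Definition trT2 p : R :=
  mtrace (metric_at p) (msquare (metric_at p) (Ttensor p)).

End Geometry.

Arguments U_S {R m} M.
Arguments U_C {R m} M.

Section SmoothnessTheory.
Context {R : realType} {m k : nat}.

Lemma Ck_cont (l : nat) (U : set 'rV[R]_m) f x :
  Ck l U f -> U x -> {for x, continuous f}.
Proof. by case: l => [|l] [fc _]; exact: fc. Qed.

Lemma CkW (l : nat) (U : set 'rV[R]_m) f : Ck l.+1 U f -> Ck l U f.
Proof.
elim: l f => [|l IH] f [fc fd]; first by split.
by split=> // i; have [? /IH] := fd i.
Qed.

Lemma eq_Ck (l : nat) (U : set 'rV[R]_m) f h : open U ->
  (forall x, U x -> f x = h x) -> Ck l U f -> Ck l U h.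
Proof.
move=> oU; elim: l f h => [|l IH] f h fh.
all: have nfh x : U x -> \near x, f x = h x
  by move=> Ux; apply: filterS (open_nbhs_nbhs (conj oU Ux)) => y; exact: fh.
all: move=> [fc fd]; split=> //.
1,2: by move=> x Ux; rewrite /prop_for /continuous_at -(fh x Ux);
  exact: cvg_trans (near_eq_cvg (nfh x Ux)) (fc x Ux).
move=> i; have [fi Ci] := fd i; split.
  by move=> x Ux; apply: near_eq_derivable (fi x Ux); exact: nfh.
by apply: IH Ci => x Ux; apply: near_eq_derive; exact: nfh.
Qed.

Lemma Ck_cst (l : nat) (U : set 'rV[R]_m) (a : R) : Ck l U (fun=> a).
Proof.
elim: l a => [|l IH] a; split=> //; try by move=> x _; apply: cst_continuous.
move=> i; split; first by move=> x _; apply: (@derivable_cst _ _ _ a x).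
suff -> : partial i (fun=> a) = (fun=> 0 : R) by exact: IH.
by apply: funext => x; rewrite /partial derive_cst.
Qed.

Lemma lsubmx_continuous : continuous (@lsubmx R 1 m k).
Proof.
move=> x A [P xP PA].
exists (fun (i : 'I_1) (j : 'I_(m + k)) =>
  if fintype.split j is inl j' then P i j' else setT) => /=.
  move=> i j; case: (split_ordP j) => j' ->; last exact: filterT.
  by have := xP i j'; rewrite mxE.
move=> y yP; apply: PA => i j; rewrite mxE.
by have := yP i (lshift k j); rewrite (unsplitK (inl j)).
Qed.

Lemma rsubmx_continuous : continuous (@rsubmx R 1 m k).
Proof.
move=> x A [P xP PA].
exists (fun (i : 'I_1) (j : 'I_(m + k)) =>
  if fintype.split j is inr j' then P i j' else setT) => /=.
  move=> i j; case: (split_ordP j) => j' ->; first exact: filterT.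
  by have := xP i j'; rewrite mxE.
move=> y yP; apply: PA => i j; rewrite mxE.
by have := yP i (rshift m j); rewrite (unsplitK (inr j)).
Qed.

Lemma row_mx_continuous (T : topologicalType) (a : T -> 'rV[R]_m)
    (b : T -> 'rV[R]_k) p :
  {for p, continuous a} -> {for p, continuous b} ->
  {for p, continuous (fun q => row_mx (a q) (b q))}.
Proof.
move=> ca cb A [P pP PA].
have : nbhs p (a @^-1` [set y | forall i j, P i (lshift k j) (y i j)]).
  apply: ca; exists (fun i j => P i (lshift k j)) => // i j.
  by have := pP i (lshift k j); rewrite row_mxEl.
have : nbhs p (b @^-1` [set y | forall i j, P i (rshift m j) (y i j)]).
  apply: cb; exists (fun i j => P i (rshift m j)) => // i j.
  by have := pP i (rshift m j); rewrite row_mxEr.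
apply: filterS2 => q /= bq aq; apply: PA => i j.
by case: (split_ordP j) => j' ->; rewrite ?row_mxEl ?row_mxEr.
Qed.

Lemma lsubmx_shift_l (h : R) (i : 'I_m) (x : 'rV[R]_(m + k)) :
  lsubmx (h *: basis_vec (lshift k i) + x) = h *: basis_vec i + lsubmx x.
Proof.
by apply/rowP => j; rewrite !mxE /= eq_lshift.
Qed.

Lemma rsubmx_shift_l (h : R) (i : 'I_m) (x : 'rV[R]_(m + k)) :
  rsubmx (h *: basis_vec (lshift k i) + x) = rsubmx x.
Proof.
by apply/rowP => j; rewrite !mxE /= eq_rlshift mulr0 add0r.
Qed.

Lemma lsubmx_shift_r (h : R) (i : 'I_k) (x : 'rV[R]_(m + k)) :
  lsubmx (h *: basis_vec (rshift m i) + x) = lsubmx x.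
Proof.
by apply/rowP => j; rewrite !mxE /= eq_lrshift mulr0 add0r.
Qed.

Lemma rsubmx_shift_r (h : R) (i : 'I_k) (x : 'rV[R]_(m + k)) :
  rsubmx (h *: basis_vec (rshift m i) + x) = h *: basis_vec i + rsubmx x.
Proof.
by apply/rowP => j; rewrite !mxE /= eq_rshift.
Qed.

Lemma derive_transfer (V W : normedModType R) (a : V -> R) (b : W -> R)
    x y u v :
  (forall h : R, a (h *: u + x) = b (h *: v + y)) ->
  derivable a x u = derivable b y v /\ 'D_u a x = 'D_v b y.
Proof.
move=> ab; have abE : (fun h : R => h^-1 *: ((a \o shift x) (h *: u) - a x)) =
    (fun h : R => h^-1 *: ((b \o shift y) (h *: v) - b y)).
  apply: funext => h /=; rewrite ab; congr (_ *: (_ - _)).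
  by have := ab 0; rewrite !scale0r !add0r.
by rewrite /derivable /derive abE.
Qed.

Lemma lsubmx_transfer_l (a : 'rV[R]_m -> R) i (x : 'rV[R]_(m + k)) :
  derivable (fun y => a (lsubmx y)) x (basis_vec (lshift k i)) =
    derivable a (lsubmx x) (basis_vec i) /\
  partial (lshift k i) (fun y => a (lsubmx y)) x = partial i a (lsubmx x).
Proof. by apply: derive_transfer => h; rewrite lsubmx_shift_l. Qed.

Lemma lsubmx_transfer_r (a : 'rV[R]_m -> R) i (x : 'rV[R]_(m + k)) :
  derivable (fun y => a (lsubmx y)) x (basis_vec (rshift m i)) /\
  partial (rshift m i) (fun y => a (lsubmx y)) x = 0.
Proof.
have [|-> d0] := @derive_transfer _ _ (fun y => a (lsubmx y))
  (cst (a (lsubmx x)) : 'rV[R]_k -> R) x 0 (basis_vec (rshift m i)) 0.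
  by move=> h; rewrite lsubmx_shift_r.
by split; [exact: derivable_cst|rewrite /partial d0 derive_cst].
Qed.

Lemma rsubmx_transfer_l (b : 'rV[R]_k -> R) i (x : 'rV[R]_(m + k)) :
  derivable (fun y => b (rsubmx y)) x (basis_vec (lshift k i)) /\
  partial (lshift k i) (fun y => b (rsubmx y)) x = 0.
Proof.
have [|-> d0] := @derive_transfer _ _ (fun y => b (rsubmx y))
  (cst (b (rsubmx x)) : 'rV[R]_m -> R) x 0 (basis_vec (lshift k i)) 0.
  by move=> h; rewrite rsubmx_shift_l.
by split; [exact: derivable_cst|rewrite /partial d0 derive_cst].
Qed.

Lemma rsubmx_transfer_r (b : 'rV[R]_k -> R) i (x : 'rV[R]_(m + k)) :
  derivable (fun y => b (rsubmx y)) x (basis_vec (rshift m i)) =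
    derivable b (rsubmx x) (basis_vec i) /\
  partial (rshift m i) (fun y => b (rsubmx y)) x = partial i b (rsubmx x).
Proof. by apply: derive_transfer => h; rewrite rsubmx_shift_r. Qed.

End SmoothnessTheory.

Definition mxprod (R : realType) (m k : nat) (U : set 'rV[R]_m)
    (W : set 'rV[R]_k) : set 'rV[R]_(m + k) :=
  [set x | U (lsubmx x) /\ W (rsubmx x)].

Section ProductSmoothness.
Context {R : realType} {m k : nat}.
Variables (U : set 'rV[R]_m) (W : set 'rV[R]_k).

Lemma open_mxprod : open U -> open W -> open (mxprod U W).
Proof.
move=> oU oW; apply: openI.
  exact: open_comp (fun x _ => @lsubmx_continuous R m k x) oU.
exact: open_comp (fun x _ => @rsubmx_continuous R m k x) oW.
Qed.

Lemma Ck_mxprod (l : nat) a b : open U -> open W -> Ck l U a -> Ck l W b ->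
  Ck l (mxprod U W) (fun x => a (lsubmx x) * b (rsubmx x)).
Proof.
move=> oU oW; elim: l a b => [|l IH] a b Ca Cb.
all: have cont x : mxprod U W x ->
  {for x, continuous (fun x => a (lsubmx x) * b (rsubmx x))}.
1,3: move=> [Ux Wx]; apply: continuousM.
1,3: by apply: (@continuous_comp _ _ _ lsubmx a);
  [exact: lsubmx_continuous|exact: Ck_cont Ca Ux].
1,2: by apply: (@continuous_comp _ _ _ rsubmx b);
  [exact: rsubmx_continuous|exact: Ck_cont Cb Wx].
- by split.
split=> // i; case: (split_ordP i) => j ->.
- have da x : U (lsubmx x) ->
      derivable (fun y => a (lsubmx y)) x (basis_vec (lshift k j)).
    by move=> Ux; rewrite (lsubmx_transfer_l a j x).1; exact: (Ca.2 j).1.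
  split=> [x [Ux Wx]|].
    by apply: derivableM; [exact: da|exact: (rsubmx_transfer_l b j x).1].
  apply: eq_Ck (IH _ _ (Ca.2 j).2 (CkW Cb)); first exact: open_mxprod.
  move=> x [Ux Wx]; rewrite /partial deriveM; last exact: (rsubmx_transfer_l b j x).1.
    rewrite -[X in _ = _ *: X + _]/(partial _ _ _) (rsubmx_transfer_l b j x).2 scaler0 add0r.
    by rewrite -[X in _ = _ *: X]/(partial _ _ _) (lsubmx_transfer_l a j x).2 /= mulrC.
  exact: da.
- have db x : W (rsubmx x) ->
      derivable (fun y => b (rsubmx y)) x (basis_vec (rshift m j)).
    by move=> Wx; rewrite (rsubmx_transfer_r b j x).1; exact: (Cb.2 j).1.
  split=> [x [Ux Wx]|].
    by apply: derivableM; [exact: (lsubmx_transfer_r a j x).1|exact: db].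
  apply: eq_Ck (IH _ _ (CkW Ca) (Cb.2 j).2); first exact: open_mxprod.
  move=> x [Ux Wx]; rewrite /partial deriveM; first last.
  + exact: db.
  + exact: (lsubmx_transfer_r a j x).1.
  rewrite -[X in _ = _ + _ *: X]/(partial _ _ _) (lsubmx_transfer_r a j x).2 scaler0 addr0.
  by rewrite -[X in _ = _ *: X]/(partial _ _ _) (rsubmx_transfer_r b j x).2.
Qed.

Lemma smooth_on_mxprod a b : open U -> open W ->
  smooth_on U a -> smooth_on W b ->
  smooth_on (mxprod U W) (fun x => a (lsubmx x) * b (rsubmx x)).
Proof. by move=> oU oW sa sb l; apply: Ck_mxprod. Qed.

Lemma smooth_on_lsubmx a : open U -> open W -> smooth_on U a ->
  smooth_on (mxprod U W) (fun x => a (lsubmx x)).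
Proof.
move=> oU oW sa l; rewrite (_ : (fun x => _) = fun x => a (lsubmx x) * 1).
  by apply: (@Ck_mxprod _ _ (fun=> 1)) => //; exact: Ck_cst.
by apply: funext => x; rewrite mulr1.
Qed.

Lemma smooth_on_rsubmx b : open U -> open W -> smooth_on W b ->
  smooth_on (mxprod U W) (fun x => b (rsubmx x)).
Proof.
move=> oU oW sb l; rewrite (_ : (fun x => _) = fun x => 1 * b (rsubmx x)).
  by apply: (@Ck_mxprod _ (fun=> 1)) => //; exact: Ck_cst.
by apply: funext => x; rewrite mul1r.
Qed.

End ProductSmoothness.

Section Product.
Context {R : realType} {m k : nat}.
Variables (M : smooth_manifold R m) (N : smooth_manifold R k).

Let T : topologicalType := (M * N)%type.
Let pchart : Type := (chart M * chart N)%type.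
Let pdom (c : pchart) : set T := chart_dom c.1 `*` chart_dom c.2.
Let pcoord (c : pchart) (p : T) : 'rV[R]_(m + k) :=
  row_mx (chart_coord c.1 p.1) (chart_coord c.2 p.2).
Let pinv (c : pchart) (x : 'rV[R]_(m + k)) : T :=
  (chart_inv c.1 (lsubmx x), chart_inv c.2 (rsubmx x)).
Let pat (p : T) : pchart := (chart_at p.1, chart_at p.2).

Lemma pimgE (c : pchart) (A : set M) (B : set N) :
  pcoord c @` (A `*` B) = mxprod (chart_coord c.1 @` A) (chart_coord c.2 @` B).
Proof.
rewrite eqEsubset; split=> x.
  by move=> [[p q] [/= Ap Bq] <-]; split; rewrite ?row_mxKl ?row_mxKr;
    [exists p|exists q].
move=> [[p Ap px] [q Bq qx]]; exists (p, q) => //.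
by rewrite /pcoord /= px qx hsubmxK.
Qed.

Fact pat_dom p : pdom (pat p) p.
Proof. by split; exact: chart_atP. Qed.

Fact pdom_open c : open (pdom c).
Proof.
rewrite openE => -[p q] [/= cp cq].
exists (chart_dom c.1, chart_dom c.2) => //.
by split; apply: open_nbhs_nbhs; split=> //; exact: open_chart_dom.
Qed.

Fact pimg_open c : open (pcoord c @` pdom c).
Proof. by rewrite pimgE; apply: open_mxprod; exact: open_chart_img. Qed.

Fact pcoordK c p : pdom c p -> pinv c (pcoord c p) = p.
Proof.
by case: p => p q [/= cp cq]; rewrite /pinv row_mxKl row_mxKr !chart_coordK.
Qed.

Fact pcoord_cont c p : pdom c p -> {for p, continuous (pcoord c)}.
Proof.
move=> [cp cq]; apply: row_mx_continuous.
  by apply: (@continuous_comp _ _ _ fst (chart_coord c.1));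
    [exact: cvg_fst|exact: chart_coord_cont].
by apply: (@continuous_comp _ _ _ snd (chart_coord c.2));
  [exact: cvg_snd|exact: chart_coord_cont].
Qed.

Fact pinv_cont c x : (pcoord c @` pdom c) x -> {for x, continuous (pinv c)}.
Proof.
rewrite pimgE => -[cx dx].
have l_cont : {for x, continuous (chart_inv c.1 \o @lsubmx R 1 m k)}.
  by apply: continuous_comp; [exact: lsubmx_continuous|exact: chart_inv_cont].
have r_cont : {for x, continuous (chart_inv c.2 \o @rsubmx R 1 m k)}.
  by apply: continuous_comp; [exact: rsubmx_continuous|exact: chart_inv_cont].
exact: (cvg_pair l_cont r_cont).
Qed.

Fact ptransition_smooth c d (i : 'I_(m + k)) :
  smooth_on (pcoord c @` (pdom c `&` pdom d))
            (fun x => pcoord d (pinv c x) 0 i).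
Proof.
have -> : pdom c `&` pdom d = (chart_dom c.1 `&` chart_dom d.1) `*`
                              (chart_dom c.2 `&` chart_dom d.2).
  by rewrite /pdom -setXI.
rewrite pimgE /pcoord /pinv /=; case: (split_ordP i) => j ->.
  under eq_fun do rewrite row_mxEl.
  by apply: (smooth_on_lsubmx (a := fun x => chart_coord d.1 (chart_inv c.1 x) 0 j));
    [exact: open_overlap|exact: open_overlap|exact: transition_smooth].
under eq_fun do rewrite row_mxEr.
by apply: (smooth_on_rsubmx (b := fun x => chart_coord d.2 (chart_inv c.2 x) 0 j));
  [exact: open_overlap|exact: open_overlap|exact: transition_smooth].
Qed.

Definition product_manifold : smooth_manifold R (m + k) :=
  SmoothManifold pat_dom pdom_open pimg_open pcoordK pcoord_cont pinv_cont
    ptransition_smooth.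

Lemma product_jacobian (c d : chart product_manifold) p :
  transition_jacobian c d p =
  block_mx (transition_jacobian c.1 d.1 p.1) 0
           0 (transition_jacobian c.2 d.2 p.2).
Proof.
apply/matrixP => i j; rewrite mxE /= /pcoord /pinv /=.
case: (split_ordP j) => j' ->; under eq_fun do rewrite ?row_mxEl ?row_mxEr.
  case: (split_ordP i) => i' ->; rewrite ?block_mxEul ?block_mxEdl !mxE.
    rewrite (lsubmx_transfer_l (fun x => chart_coord d.1 (chart_inv c.1 x) 0 j') _ _).2.
    by rewrite row_mxKl.
  exact: (lsubmx_transfer_r (fun x => chart_coord d.1 (chart_inv c.1 x) 0 j') _ _).2.
case: (split_ordP i) => i' ->; rewrite ?block_mxEur ?block_mxEdr !mxE.
  exact: (rsubmx_transfer_l (fun x => chart_coord d.2 (chart_inv c.2 x) 0 j') _ _).2.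
rewrite (rsubmx_transfer_r (fun x => chart_coord d.2 (chart_inv c.2 x) 0 j') _ _).2.
by rewrite row_mxKr.
Qed.

End Product.

Section WarpedProduct.
Context {R : realType} {m k : nat}.
Variables (M : semi_riemannian R m) (N : semi_riemannian R k) (F : M -> R).
Hypotheses (F_smooth : smooth_fun F) (F_gt0 : forall p, 0 < F p).

Let P := product_manifold M N.

Definition warped_metric (c : chart P) (p : P) : 'M[R]_(m + k) :=
  block_mx (metric c.1 p.1) 0 0 (F p.1 *: metric c.2 p.2).

Fact warped_sym c p : chart_dom c p -> (warped_metric c p)^T = warped_metric c p.
Proof.
move=> [cp cq]; rewrite /warped_metric tr_block_mx !trmx0 linearZ /=.
by rewrite !metric_tr.
Qed.

Fact warped_nondeg c p : chart_dom c p -> warped_metric c p \in unitmx.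
Proof.
move=> [cp cq]; rewrite unitmxE det_ublock unitrM -!unitmxE metric_nondeg //=.
rewrite unitmxE detZ unitrM -unitmxE metric_nondeg // andbT.
by rewrite unitfE expf_neq0 // lt0r_neq0.
Qed.

Fact warped_smooth c i j :
  smooth_on (chart_img c) (fun x => warped_metric c (chart_inv c x) i j).
Proof.
have oM : open (chart_img c.1) by exact: open_chart_img.
have oN : open (chart_img c.2) by exact: open_chart_img.
rewrite /chart_img /= pimgE /warped_metric /=.
case: (split_ordP i) => i' ->; case: (split_ordP j) => j' ->.
- under eq_fun do rewrite block_mxEul.
  apply: (smooth_on_lsubmx (a := fun x => metric c.1 (chart_inv c.1 x) i' j')) => //.
  exact: metric_smooth.
- under eq_fun do rewrite block_mxEur mxE.
  by move=> l; exact: Ck_cst.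
- under eq_fun do rewrite block_mxEdl mxE.
  by move=> l; exact: Ck_cst.
- under eq_fun do rewrite block_mxEdr mxE.
  apply: (smooth_on_mxprod (a := F \o chart_inv c.1)
    (b := fun x => metric c.2 (chart_inv c.2 x) i' j')) => //.
    exact: F_smooth.
  exact: metric_smooth.
Qed.

Fact warped_compat c d p : chart_dom c p -> chart_dom d p ->
  warped_metric c p = transition_jacobian c d p *m warped_metric d p
                        *m (transition_jacobian c d p)^T.
Proof.
move=> [cp cq] [dp dq]; rewrite product_jacobian /warped_metric.
rewrite tr_block_mx !trmx0 !mulmx_block !(mulmx0, mul0mx, addr0, add0r).
by rewrite -scalemxAr -scalemxAl -!metric_compat.
Qed.

Definition warped_product : semi_riemannian R (m + k) :=
  SemiRiemannian warped_sym warped_nondeg warped_smooth warped_compat.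

End WarpedProduct.

(* The functions of the warped product M x_F N (dim M = 2, dim N = n - 2)    *)
(* that are built from the curvatures of the factors and from F.             *)
Section WarpedFunctions.
Context {R : realType} {n : nat}.
Variables (M : semi_riemannian R 2) (N : semi_riemannian R (n - 2)).
Variable F : M -> R.
Implicit Type p : (M * N)%type.

Definition warp_tau1 p : R :=
  scal p.2 / ((n%:R - 2) * F p.1) - trT F p.1 / (2 * F p.1)
  - (n%:R - 3) * Delta1 F p.1 / (4 * F p.1 ^+ 2).

Definition warp_rho p : R :=
  2 * (n%:R - 3) / (n%:R - 1) *
  (scal p.1 / 2 + scal p.2 / ((n%:R - 3) * (n%:R - 2) * F p.1)
   + trT F p.1 / (2 * F p.1) - Delta1 F p.1 / (4 * F p.1 ^+ 2)).

Definition warp_L p : R :=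
  - ((n%:R - 2) / ((n%:R - 1) * warp_rho p)) *
  (scal p.1 * (warp_tau1 p + trT F p.1 / (2 * F p.1))
   + (n%:R - 3) / (4 * F p.1 ^+ 2) * (trT2 F p.1 - trT F p.1 ^+ 2)).

End WarpedFunctions.

Arguments warp_tau1 {R n M} N F p.
Arguments warp_rho {R n M} N F p.
Arguments warp_L {R n M} N F p.

(* Main.v *)
(* Let h and f be the base and fiber parts of the warped metric g = h + f, let
   s be the trace-free part of T, tau = tr(T), and write E /\ A for the
   Kulkarni-Nomizu product.  The curvature tensor is
     R = al/2 h/\h - be tau/2 h/\f + ga/2 f/\f - be s/\f,
   with al = kappa_M / 2, be = 1 / (2 F) and ga the sectional curvature of the
   fiber inside the product.  Since the base is a surface, h/\s = 0,
   s/\s = - e h/\h and s^2 = e h for a scalar e.  Hence S, S^2, R, C, S/\S, ...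
   are all combinations of h, s, f, respectively of h/\h, h/\f, f/\f, s/\f, and C
   is rho times a tensor that depends only on n.  Each identity of the theorem
   thereby becomes a polynomial identity in the values of h, s, f on the six
   arguments, modulo the two relations h/\s = 0 and s/\s = - e h/\h. *)
Require Import Defs.
From HB Require Import structures.
From mathcomp Require Import all_boot all_order all_algebra.
From mathcomp Require Import all_classical all_reals all_analysis.
From mathcomp Require Import ring lra.
Set Implicit Arguments.
Unset Strict Implicit.
Unset Printing Implicit Defensive.
Import Order.TTheory GRing.Theory Num.Theory.
Import numFieldNormedType.Exports.
Local Open Scope classical_set_scope.
Local Open Scope ring_scope.

(** Why C is a fixed tensor times rho: a combination of h/\h, h/\f, f/\f, s/\f with vanishing Ricci
    contraction is unique up to a scalar and has no s/\f part. The same holds for the trace-free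
    part of (n-2)/2 S/\S - kappa g/\S + g/\S^2, so it is a multiple of the same tensor; the factor
    is tr(A^2) - tr(A)^2 up to a constant depending on n, and this is how [tau2] enters. The
    function tau_1 is the Ricci eigenvalue along the fiber, hence A = S - tau_1 g lives on the base
    surface, where Cayley-Hamilton governs it. The obstacle is that the surface relations have four
    arguments while the identities have six, so that normalisation of polynomials cannot find them.
    Derivations Q(f, .) and Q(h, .) carry the relations to six arguments, and each identity that
    needs them is certified by explicit multipliers. Constant curvature is used only at one point at
    a time. A surface has it at each point, with a value that may vary, and this settles both the
    base and the fiber when n = 4. *)

Lemma partialE (R : realType) (m : nat) (i : 'I_m) (f : 'rV[R]_m -> R) x :
  partial i f x = 'D_(basis_vec i) f x.
Proof. by []. Qed.

(* Otherwise the unifier unfolds both sides when comparing distinct partials. *)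
#[local] Opaque partial.

(** * Symmetry of mixed partial derivatives *)

Section MixedPartials.
Context {R : realType} {m : nat}.
Implicit Types (U : set 'rV[R]_m) (f : 'rV[R]_m -> R).

Lemma line_is_derive f (i : 'I_m) (y : 'rV[R]_m) (s : R) :
  derivable f (s *: basis_vec i + y) (basis_vec i) ->
  is_derive s 1 (fun s => f (s *: basis_vec i + y))
    (partial i f (s *: basis_vec i + y)).
Proof.
have [h|e1 e2] := @derive_transfer _ R^o _ (fun s : R => f (s *: basis_vec i + y))
  f s (s *: basis_vec i + y) 1 (basis_vec i).
  by rewrite scalerDl addrA [_ *: 1]mulr1.
by move=> df; apply: DeriveDef; rewrite ?e1.
Qed.

Lemma line_MVT f (i : 'I_m) (y : 'rV[R]_m) (h : R) : 0 < h ->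
  (forall s, 0 <= s <= h -> derivable f (s *: basis_vec i + y) (basis_vec i)) ->
  exists2 s, 0 <= s <= h &
    f (h *: basis_vec i + y) - f y = h * partial i f (s *: basis_vec i + y).
Proof.
move=> h0 df.
have [|||s] := @MVT_segment R (fun s => f (s *: basis_vec i + y))
  (fun s => partial i f (s *: basis_vec i + y)) 0 h.
- exact: ltW.
- move=> s; rewrite in_itv /= => /andP[s0 sh].
  by apply: line_is_derive; apply: df; rewrite !ltW.
- apply: derivable_within_continuous => s; rewrite in_itv /= => sh.
  by have [] := line_is_derive (df s sh).
rewrite in_itv /= scale0r add0r subr0 => sh ->.
by exists s => //; rewrite mulrC.
Qed.

(** The mean value theorem is applied twice: to y -> f (y + h e_j) - f y along e_i, then to
    [partial i f] along e_j. The intermediate points stay in the parallelogram that [U] is assumed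
    to contain. *)
Lemma second_difference U f (i j : 'I_m) x h : Ck 2 U f -> 0 < h ->
  (forall s t, 0 <= s <= h -> 0 <= t <= h ->
    U (s *: basis_vec i + (t *: basis_vec j + x))) ->
  exists s t, [/\ 0 <= s <= h, 0 <= t <= h &
    f (h *: basis_vec i + (h *: basis_vec j + x)) - f (h *: basis_vec i + x)
    - (f (h *: basis_vec j + x) - f x)
    = h * (h * partial j (partial i f) (s *: basis_vec i + (t *: basis_vec j + x)))].
Proof.
move=> [_ fd] h0 hU.
have h0h : 0 <= h <= h by rewrite lexx ltW.
have h00 : 0 <= (0 : R) <= h by rewrite lexx ltW.
have hU0 s : 0 <= s <= h -> U (s *: basis_vec i + x).
  by move=> sh; have := hU s 0 sh h00; rewrite scale0r add0r.
have da s : 0 <= s <= h -> derivable (fun y => f (y + h *: basis_vec j))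
    (s *: basis_vec i + x) (basis_vec i) /\
    partial i (fun y => f (y + h *: basis_vec j)) (s *: basis_vec i + x) =
    partial i f (s *: basis_vec i + (h *: basis_vec j + x)).
  move=> sh; have [k|e1 e2] := @derive_transfer _ _ _
    (fun y => f (y + h *: basis_vec j)) f (s *: basis_vec i + x)
    (s *: basis_vec i + (h *: basis_vec j + x)) (basis_vec i) (basis_vec i).
    by rewrite -!addrA [x + _]addrC.
  rewrite e1; split; last exact: e2.
  by apply: (fd i).1; exact: hU.
have [|s sh] := @line_MVT (fun y => f (y + h *: basis_vec j) - f y) i x h h0.
  move=> s sh; apply: derivableB; first exact: (da s sh).1.
  by apply: (fd i).1; exact: hU0.
have -> : partial i (fun y => f (y + h *: basis_vec j) - f y)
      (s *: basis_vec i + x) =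
    partial i f (s *: basis_vec i + (h *: basis_vec j + x)) -
    partial i f (s *: basis_vec i + x).
  rewrite -(da s sh).2 !partialE deriveB //; first exact: (da s sh).1.
  by apply: (fd i).1; exact: hU0.
have [|t th] := @line_MVT (partial i f) j (s *: basis_vec i + x) h h0.
  move=> t th; apply: ((fd i).2.2 j).1.
  by rewrite addrCA; exact: hU.
have comm a b : b *: basis_vec j + (a *: basis_vec i + x) =
    a *: basis_vec i + (b *: basis_vec j + x) by rewrite addrCA.
rewrite !comm => -> E; exists s, t; split; [exact: sh|exact: th|rewrite -E].
have shift y : y + h *: basis_vec j = h *: basis_vec j + y by rewrite addrC.
by rewrite !shift comm.
Qed.

(** The second difference is symmetric in i and j, so [second_difference] makes the two mixed
    derivatives equal at two points near x; their continuity at x does the rest. *)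
Lemma partialC U f (i j : 'I_m) x : open U -> Ck 2 U f -> U x ->
  partial i (partial j f) x = partial j (partial i f) x.
Proof.
move=> oU Cf Ux.
have cont a b : {for x, continuous (partial a (partial b f))}.
  have [_ /(_ b) [_ [_ /(_ a) [_ [+ _]]]]] := Cf; exact.
apply/eqP; rewrite -subr_eq0 -normr_le0; apply/ler_addgt0Pl => e e0; rewrite addr0.
have e20 : 0 < e / 2 by rewrite divr_gt0.
have /cvgrPdist_lt /(_ _ e20) c1 := cont i j.
have /cvgrPdist_lt /(_ _ e20) c2 := cont j i.
have nU : nbhs x U by exact: open_nbhs_nbhs.
have [d /= d0 dU] := (nbhs_normP _ _).1 (filterI (filterI nU c1) c2).
(* Points with both parameters in [0, h] are within h * B = d / 2 of x; the summand 1 makes [B]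
   positive. *)
pose B := `|basis_vec i : 'rV[R]_m| + `|basis_vec j : 'rV[R]_m| + 1.
have B0 : 0 < B by rewrite ltr_wpDl // addr_ge0.
pose h := d / 2 / B.
have h0 : 0 < h by rewrite !divr_gt0.
have hd s t : 0 <= s <= h -> 0 <= t <= h ->
    `|x - (s *: basis_vec i + (t *: basis_vec j + x))| < d.
  move=> /andP[s0 sh] /andP[t0 th].
  rewrite addrA opprD addrCA subrr addr0 normrN.
  apply: (le_lt_trans (ler_normD _ _)); rewrite !normrZ (ger0_norm s0) (ger0_norm t0).
  apply: (@le_lt_trans _ _ (h * B)).
    rewrite /B !mulrDr mulr1 -addrA lerD // ?ler_wpM2r //.
    by rewrite -[leLHS]addr0 lerD ?ler_wpM2r // ltW.
  by rewrite /h divfK ?gt_eqF // ltr_pdivrMr // ltr_pMr // ltr1n.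
have near_s s t : 0 <= s <= h -> 0 <= t <= h -> _ :=
  fun sh th => dU _ (hd s t sh th).
have [|s [t [sh th E1]]] := @second_difference U f i j x h Cf h0.
  by move=> s t sh th; have [[Us _] _] := near_s _ _ sh th.
have [|s' [t' [sh' th' E2]]] := @second_difference U f j i x h Cf h0.
  by move=> s' t' sh' th'; have [[Us _] _] := near_s _ _ th' sh'; rewrite addrCA.
(* Both values are the common second difference divided twice by h. *)
have E : partial j (partial i f) (s *: basis_vec i + (t *: basis_vec j + x)) =
    partial i (partial j f) (t' *: basis_vec i + (s' *: basis_vec j + x)).
  apply: (mulfI (lt0r_neq0 h0)); apply: (mulfI (lt0r_neq0 h0)).
  have comm a b : b *: basis_vec j + (a *: basis_vec i + x) =
      a *: basis_vec i + (b *: basis_vec j + x) by rewrite addrCA.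
  apply: etrans (esym E1) _; apply: etrans _ (congr1
    (fun z => h * (h * partial i (partial j f) z)) (comm t' s')).
  apply: etrans _ E2; rewrite (comm h h) -!addrA; congr (_ + _).
  by rewrite !opprB [LHS]addrCA [RHS]addrCA; congr (_ + _); exact: addrC.
have [_ n1] := near_s _ _ sh th; have [[_ n2] _] := near_s _ _ th' sh'.
move: n1 n2; rewrite E; move: (partial i _ x) (partial j _ x) (partial i _ _).
move=> a b c n1 n2; rewrite [e in _ <= e]splitr; apply: ltW.
apply: le_lt_trans (ltrD n2 n1); rewrite (distrC b).
by rewrite -[a - b](subrKA c); exact: ler_normD.
Qed.

End MixedPartials.

(** * Derivatives of sums, determinants and inverse matrices *)

Section DerivableMatrices.
Context {R : realType} {V : normedModType R}.
Implicit Types (x v : V).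

Lemma derivable_bigsum (I : Type) (r : seq I) (P : pred I) (F : I -> V -> R) x v :
  (forall i, P i -> derivable (F i) x v) ->
  derivable (fun y => \sum_(i <- r | P i) F i y) x v.
Proof.
move=> dF; elim: r => [|i r IH].
  by under eq_fun do rewrite big_nil; exact: derivable_cst.
under eq_fun do rewrite big_cons.
case: ifP => Pi; last exact: IH.
exact: derivableD (dF i Pi) IH.
Qed.

Lemma derive_bigsum (I : Type) (r : seq I) (P : pred I) (F : I -> V -> R) x v :
  (forall i, P i -> derivable (F i) x v) ->
  'D_v (fun y => \sum_(i <- r | P i) F i y) x = \sum_(i <- r | P i) 'D_v (F i) x.
Proof.
move=> dF; elim: r => [|i r IH].
  by under eq_fun do rewrite big_nil; rewrite big_nil derive_cst.
under eq_fun do rewrite big_cons; rewrite big_cons.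
case: ifP => // Pi; rewrite -IH deriveD //; first exact: dF.
exact: derivable_bigsum.
Qed.

Lemma derivable_bigprod (I : Type) (r : seq I) (P : pred I) (F : I -> V -> R) x v :
  (forall i, P i -> derivable (F i) x v) ->
  derivable (fun y => \prod_(i <- r | P i) F i y) x v.
Proof.
move=> dF; elim: r => [|i r IH].
  by under eq_fun do rewrite big_nil; exact: derivable_cst.
under eq_fun do rewrite big_cons.
case: ifP => Pi; last exact: IH.
exact: derivableM (dF i Pi) IH.
Qed.

Lemma derivable_det (k : nat) (A : V -> 'M[R]_k) x v :
  (forall i j, derivable (fun y => A y i j) x v) ->
  derivable (fun y => \det (A y)) x v.
Proof.
move=> dA; apply: derivable_bigsum => s _; apply: derivableM.
  exact: derivable_cst.
exact: derivable_bigprod.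
Qed.

Lemma derivable_invmx (k : nat) (A : V -> 'M[R]_k) x v i j :
  (forall i j, derivable (fun y => A y i j) x v) -> A x \in unitmx ->
  (\near x, A x \in unitmx) ->
  derivable (fun y => invmx (A y) i j) x v.
Proof.
move=> dA Ax nA.
have ddet := derivable_det dA.
have det0 : \det (A x) != 0 by rewrite -unitfE -unitmxE.
(* Off the invertible matrices [invmx] returns its argument, so the cofactor formula holds only on
   the neighbourhood provided by [nA]. *)
apply: (@near_eq_derivable _ V R^o
  (fun y => (\det (A y))^-1 * ((-1) ^+ (j + i) * \det (row' j (col' i (A y))))))%R.
  near=> y; have Ay : A y \in unitmx by near: y.
  by rewrite /invmx Ay !mxE /cofactor.
apply: derivableM; first exact: derivableV.
apply: derivableM; first exact: derivable_cst.
apply: derivable_det => a b.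
by under eq_fun do rewrite !mxE; exact: dA.
Unshelve. all: by end_near.
Qed.

End DerivableMatrices.

Section PartialRules.
Context {R : realType} {m : nat}.
Implicit Types (f g : 'rV[R]_m -> R) (i : 'I_m).

Lemma partialD f g i x : derivable f x (basis_vec i) ->
  derivable g x (basis_vec i) ->
  partial i (fun y => f y + g y) x = partial i f x + partial i g x.
Proof. by move=> df dg; rewrite !partialE deriveD. Qed.

Lemma partialB f g i x : derivable f x (basis_vec i) ->
  derivable g x (basis_vec i) ->
  partial i (fun y => f y - g y) x = partial i f x - partial i g x.
Proof. by move=> df dg; rewrite !partialE deriveB. Qed.

Lemma partialM f g i x : derivable f x (basis_vec i) ->
  derivable g x (basis_vec i) ->
  partial i (fun y => f y * g y) x = partial i f x * g x + f x * partial i g x.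
Proof.
move=> df dg; apply: etrans (deriveM df dg) _.
by rewrite addrC; congr (_ + _); exact: mulrC.
Qed.

Lemma partial_cst (r : R) i (x : 'rV[R]_m) : partial i (fun=> r) x = 0.
Proof. by rewrite partialE derive_cst. Qed.

Lemma partialZ (r : R) f i x : derivable f x (basis_vec i) ->
  partial i (fun y => r * f y) x = r * partial i f x.
Proof.
move=> df; rewrite (partialM (derivable_cst r x _) df) partial_cst.
by rewrite mul0r add0r.
Qed.

End PartialRules.

Lemma sumr_mul_exchange {R : pzRingType} {m : nat} (p g : 'I_m -> R)
    (A : 'I_m -> 'I_m -> R) :
  \sum_h (\sum_e p e * A e h) * g h = \sum_e p e * (\sum_h A e h * g h).
Proof.
under eq_bigr do rewrite mulr_suml.
rewrite exchange_big; apply: eq_bigr => e _; rewrite mulr_sumr.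
by apply: eq_bigr => h _; rewrite mulrA.
Qed.

(** * Curvature in a chart *)

Section LocalCurvature.
Context {R : realType} {m : nat}.
Variables (G : 'rV[R]_m -> 'M[R]_m) (U : set 'rV[R]_m).
Hypotheses (oU : open U) (G_smooth : forall i j, smooth_on U (fun x => G x i j))
  (G_sym : forall x, U x -> (G x)^T = G x) (G_unit : forall x, U x -> G x \in unitmx).
Implicit Types (x : 'rV[R]_m) (i j k l : 'I_m).

Let near_U x (P : 'rV[R]_m -> Prop) : (forall y, U y -> P y) -> U x -> \near x, P x.
Proof. by move=> UP Ux; apply: filterS (open_nbhs_nbhs (conj oU Ux)). Qed.

Let dG x i j k : U x -> derivable (fun y => G y j k) x (basis_vec i).
Proof. by move=> Ux; have [_ /(_ i) [+ _]] := G_smooth j k 1; exact. Qed.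

Let ddG x i j k l : U x ->
  derivable (partial l (fun y => G y j k)) x (basis_vec i).
Proof.
by move=> Ux; have [_ /(_ l) [_ [_ /(_ i) [+ _]]]] := G_smooth j k 2; exact.
Qed.

Let G_symE x i j : U x -> G x i j = G x j i.
Proof. by move=> Ux; rewrite -{1}G_sym // mxE. Qed.

Let dG_sym x i j k : U x ->
  partial i (fun y => G y j k) x = partial i (fun y => G y k j) x.
Proof.
move=> Ux; apply: near_eq_derive.
by apply: near_U Ux => y Uy; rewrite G_symE.
Qed.

Lemma derivable_christoffel x h i j k : U x ->
  derivable (fun y => christoffel G y i j k) x (basis_vec h).
Proof.
move=> Ux; apply: derivableM; first exact: derivable_cst.
apply: derivable_bigsum => l _; apply: derivableM.
  apply: derivable_invmx => [a b||]; first exact: dG.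
    exact: G_unit.
  by apply: near_U Ux => y; exact: G_unit.
by apply: derivableB; [apply: derivableD|]; exact: ddG.
Qed.

Lemma christoffel_sym x i j k : U x ->
  christoffel G x i j k = christoffel G x j i k.
Proof.
move=> Ux; rewrite /christoffel; congr (_ * _); apply: eq_bigr => l _.
congr (_ * _); rewrite (@dG_sym x l i j) //; ring.
Qed.

(** The inverse metric cancels, leaving the symbols of the first kind; these can be differentiated
    using second derivatives of [G] alone. *)
Lemma christoffel_lower x i j k : U x ->
  \sum_l christoffel G x i j l * G x l k =
  2^-1 * (partial i (fun y => G y j k) x + partial j (fun y => G y i k) x
     - partial k (fun y => G y i j) x).
Proof.
move=> Ux; pose D l := partial i (fun y => G y j l) x + partial j (fun y => G y i l) x
     - partial l (fun y => G y i j) x.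
have -> : \sum_l christoffel G x i j l * G x l k =
    2^-1 * ((\row_l D l) *m invmx (G x)^T *m G x) 0 k.
  rewrite mxE mulr_sumr; apply: eq_bigr => l _; rewrite /christoffel mulrA.
  congr (_ * _ * _); rewrite mxE; apply: eq_bigr => a _; rewrite mxE mulrC.
  by rewrite -trmx_inv mxE.
by rewrite G_sym // mulmxKV ?G_unit // mxE.
Qed.

(** This is nabla G = 0: in the sum of the two first-kind symbols all derivatives but one cancel. *)
Lemma metric_compatible x i j k : U x ->
  partial i (fun y => G y j k) x =
  \sum_l christoffel G x i j l * G x l k + \sum_l christoffel G x i k l * G x l j.
Proof.
move=> Ux; rewrite !christoffel_lower // (@dG_sym x i k j) //.
by rewrite (@dG_sym x k i j) // (@dG_sym x j i k) //; field.
Qed.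

#[local] Opaque christoffel.

(** The component R_ijk^l, in the convention R(e_i, e_j) e_k = R_ijk^l e_l. *)
Definition curv_comp x i j k l : R :=
  partial i (fun y => christoffel G y j k l) x
  - partial j (fun y => christoffel G y i k l) x
  + \sum_h (christoffel G x j k h * christoffel G x i h l
            - christoffel G x i k h * christoffel G x j h l).

(** For fields with constant components the bracket vanishes and the inner covariant derivative is a
    pure Christoffel sum, so only the outer one differentiates anything. *)
Lemma curvature_comp X Y Z x l : U x ->
  curvature G (fun=> X) (fun=> Y) (fun=> Z) x 0 l =
  \sum_i \sum_j \sum_k X 0 i * Y 0 j * Z 0 k * curv_comp x i j k l.
Proof.
move=> Ux.
have cov0 A B : covariant G (fun=> A) (fun=> B) =
    fun y => \row_k \sum_i \sum_j A 0 i * B 0 j * christoffel G y i j k.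
  apply: funext => y; apply/rowP => k; rewrite !mxE [X in X + _]big1 ?add0r //.
  by move=> i _; rewrite partialE derive_cst mulr0.
have br0 : lie_bracket (fun=> X) (fun=> Y) = fun=> 0.
  apply: funext => y; apply/rowP => k; rewrite !mxE big1 // => i _.
  by rewrite !partialE !derive_cst !mulr0 subrr.
have cov2 A B : covariant G (fun=> A) (covariant G (fun=> B) (fun=> Z)) x 0 l =
    \sum_i \sum_j \sum_k A 0 i * B 0 j * Z 0 k *
      (partial i (fun y => christoffel G y j k l) x
       + \sum_h christoffel G x j k h * christoffel G x i h l).
  rewrite cov0 !mxE -big_split /=; apply: eq_bigr => i _.
  have -> : partial i (fun y => (\row_k \sum_j \sum_h
      B 0 j * Z 0 h * christoffel G y j h k) 0 l) x =
      \sum_j \sum_k B 0 j * Z 0 k * partial i (fun y => christoffel G y j k l) x.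
    under eq_fun do rewrite mxE.
    rewrite [LHS]derive_bigsum => [|j _]; last first.
      apply: derivable_bigsum => k _; apply: derivableM; first exact: derivable_cst.
      exact: derivable_christoffel.
    apply: eq_bigr => j _; rewrite derive_bigsum => [|k _]; last first.
      by apply: derivableM; [exact: derivable_cst|exact: derivable_christoffel].
    by apply: eq_bigr => k _; apply: partialZ; exact: derivable_christoffel.
  have -> : \sum_j A 0 i * (\row_k \sum_i \sum_j B 0 i * Z 0 j *
       christoffel G x i j k) 0 j * christoffel G x i j l =
     \sum_j \sum_k A 0 i * (B 0 j * Z 0 k *
       \sum_h christoffel G x j k h * christoffel G x i h l).
    under eq_bigr do rewrite mxE mulr_sumr mulr_suml.
    rewrite exchange_big /=; apply: eq_bigr => j _.
    under eq_bigr do rewrite mulr_sumr mulr_suml.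
    rewrite exchange_big /=; apply: eq_bigr => k _.
    by rewrite mulr_sumr mulr_sumr; apply: eq_bigr => h _; ring.
  rewrite mulr_sumr -big_split /=; apply: eq_bigr => j _.
  by rewrite mulr_sumr -big_split /=; apply: eq_bigr => k _; ring.
have coordB (a b c : 'rV[R]_m) : (a - b - c) 0 l = a 0 l - b 0 l - c 0 l.
  by rewrite !mxE.
rewrite /curvature coordB br0 (cov2 X Y) (cov2 Y X) (cov0 0 Z).
rewrite [X in _ - _ - X]mxE [X in _ - _ - X]big1 => [|i _]; last first.
  by rewrite big1 // => j _; rewrite mxE !mul0r.
rewrite subr0 [X in _ - X]exchange_big -sumrB; apply: eq_bigr => i _.
rewrite -sumrB; apply: eq_bigr => j _; rewrite -sumrB; apply: eq_bigr => k _.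
rewrite /curv_comp sumrB; move: (partial i _ _) (partial j _ _) => a b.
by rewrite [Y 0 j * _]mulrC -mulrBr; congr (_ * _); rewrite opprD addrACA.
Qed.

Lemma curv_comp_skew x i j k l : curv_comp x i j k l = - curv_comp x j i k l.
Proof.
rewrite /curv_comp !sumrB; move: (partial i _ _) (partial j _ _) => a b.
by rewrite opprD !opprB.
Qed.

Definition curv_low x i j k l : R := \sum_h curv_comp x i j k h * G x h l.

Lemma curv_low_skew12 x i j k l : curv_low x i j k l = - curv_low x j i k l.
Proof.
by rewrite /curv_low -sumrN; apply: eq_bigr => h _; rewrite curv_comp_skew mulNr.
Qed.

(** Metric compatibility reduces the lowered tensor to second derivatives of [G] and products of two
    Christoffel symbols contracted by [G]. The former are antisymmetric in k, l because partial
    derivatives commute, the latter because the contraction is symmetric. *)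
Lemma curv_low_skew34 x i j k l : U x ->
  curv_low x i j k l = - curv_low x i j l k.
Proof.
move=> Ux; pose Ga := christoffel G x.
(* The three families are introduced through existentials to be opaque atoms for [ring]: second
   derivatives of [G], and products of Christoffel symbols with the last one lowered at a free index
   ([Q]) or at the summed index ([K]). *)
have [D2 D2E] : exists D2 : 'I_m -> 'I_m -> 'I_m -> 'I_m -> R, forall a b c d,
    partial a (partial b (fun y => G y c d)) x = D2 a b c d by eexists.
have [Q QE] : exists Q : 'I_m -> 'I_m -> 'I_m -> 'I_m -> R, forall a b c d,
    \sum_h Ga a b h * (\sum_e Ga c h e * G x e d) = Q a b c d by eexists.
have [K KE] : exists K : 'I_m -> 'I_m -> 'I_m -> 'I_m -> R, forall a b c d,
    \sum_h Ga a b h * (\sum_e Ga c d e * G x e h) = K a b c d by eexists.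
have D2C a b c d : D2 a b c d = D2 b a c d.
  by rewrite -!D2E; apply: (@partialC _ _ U) => //; exact: G_smooth.
have KC a b c d : K a b c d = K c d a b.
  rewrite -!KE; under eq_bigr do rewrite mulr_sumr.
  rewrite exchange_big; apply: eq_bigr => e _; rewrite mulr_sumr.
  apply: eq_bigr => h _; rewrite (@G_symE x e h) //.
  by rewrite mulrCA.
(* Product rule applied to [christoffel_lower], with the derivative of [G] replaced by means of
   [metric_compatible]. *)
have dlow a b c d :
    \sum_h partial a (fun y => christoffel G y b c h) x * G x h d =
    2^-1 * (D2 a b c d + D2 a c b d - D2 a d b c) - (Q b c a d + K b c a d).
  have -> : Q b c a d + K b c a d = \sum_h Ga b c h * partial a (fun y => G y h d) x.
    rewrite -QE -KE -big_split; apply: eq_bigr => h _ /=.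
    by rewrite (@metric_compatible x a h d Ux) mulrDr.
  have -> : 2^-1 * (D2 a b c d + D2 a c b d - D2 a d b c) =
      partial a (fun y => \sum_h christoffel G y b c h * G y h d) x.
    have d1 := @ddG x a c d b Ux; have d2 := @ddG x a b d c Ux.
    have d3 := @ddG x a b c d Ux; have d12 := derivableD d1 d2.
    have -> : partial a (fun y => \sum_h christoffel G y b c h * G y h d) x =
      partial a (fun y => 2^-1 * (partial b (fun y => G y c d) y +
        partial c (fun y => G y b d) y - partial d (fun y => G y b c) y)) x.
      by apply: near_eq_derive; apply: near_U Ux => y; exact: christoffel_lower.
    apply: etrans _ (esym (partialZ _ (derivableB d12 d3))); congr (_ * _).
    apply: etrans _ (esym (partialB d12 d3)); rewrite D2E; congr (_ - _).
    by apply: etrans _ (esym (partialD d1 d2)); rewrite !D2E.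
  apply/eqP; rewrite eq_sym subr_eq -big_split; apply/eqP.
  have dCG h : xpredT h ->
      derivable (fun y => christoffel G y b c h * G y h d) x (basis_vec a).
    by move=> _; apply: derivableM; [exact: derivable_christoffel|exact: dG].
  apply: etrans (derive_bigsum (index_enum _) dCG) _; apply: eq_bigr => h _.
  exact: partialM (@derivable_christoffel x a b c h Ux) (@dG x a h d Ux).
(* The [Q] terms cancel within this expression; the [K] terms cancel, through [KC], only against the
   expression with k and l exchanged. *)
have lowE c d : curv_low x i j c d =
   2^-1 * (D2 i j c d + D2 i c j d - D2 i d j c) - (Q j c i d + K j c i d)
   - (2^-1 * (D2 j i c d + D2 j c i d - D2 j d i c) - (Q i c j d + K i c j d))
   + Q j c i d - Q i c j d.
  rewrite -!dlow -!QE /curv_low /curv_comp /Ga -!sumr_mul_exchange.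
  rewrite -sumrB -big_split -sumrB; apply: eq_bigr => h _ /=.
  by rewrite mulrDl mulrBl sumrB mulrBl addrA.
apply/eqP; rewrite -addr_eq0 !lowE (KC j k) (KC j l).
by rewrite (D2C j i k l) (D2C j i l k); apply/eqP; ring.
Qed.

End LocalCurvature.

(** * Bilinear and quadrilinear forms in components *)

Section MultilinearForms.
Context {R : realType} {m : nat}.
Notation vec := 'rV[R]_m.
Implicit Types (A E : 'M[R]_m) (X Y : vec).

Definition mlin4 (a : 'I_m -> 'I_m -> 'I_m -> 'I_m -> R) (X1 X2 X3 X4 : vec) : R :=
  \sum_i \sum_j \sum_k \sum_l X1 0 i * X2 0 j * X3 0 k * X4 0 l * a i j k l.

Lemma bilE A X Y : bil A X Y = \sum_i \sum_j X 0 i * Y 0 j * A i j.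
Proof.
rewrite /bil mxE exchange_big; apply: eq_bigr => j _.
by rewrite !mxE mulr_suml; apply: eq_bigr => i _; rewrite mulrAC.
Qed.

Lemma eq_mlin4 a b X1 X2 X3 X4 : (forall i j k l, a i j k l = b i j k l) ->
  mlin4 a X1 X2 X3 X4 = mlin4 b X1 X2 X3 X4.
Proof.
by move=> ab; do 4 (apply: eq_bigr => ? _); rewrite ab.
Qed.

Lemma mlin4D a b X1 X2 X3 X4 :
  mlin4 (fun i j k l => a i j k l + b i j k l) X1 X2 X3 X4 =
  mlin4 a X1 X2 X3 X4 + mlin4 b X1 X2 X3 X4.
Proof.
rewrite -big_split /=; do 3 (apply: eq_bigr => ? _; rewrite -big_split /=).
by apply: eq_bigr => ? _; rewrite mulrDr.
Qed.

Lemma mlin4Z r a X1 X2 X3 X4 :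
  mlin4 (fun i j k l => r * a i j k l) X1 X2 X3 X4 = r * mlin4 a X1 X2 X3 X4.
Proof.
rewrite mulr_sumr; do 3 (apply: eq_bigr => ? _; rewrite mulr_sumr).
by apply: eq_bigr => ? _; rewrite mulrCA.
Qed.

Lemma mlin4N a X1 X2 X3 X4 :
  mlin4 (fun i j k l => - a i j k l) X1 X2 X3 X4 = - mlin4 a X1 X2 X3 X4.
Proof. by rewrite -mulN1r -mlin4Z; apply: eq_mlin4 => i j k l; rewrite mulN1r. Qed.

Lemma mlin4_bil14 A E X1 X2 X3 X4 : bil A X1 X4 * bil E X2 X3 =
  mlin4 (fun i j k l => A i l * E j k) X1 X2 X3 X4.
Proof.
rewrite !bilE mulr_suml; apply: eq_bigr => i _; rewrite mulr_sumr.
apply: eq_bigr => j _; rewrite mulr_sumr; apply: eq_bigr => k _.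
by rewrite mulr_suml; apply: eq_bigr => l _; ring.
Qed.

Lemma mlin4_bil13 A E X1 X2 X3 X4 : bil A X1 X3 * bil E X2 X4 =
  mlin4 (fun i j k l => A i k * E j l) X1 X2 X3 X4.
Proof.
rewrite !bilE mulr_suml; apply: eq_bigr => i _; rewrite mulr_sumr.
apply: eq_bigr => j _; rewrite mulr_suml; apply: eq_bigr => k _.
by rewrite mulr_sumr; apply: eq_bigr => l _; ring.
Qed.

Lemma kn_mlin4 A E X1 X2 X3 X4 : kn A E X1 X2 X3 X4 =
  mlin4 (fun i j k l => A i l * E j k + A j k * E i l - A i k * E j l - A j l * E i k)
    X1 X2 X3 X4.
Proof.
rewrite /kn /kulkarni [bil A X2 X3 * _]mulrC [bil A X2 X4 * _]mulrC.
rewrite (mlin4_bil14 A E) (mlin4_bil14 E A) (mlin4_bil13 A E) (mlin4_bil13 E A).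
rewrite -!mlin4N -!mlin4D; apply: eq_mlin4 => i j k l; ring.
Qed.

Lemma Gtensor_mlin4 g X1 X2 X3 X4 : Gtensor g X1 X2 X3 X4 =
  mlin4 (fun i j k l => g i l * g j k - g i k * g j l) X1 X2 X3 X4.
Proof.
rewrite /Gtensor kn_mlin4 -mlin4Z; apply: eq_mlin4 => i j k l.
by field.
Qed.

End MultilinearForms.

(** * Components of the Riemann tensor at a point *)

Section RiemannComponents.
Context {R : realType} {m : nat}.
Variable M : semi_riemannian R m.
Implicit Types (c : chart M) (p : M).

Lemma chart_img_inv c x : chart_img c x -> chart_dom c (chart_inv c x).
Proof. by case=> p cp <-; rewrite chart_coordK. Qed.

Lemma local_metric_tr c x : chart_img c x -> (local_metric c x)^T = local_metric c x.
Proof. by move=> /chart_img_inv; exact: metric_tr. Qed.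

Lemma local_metric_unit c x : chart_img c x -> local_metric c x \in unitmx.
Proof. by move=> /chart_img_inv; exact: metric_nondeg. Qed.

Lemma chart_img_at p : chart_img (chart_at p) (chart_coord (chart_at p) p).
Proof. by exists p => //; exact: chart_atP. Qed.

Lemma metric_atE p :
  metric_at p = local_metric (chart_at p) (chart_coord (chart_at p) p).
Proof. by rewrite /local_metric chart_coordK //; exact: chart_atP. Qed.

Lemma Rop_comp p X Y Z l : Rop p X Y Z 0 l =
  \sum_i \sum_j \sum_k X 0 i * Y 0 j * Z 0 k * curv_comp
    (local_metric (chart_at p)) (chart_coord (chart_at p) p) i j k l.
Proof.
exact: (curvature_comp (G := local_metric (chart_at p))
  (@open_chart_img _ _ M (chart_at p)) (@metric_smooth _ _ M _)
  (@local_metric_unit _) X Y Z l (chart_img_at p)).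
Qed.

Definition riem_comp p := curv_low (local_metric (chart_at p))
  (chart_coord (chart_at p) p).

Lemma Riem_mlin4 p X1 X2 X3 X4 :
  Riem p X1 X2 X3 X4 = mlin4 (riem_comp p) X1 X2 X3 X4.
Proof.
rewrite /Riem bilE metric_atE.
under eq_bigr => h _ do under eq_bigr => l _ do rewrite Rop_comp.
under eq_bigr => h _ do under eq_bigr => l _ do
  (rewrite !mulr_suml; under eq_bigr => i _ do (rewrite !mulr_suml;
   under eq_bigr => j _ do rewrite !mulr_suml)).
rewrite exchange_big /=.
under eq_bigr => l _ do rewrite exchange_big /=.
rewrite exchange_big; apply: eq_bigr => i _ /=.
under eq_bigr => l _ do rewrite exchange_big /=.
under eq_bigr => l _ do under eq_bigr => j _ do rewrite exchange_big /=.
under eq_bigr => l _ do under eq_bigr => h _ do rewrite exchange_big /=.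
rewrite exchange_big; apply: eq_bigr => j _ /=.
under [LHS]eq_bigr => h _ do rewrite exchange_big /=.
rewrite exchange_big; apply: eq_bigr => k _ /=.
apply: eq_bigr => l _; rewrite /riem_comp /curv_low mulr_sumr.
by apply: eq_bigr => h _; ring.
Qed.

Lemma riem_comp_skew12 p i j k l : riem_comp p i j k l = - riem_comp p j i k l.
Proof. exact: curv_low_skew12. Qed.

Lemma riem_comp_skew34 p i j k l : riem_comp p i j k l = - riem_comp p i j l k.
Proof.
apply: (curv_low_skew34 (@open_chart_img _ _ M (chart_at p))).
- exact: metric_smooth.
- exact: local_metric_tr.
- exact: local_metric_unit.
- exact: chart_img_at.
Qed.

Lemma metric_at_unit p : metric_at p \in unitmx.
Proof. exact: metric_nondeg (chart_atP p). Qed.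

Lemma metric_at_tr p : (metric_at p)^T = metric_at p.
Proof. exact: metric_tr (chart_atP p). Qed.

End RiemannComponents.

Lemma invmx_block_diag (F : fieldType) (m k : nat) (A : 'M[F]_m) (B : 'M[F]_k) :
  A \in unitmx -> B \in unitmx ->
  invmx (block_mx A 0 0 B) = block_mx (invmx A) 0 0 (invmx B).
Proof.
move=> uA uB; have uAB : block_mx A 0 0 B \in unitmx.
  by rewrite unitmxE det_ublock unitrM -!unitmxE uA.
apply: (can_inj (mulKmx uAB)); rewrite mulmxV // mulmx_block.
by rewrite !(mulmx0, mul0mx, addr0, add0r) !mulmxV // scalar_mx_block.
Qed.

(** * Christoffel symbols and curvature of a warped metric *)

Section LocalWarpedMetric.
Context {R : realType} {m k : nat}.
Variables (G1 : 'rV[R]_m -> 'M[R]_m) (U1 : set 'rV[R]_m).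
Variables (G2 : 'rV[R]_k -> 'M[R]_k) (U2 : set 'rV[R]_k).
Variable phi : 'rV[R]_m -> R.
Hypotheses (oU1 : open U1) (G1_smooth : forall i j, smooth_on U1 (fun x => G1 x i j))
  (G1_sym : forall x, U1 x -> (G1 x)^T = G1 x)
  (G1_unit : forall x, U1 x -> G1 x \in unitmx).
Hypotheses (oU2 : open U2) (G2_smooth : forall i j, smooth_on U2 (fun x => G2 x i j))
  (G2_sym : forall x, U2 x -> (G2 x)^T = G2 x)
  (G2_unit : forall x, U2 x -> G2 x \in unitmx).
Hypotheses (phi_smooth : smooth_on U1 phi) (phi_neq0 : forall x, U1 x -> phi x != 0).

(** Chart-level model of the warped metric, so that the computation runs on open sets of coordinate
    spaces; [Riem_warped] identifies the two by conversion. *)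
Definition warped_local (y : 'rV[R]_(m + k)) : 'M[R]_(m + k) :=
  block_mx (G1 (lsubmx y)) 0 0 (phi (lsubmx y) *: G2 (rsubmx y)).

Notation W := warped_local.
Notation L := (lshift k).
Notation H := (rshift m).
Let U : set 'rV[R]_(m + k) := mxprod U1 U2.
Implicit Types (x y : 'rV[R]_(m + k)) (a b c d e : 'I_m) (r s t u : 'I_k).

Let WLL y a b : W y (L a) (L b) = G1 (lsubmx y) a b.
Proof. by rewrite /W block_mxEul. Qed.

Let WLH y a s : W y (L a) (H s) = 0.
Proof. by rewrite /W block_mxEur mxE. Qed.

Let WHL y s a : W y (H s) (L a) = 0.
Proof. by rewrite /W block_mxEdl mxE. Qed.

Let WHH y s t : W y (H s) (H t) = phi (lsubmx y) * G2 (rsubmx y) s t.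
Proof. by rewrite /W block_mxEdr mxE. Qed.

Let partialL_l (f : 'rV[R]_m -> R) a x :
  partial (L a) (fun y => f (lsubmx y)) x = partial a f (lsubmx x).
Proof. exact: (lsubmx_transfer_l f a x).2. Qed.

Let partialL_r (f : 'rV[R]_k -> R) a x : partial (L a) (fun y => f (rsubmx y)) x = 0.
Proof. exact: (rsubmx_transfer_l f a x).2. Qed.

Let partialH_l (f : 'rV[R]_m -> R) s x : partial (H s) (fun y => f (lsubmx y)) x = 0.
Proof. exact: (lsubmx_transfer_r f s x).2. Qed.

Let partialH_r (f : 'rV[R]_k -> R) s x :
  partial (H s) (fun y => f (rsubmx y)) x = partial s f (rsubmx x).
Proof. exact: (rsubmx_transfer_r f s x).2. Qed.

Let dphi a z : U1 z -> derivable phi z (basis_vec a).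
Proof. by move=> Uz; have [_ /(_ a) [+ _]] := phi_smooth 1; exact. Qed.

Let ddphi a b z : U1 z -> derivable (partial b phi) z (basis_vec a).
Proof.
by move=> Uz; have [_ /(_ b) [_ [_ /(_ a) [+ _]]]] := phi_smooth 2; exact.
Qed.

Let dG2 r s t z : U2 z -> derivable (fun z => G2 z s t) z (basis_vec r).
Proof. by move=> Uz; have [_ /(_ r) [+ _]] := G2_smooth s t 1; exact. Qed.

Let pWLL i x a b : partial i (fun y => W y (L a) (L b)) x =
  partial i (fun y => G1 (lsubmx y) a b) x.
Proof. by congr (partial i _ x); apply: funext => y; exact: WLL. Qed.

Let pWLH i x a s : partial i (fun y => W y (L a) (H s)) x = 0.
Proof.
by rewrite -(partial_cst 0 i x); congr (partial i _ x); apply: funext => y; exact: WLH.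
Qed.

Let pWHL i x a s : partial i (fun y => W y (H s) (L a)) x = 0.
Proof.
by rewrite -(partial_cst 0 i x); congr (partial i _ x); apply: funext => y; exact: WHL.
Qed.

Let pLWLL x a b c : partial (L a) (fun y => W y (L b) (L c)) x =
  partial a (fun z => G1 z b c) (lsubmx x).
Proof. by rewrite pWLL (partialL_l (fun z => G1 z b c)). Qed.

Let pHWLL x s b c : partial (H s) (fun y => W y (L b) (L c)) x = 0.
Proof. by rewrite pWLL (partialH_l (fun z => G1 z b c)). Qed.

Let pWHH i x s t : partial i (fun y => W y (H s) (H t)) x =
  partial i (fun y => phi (lsubmx y) * G2 (rsubmx y) s t) x.
Proof. by congr (partial i _ x); apply: funext => y; exact: WHH. Qed.

Let pLWHH x a s t : U x -> partial (L a) (fun y => W y (H s) (H t)) x =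
  partial a phi (lsubmx x) * G2 (rsubmx x) s t.
Proof.
move=> [Ul Ur]; rewrite pWHH.
have d1 : derivable (fun y => phi (lsubmx y)) x (basis_vec (L a)).
  by rewrite (lsubmx_transfer_l phi a x).1; exact: dphi.
have d2 := (rsubmx_transfer_l (fun z => G2 z s t) a x).1.
apply: etrans (partialM d1 d2) _.
by rewrite (partialL_l phi) (partialL_r (fun z => G2 z s t)) mulr0 addr0.
Qed.

Let pHWHH x r s t : U x -> partial (H r) (fun y => W y (H s) (H t)) x =
  phi (lsubmx x) * partial r (fun z => G2 z s t) (rsubmx x).
Proof.
move=> [Ul Ur]; rewrite pWHH.
have d1 := (lsubmx_transfer_r phi r x).1.
have d2 : derivable (fun y => G2 (rsubmx y) s t) x (basis_vec (H r)).
  by rewrite (rsubmx_transfer_r (fun z => G2 z s t) r x).1; exact: dG2.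
apply: etrans (partialM d1 d2) _.
by rewrite (partialH_l phi) (partialH_r (fun z => G2 z s t)) mul0r add0r.
Qed.

Let invW x : U x -> invmx (W x) =
  block_mx (invmx (G1 (lsubmx x))) 0 0 ((phi (lsubmx x))^-1 *: invmx (G2 (rsubmx x))).
Proof.
move=> [Ul Ur]; have u1 := G1_unit Ul; have u2 := G2_unit Ur; have p0 := phi_neq0 Ul.
by rewrite invmx_block_diag ?invmxZ // unitmxZ ?unitfE.
Qed.

Let chrE_L x i j c : U x -> christoffel W x i j (L c) =
  2^-1 * \sum_l invmx (G1 (lsubmx x)) c l *
    (partial i (fun y => W y j (L l)) x + partial j (fun y => W y i (L l)) x
     - partial (L l) (fun y => W y i j) x).
Proof.
move=> Ux; rewrite /christoffel big_split_ord /= [X in _ + X]big1 ?addr0.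
  by congr (_ * _); apply: eq_bigr => l _; rewrite invW // block_mxEul.
by move=> l _; rewrite invW // block_mxEur mxE mul0r.
Qed.

Let chrE_H x i j t : U x -> christoffel W x i j (H t) =
  2^-1 * \sum_l (phi (lsubmx x))^-1 * invmx (G2 (rsubmx x)) t l *
    (partial i (fun y => W y j (H l)) x + partial j (fun y => W y i (H l)) x
     - partial (H l) (fun y => W y i j) x).
Proof.
move=> Ux; rewrite /christoffel big_split_ord /= [X in X + _]big1 ?add0r.
  by congr (_ * _); apply: eq_bigr => l _; rewrite invW // block_mxEdr mxE.
by move=> l _; rewrite invW // block_mxEdl mxE mul0r.
Qed.

Lemma warped_chr_LLL x a b c : U x ->
  christoffel W x (L a) (L b) (L c) = christoffel G1 (lsubmx x) a b c.
Proof.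
by move=> Ux; rewrite chrE_L //; under eq_bigr do rewrite !pLWLL.
Qed.

Lemma warped_chr_LLH x a b t : U x -> christoffel W x (L a) (L b) (H t) = 0.
Proof.
move=> Ux; rewrite chrE_H // big1 ?mulr0 // => l _.
by rewrite !pWLH pHWLL !addr0 subr0 mulr0.
Qed.

Lemma warped_chr_LHL x a s c : U x -> christoffel W x (L a) (H s) (L c) = 0.
Proof.
move=> Ux; rewrite chrE_L // big1 ?mulr0 // => l _.
by rewrite !pWLH !pWHL pHWLL !addr0 subr0 mulr0.
Qed.

Lemma warped_chr_HLL x a s c : U x -> christoffel W x (H s) (L a) (L c) = 0.
Proof.
move=> Ux; rewrite chrE_L // big1 ?mulr0 // => l _.
by rewrite !pWHL pHWLL !addr0 subr0 mulr0.
Qed.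

Let inv_delta x s t : U x ->
  \sum_l invmx (G2 (rsubmx x)) t l * G2 (rsubmx x) s l = (s == t)%:R.
Proof.
move=> [_ Ur]; have := mulVmx (G2_unit Ur) => /matrixP /(_ t s).
rewrite !mxE eq_sym => <-; apply: eq_bigr => l _.
by rewrite -{2}(G2_sym Ur) mxE.
Qed.

Lemma warped_chr_LHH x a s t : U x -> christoffel W x (L a) (H s) (H t) =
  (s == t)%:R * (partial a phi (lsubmx x) / (2 * phi (lsubmx x))).
Proof.
move=> Ux; rewrite chrE_H // -(inv_delta s t Ux) mulr_sumr mulr_suml.
apply: eq_bigr => l _; rewrite pLWHH // !pWLH addr0 subr0 invfM.
by move: (partial a phi _) => u; ring.
Qed.

Lemma warped_chr_HLH x a s t : U x -> christoffel W x (H s) (L a) (H t) =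
  (s == t)%:R * (partial a phi (lsubmx x) / (2 * phi (lsubmx x))).
Proof.
move=> Ux; rewrite chrE_H // -(inv_delta s t Ux) mulr_sumr mulr_suml.
apply: eq_bigr => l _; rewrite pLWHH // pWLH pWHL add0r subr0 invfM.
by move: (partial a phi _) => u; ring.
Qed.

Lemma warped_chr_HHL x s t c : U x -> christoffel W x (H s) (H t) (L c) =
  - (2^-1 * G2 (rsubmx x) s t *
     \sum_l invmx (G1 (lsubmx x)) c l * partial l phi (lsubmx x)).
Proof.
move=> Ux; rewrite chrE_L // -mulrA -mulrN; congr (_ * _); rewrite mulr_sumr -sumrN.
apply: eq_bigr => l _; rewrite pLWHH // !pWHL addr0 sub0r mulrN.
by move: (partial l phi _) => u; ring.
Qed.

Lemma warped_chr_HHH x r s t : U x ->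
  christoffel W x (H r) (H s) (H t) = christoffel G2 (rsubmx x) r s t.
Proof.
move=> Ux; rewrite chrE_H // /christoffel; congr (_ * _).
apply: eq_bigr => l _; rewrite !pHWHH // -mulrDr -mulrBr.
rewrite mulrACA mulVf ?mul1r //.
by case: Ux => Ul _; exact: phi_neq0.
Qed.

#[local] Opaque christoffel.

Let near_partial (f g : 'rV[R]_(m + k) -> R) i x : U x ->
  (forall y, U y -> f y = g y) -> partial i f x = partial i g x.
Proof.
move=> Ux fg; apply: near_eq_derive.
by apply: filterS (open_nbhs_nbhs (conj (open_mxprod oU1 oU2) Ux)) => y; exact: fg.
Qed.

Let partial_eq0 (f : 'rV[R]_(m + k) -> R) i x : U x ->
  (forall y, U y -> f y = 0) -> partial i f x = 0.
Proof. by move=> Ux f0; rewrite (near_partial i Ux f0) partial_cst. Qed.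

(** Half the logarithmic derivative of [phi], the factor in the mixed symbols [warped_chr_LHH] and
    [warped_chr_HLH]. *)
Let psi a z : R := partial a phi z / (2 * phi z).

Let partial_psi a b z : U1 z -> partial a (psi b) z =
  partial a (partial b phi) z / (2 * phi z)
  - partial a phi z * partial b phi z / (2 * phi z ^+ 2).
Proof.
move=> Uz; have p0 := phi_neq0 Uz.
have d2 : derivable (fun z => 2 * phi z) z (basis_vec a).
  by apply: derivableM; [exact: derivable_cst|exact: dphi].
have n2 : 2 * phi z != 0 by rewrite mulf_neq0 ?pnatr_eq0.
have dV : partial a (fun z => (2 * phi z)^-1) z =
    - (2 * phi z) ^- 2 * (2 * partial a phi z).
  have := @deriveV R 'rV[R]_m (fun z => 2 * phi z) z (basis_vec a) n2 d2.
  rewrite -!partialE (partialZ 2 (@dphi a z Uz)).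
  exact.
have d2V : derivable (fun z => (2 * phi z)^-1) z (basis_vec a).
  exact: (@derivableV R 'rV[R]_m (fun z => 2 * phi z) z (basis_vec a) n2 d2).
apply: etrans (@partialM R m (partial b phi) (fun z => (2 * phi z)^-1) a z
  (@ddphi a b z Uz) d2V) _.
rewrite dV.
move: (partial a phi z) (partial b phi z) (partial a _ z) => u v w.
by field.
Qed.

Let sum_deltal s (u : R) (f : 'I_k -> R) :
  \sum_h ((s == h)%:R * u) * f h = u * f s.
Proof.
rewrite (bigD1 s) //= eqxx mul1r big1 ?addr0 // => h hs.
by rewrite eq_sym (negbTE hs) !mul0r.
Qed.

Let sum_deltar t (u : R) (f : 'I_k -> R) :
  \sum_h f h * ((h == t)%:R * u) = f t * u.
Proof.
rewrite (bigD1 t) //= eqxx mul1r big1 ?addr0 // => h hs.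
by rewrite (negbTE hs) mul0r mulr0.
Qed.

(** The index patterns computed from here on represent all sixteen: antisymmetry in the first pair,
    and in the second pair after lowering, yields the others. *)
Let curv_LLLL x a b c d : U x ->
  curv_comp W x (L a) (L b) (L c) (L d) = curv_comp G1 (lsubmx x) a b c d.
Proof.
move=> Ux; rewrite /curv_comp big_split_ord /= [X in _ + (_ + X)]big1 ?addr0.
  rewrite !(near_partial _ Ux (fun y => warped_chr_LLL _ _ _)).
  rewrite (partialL_l (fun z => christoffel G1 z b c d)).
  rewrite (partialL_l (fun z => christoffel G1 z a c d)).
  by congr (_ + _); apply: eq_bigr => h _; rewrite !warped_chr_LLL.
by move=> h _; rewrite !warped_chr_LLH // !mul0r subrr.
Qed.

Let curv_LLLH x a b c u : U x -> curv_comp W x (L a) (L b) (L c) (H u) = 0.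
Proof.
move=> Ux; rewrite /curv_comp big_split_ord /= !big1 ?addr0.
- by rewrite !(partial_eq0 _ Ux (fun y => warped_chr_LLH _ _ _)) subrr.
- by move=> h _; rewrite !warped_chr_LLH // !mul0r subrr.
- by move=> h _; rewrite !warped_chr_LLH // !mulr0 subrr.
Qed.

Let partial_chr_LHH i a s t x : U x ->
  partial i (fun y => christoffel W y (L a) (H s) (H t)) x =
  (s == t)%:R * partial i (fun y => psi a (lsubmx y)) x.
Proof.
move=> Ux; rewrite (near_partial i Ux (fun y => warped_chr_LHH a s t)).
case: (s == t); last first.
  by rewrite mul0r; apply: (partial_eq0 _ Ux) => y _; rewrite mul0r.
by rewrite mul1r; apply: (near_partial _ Ux) => y _; rewrite mul1r.
Qed.

Let partial_chr_HLH i a s t x : U x ->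
  partial i (fun y => christoffel W y (H s) (L a) (H t)) x =
  (s == t)%:R * partial i (fun y => psi a (lsubmx y)) x.
Proof.
move=> Ux; rewrite -(@partial_chr_LHH i a s t x Ux).
apply: (near_partial _ Ux) => y Uy.
by rewrite (warped_chr_LHH _ _ _ Uy) (warped_chr_HLH _ _ _ Uy).
Qed.

(** [psi] is a gradient, so its derivatives cancel by [partialC]; the products of two mixed symbols
    are symmetric in a, b. *)
Let curv_LLHH x a b s u : U x -> curv_comp W x (L a) (L b) (H s) (H u) = 0.
Proof.
move=> Ux; rewrite /curv_comp big_split_ord /= [X in _ + (X + _)]big1.
  rewrite !partial_chr_LHH // !(partialL_l (psi _)).
  under eq_bigr do rewrite !warped_chr_LHH //.
  rewrite sumrB !sum_deltal !(partial_psi _ _ Ux.1).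
  have -> : partial a (partial b phi) (lsubmx x) = partial b (partial a phi) (lsubmx x).
    exact: (@partialC R m U1 phi _ _ _ oU1 (phi_smooth 2) Ux.1).
  rewrite /psi; move: (partial a _ _) (partial b _ _) (partial b (partial a _) _).
  by move=> v w z; ring.
by move=> h _; rewrite !warped_chr_LHL // !mul0r subrr.
Qed.

Let curv_LHLL x a s c d : U x -> curv_comp W x (L a) (H s) (L c) (L d) = 0.
Proof.
move=> Ux; rewrite /curv_comp big_split_ord /= !big1 ?addr0.
- rewrite (partial_eq0 _ Ux (fun y => warped_chr_HLL _ _ _)) sub0r.
  rewrite (near_partial _ Ux (fun y => warped_chr_LLL _ _ _)).
  by rewrite (partialH_l (fun z => christoffel G1 z a c d)) oppr0.
- by move=> h _; rewrite warped_chr_LLH // warped_chr_LHL // mul0r mulr0 subrr.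
- by move=> h _; rewrite !warped_chr_HLL // mul0r mulr0 subrr.
Qed.

Let curv_LHHH x a r s t : U x -> curv_comp W x (L a) (H r) (H s) (H t) = 0.
Proof.
move=> Ux; rewrite /curv_comp big_split_ord /= [X in _ + (X + _)]big1.
  rewrite partial_chr_LHH // (partialH_l (psi _)) mulr0 subr0.
  rewrite (near_partial _ Ux (fun y => warped_chr_HHH _ _ _)).
  rewrite (partialL_r (fun z => christoffel G2 z r s t)).
  under eq_bigr do rewrite !warped_chr_LHH // !warped_chr_HHH //.
  by rewrite sumrB sum_deltal sum_deltar !add0r mulrC subrr.
by move=> h _; rewrite warped_chr_LLH // warped_chr_LHL // mul0r mulr0 subrr.
Qed.

Let curv_HHLL x r s c d : U x -> curv_comp W x (H r) (H s) (L c) (L d) = 0.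
Proof.
move=> Ux; rewrite /curv_comp big_split_ord /= [X in _ + (X + _)]big1.
  rewrite !(partial_eq0 _ Ux (fun y => warped_chr_HLL _ _ _)) subrr !add0r.
  under eq_bigr do rewrite !warped_chr_HLH // !warped_chr_HHL //.
  rewrite sumrB !sum_deltal.
  have /matrixP /(_ r s) := G2_sym Ux.2; rewrite mxE => ->; exact: subrr.
by move=> h _; rewrite !warped_chr_HLL // !mul0r subrr.
Qed.

Let curv_HHLH x r s c t : U x -> curv_comp W x (H r) (H s) (L c) (H t) = 0.
Proof.
move=> Ux; rewrite /curv_comp big_split_ord /= [X in _ + (X + _)]big1.
  rewrite !partial_chr_HLH // !(partialH_l (psi _)) !mulr0 subrr !add0r.
  under eq_bigr do rewrite !warped_chr_HLH // !warped_chr_HHH //.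
  rewrite sumrB !sum_deltal.
  by rewrite (christoffel_sym oU2 G2_sym s r t Ux.2) subrr.
by move=> h _; rewrite !warped_chr_HLL // !mul0r subrr.
Qed.

Definition warped_T a c z : R :=
  partial a (partial c phi) z - \sum_h christoffel G1 z a c h * partial h phi z
  - (2 * phi z)^-1 * (partial a phi z * partial c phi z).

Definition warped_Delta z : R :=
  \sum_e \sum_l invmx (G1 z) e l * partial l phi z * partial e phi z.

(** The product psi_a psi_c offsets half of the quadratic term in the derivative of psi_c. What is
    left of it is the term with coefficient 1 / (2 phi) in [warped_T]. *)
Let curv_LHLH x a s c u : U x -> curv_comp W x (L a) (H s) (L c) (H u) =
  (s == u)%:R * (warped_T a c (lsubmx x) / (2 * phi (lsubmx x))).
Proof.
move=> Ux; have p0 := phi_neq0 Ux.1; rewrite /curv_comp big_split_ord /=.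
rewrite partial_chr_HLH // (partialL_l (psi _)).
rewrite (partial_eq0 _ Ux (fun y => warped_chr_LLH _ _ _)) subr0.
under [X in _ + (X + _)]eq_bigr do
  rewrite warped_chr_HLL // warped_chr_LLL // warped_chr_HLH // mul0r sub0r.
under [X in _ + (_ + X)]eq_bigr do
  rewrite warped_chr_LLH // warped_chr_HLH // mul0r subr0 warped_chr_LHH //.
rewrite sum_deltal partial_psi; last exact: Ux.1.
have -> : \sum_i - (christoffel G1 (lsubmx x) a c i *
    ((s == u)%:R * (partial i phi (lsubmx x) / (2 * phi (lsubmx x))))) =
  - ((s == u)%:R * ((\sum_h christoffel G1 (lsubmx x) a c h *
      partial h phi (lsubmx x)) / (2 * phi (lsubmx x)))).
  rewrite sumrN mulr_suml mulr_sumr; congr (- _); apply: eq_bigr => h _.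
  by move: (partial h _ _) => w; ring.
rewrite /warped_T; move: (\sum_h _) (partial a _ _) (partial c _ _) (partial a _ _).
by move=> S v w z; field.
Qed.

(** The correction to the fiber curvature comes from summing over base indices: each product of an
    HHL and an HLH symbol contributes one term of the squared gradient of [phi]. *)
Let curv_HHHH x r s t u : U x -> curv_comp W x (H r) (H s) (H t) (H u) =
  curv_comp G2 (rsubmx x) r s t u
  - warped_Delta (lsubmx x) / (4 * phi (lsubmx x)) *
    (G2 (rsubmx x) s t * (r == u)%:R - G2 (rsubmx x) r t * (s == u)%:R).
Proof.
move=> Ux; have p0 := phi_neq0 Ux.1; rewrite /curv_comp big_split_ord /=.
rewrite !(near_partial _ Ux (fun y => warped_chr_HHH _ _ _)).
rewrite (partialH_r (fun z => christoffel G2 z s t u)).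
rewrite (partialH_r (fun z => christoffel G2 z r t u)) -!addrA; do 2 congr (_ + _).
rewrite addrC; congr (_ + _).
  by apply: eq_bigr => h _; rewrite !warped_chr_HHH.
rewrite /warped_Delta mulr_suml mulr_suml -sumrN; apply: eq_bigr => e _.
rewrite !warped_chr_HHL // !warped_chr_HLH // -mulr_suml.
by move: (\sum_l _) (partial e _ _) => S v; field.
Qed.

Let W_smooth i j : smooth_on U (fun y => W y i j).
Proof.
case: (split_ordP i) => i' ->; case: (split_ordP j) => j' ->.
- under eq_fun do rewrite WLL.
  exact: (smooth_on_lsubmx oU1 oU2 (G1_smooth i' j')).
- by under eq_fun do rewrite WLH; move=> l; exact: Ck_cst.
- by under eq_fun do rewrite WHL; move=> l; exact: Ck_cst.
- under eq_fun do rewrite WHH.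
  exact: (smooth_on_mxprod oU1 oU2 phi_smooth (G2_smooth i' j')).
Qed.

Let W_sym y : U y -> (W y)^T = W y.
Proof.
by move=> [Ul Ur]; rewrite /W tr_block_mx !trmx0 linearZ /= G1_sym // G2_sym.
Qed.

Let W_unit y : U y -> W y \in unitmx.
Proof.
move=> [Ul Ur]; rewrite unitmxE det_ublock unitrM -!unitmxE G1_unit //=.
by rewrite unitmxZ ?G2_unit // unitfE phi_neq0.
Qed.

Let low_skew34 x i j p q : U x -> curv_low W x i j p q = - curv_low W x i j q p.
Proof.
exact: (curv_low_skew34 (open_mxprod oU1 oU2) W_smooth W_sym W_unit).
Qed.

Let low_L x i j p d : curv_low W x i j p (L d) =
  \sum_h curv_comp W x i j p (L h) * G1 (lsubmx x) h d.
Proof.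
rewrite /curv_low big_split_ord /= [X in _ + X]big1 ?addr0 => [|h _].
  by apply: eq_bigr => h _; rewrite WLL.
by rewrite WHL mulr0.
Qed.

Let low_H x i j p u : curv_low W x i j p (H u) =
  \sum_h curv_comp W x i j p (H h) * (phi (lsubmx x) * G2 (rsubmx x) h u).
Proof.
rewrite /curv_low big_split_ord /= [X in X + _]big1 ?add0r => [|h _].
  by apply: eq_bigr => h _; rewrite WHH.
by rewrite WLH mulr0.
Qed.

Let low_LHLH x a s c u : U x -> curv_low W x (L a) (H s) (L c) (H u) =
  2^-1 * warped_T a c (lsubmx x) * G2 (rsubmx x) s u.
Proof.
move=> Ux; have p0 := phi_neq0 Ux.1; rewrite low_H.
under eq_bigr do rewrite curv_LHLH //; rewrite sum_deltal.
by move: (warped_T _ _ _) => w; field.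
Qed.

Let low_HHHH x r s t u : U x -> curv_low W x (H r) (H s) (H t) (H u) =
  phi (lsubmx x) * curv_low G2 (rsubmx x) r s t u
  - warped_Delta (lsubmx x) / 4 *
    (G2 (rsubmx x) s t * G2 (rsubmx x) r u - G2 (rsubmx x) r t * G2 (rsubmx x) s u).
Proof.
move=> Ux; have p0 := phi_neq0 Ux.1; rewrite low_H /curv_low mulr_sumr.
have deltaG v : G2 (rsubmx x) v u = \sum_h ((v == h)%:R * 1) * G2 (rsubmx x) h u.
  by rewrite sum_deltal mul1r.
rewrite (deltaG r) (deltaG s) !mulr_sumr -sumrB mulr_sumr -sumrB.
apply: eq_bigr => h _; rewrite curv_HHHH //.
by move: (warped_Delta _) (curv_comp _ _ _ _ _ _) => w z; field.
Qed.

Let low0 x i j p : U x ->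
  (forall d, curv_comp W x i j p (L d) = 0) -> forall d, curv_low W x i j p (L d) = 0.
Proof. by move=> Ux c0 d; rewrite low_L big1 // => h _; rewrite c0 mul0r. Qed.

Let low0H x i j p : U x ->
  (forall u, curv_comp W x i j p (H u) = 0) -> forall u, curv_low W x i j p (H u) = 0.
Proof. by move=> Ux c0 d; rewrite low_H big1 // => h _; rewrite c0 mul0r. Qed.

(** Lowering multiplies the fiber curvature by [phi] once, whereas f/\f contains phi^2; hence K2 /
    phi, and likewise the denominator 4 phi^2. The curvature assumptions concern the single point
    x. *)
Lemma warped_curv_low (K1 K2 : R) x i j p q : U x ->
  (forall a b c d, curv_low G1 (lsubmx x) a b c d = K1 *
    (G1 (lsubmx x) a d * G1 (lsubmx x) b c - G1 (lsubmx x) a c * G1 (lsubmx x) b d)) ->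
  (forall r s t u, curv_low G2 (rsubmx x) r s t u = K2 *
    (G2 (rsubmx x) r u * G2 (rsubmx x) s t - G2 (rsubmx x) r t * G2 (rsubmx x) s u)) ->
  let h := block_mx (G1 (lsubmx x)) 0 0 0 : 'M[R]_(m + k) in
  let f := block_mx 0 0 0 (phi (lsubmx x) *: G2 (rsubmx x)) : 'M[R]_(m + k) in
  let t := block_mx (\matrix_(a, c) warped_T a c (lsubmx x)) 0 0 0 : 'M[R]_(m + k) in
  curv_low W x i j p q = K1 * (h i q * h j p - h i p * h j q)
    + (K2 / phi (lsubmx x) - warped_Delta (lsubmx x) / (4 * phi (lsubmx x) ^+ 2))
      * (f i q * f j p - f i p * f j q)
    - (2 * phi (lsubmx x))^-1 *
      (t i q * f j p + t j p * f i q - t i p * f j q - t j q * f i p).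
Proof.
move=> Ux c1 c2 h f t; have p0 := phi_neq0 Ux.1.
have T_sym a c : warped_T a c (lsubmx x) = warped_T c a (lsubmx x).
  rewrite /warped_T (@partialC R m U1 phi a c _ oU1 (phi_smooth 2) Ux.1).
  rewrite [partial a phi _ * _]mulrC; congr (_ - _ - _); apply: eq_bigr => e _.
  by rewrite (christoffel_sym oU1 G1_sym a c e Ux.1).
have E := (block_mxEul, block_mxEur, block_mxEdl, block_mxEdr, mxE).
case: (split_ordP i) => a ->; case: (split_ordP j) => b ->;
  case: (split_ordP p) => c ->; case: (split_ordP q) => d ->; rewrite /h /f /t !E.
- rewrite low_L; under eq_bigr do rewrite curv_LLLL //.
  by rewrite -/(curv_low G1 _ _ _ _ _) c1 !(mulr0, mul0r, subrr, subr0, addr0).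
- by rewrite low0H // => [|u]; [ring|exact: curv_LLLH].
- by rewrite low_skew34 // low0H // => [|u]; [ring|exact: curv_LLLH].
- by rewrite low0H // => [|u]; [ring|exact: curv_LLHH].
- by rewrite low0 // => [|u]; [ring|exact: curv_LHLL].
- by rewrite low_LHLH //; field.
- by rewrite low_skew34 // low_LHLH //; field.
- by rewrite low0H // => [|u]; [ring|exact: curv_LHHH].
- by rewrite curv_low_skew12 low0 // => [|u]; [ring|exact: curv_LHLL].
- by rewrite curv_low_skew12 low_LHLH //; field.
- by rewrite curv_low_skew12 low_skew34 // low_LHLH //; field.
- by rewrite curv_low_skew12 low0H // => [|u]; [ring|exact: curv_LHHH].
- by rewrite low0 // => [|u]; [ring|exact: curv_HHLL].
- by rewrite low0H // => [|u]; [ring|exact: curv_HHLH].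
- by rewrite low_skew34 // low0H // => [|u]; [ring|exact: curv_HHLH].
- by rewrite low_HHHH // c2; field.
Qed.

End LocalWarpedMetric.

#[local] Opaque christoffel.

(** * Ricci contraction *)

Section Contraction.
Context {R : realType} {m : nat}.
Implicit Types (g A E : 'M[R]_m) (X Y : 'rV[R]_m).

Lemma mlin4_basis a (i j k l : 'I_m) :
  mlin4 a (basis_vec i) (basis_vec j) (basis_vec k) (basis_vec l) = a i j k l :> R.
Proof.
have pick (F : 'I_m -> R) (h : 'I_m) c : \sum_e c * (basis_vec h : 'rV[R]_m) 0 e * F e = c * F h.
  rewrite (bigD1 h) //= big1 ?addr0 => [|e eh]; first by rewrite mxE !eqxx mulr1.
  by rewrite mxE (negbTE eh) andbF mulr0 mul0r.
rewrite /mlin4.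
under eq_bigr do under eq_bigr do under eq_bigr do rewrite pick.
under eq_bigr do under eq_bigr do (under eq_bigr do rewrite -mulrA; rewrite -mulr_sumr).
(* A factor 1 is inserted because [pick] expects a coefficient in front. *)
under eq_bigr do under eq_bigr do (under eq_bigr do rewrite -[_ 0 _]mul1r; rewrite pick mul1r).
under eq_bigr do rewrite pick.
by under eq_bigr do rewrite -[_ 0 _]mul1r; rewrite pick mul1r.
Qed.

Lemma bil_basisr A X j : bil A X (basis_vec j) = (X *m A) 0 j.
Proof.
rewrite /bil mxE (bigD1 j) //= big1 ?addr0 => [|e ej]; first by rewrite !mxE !eqxx mulr1.
by rewrite [_^T _ _]mxE [basis_vec _ _ _]mxE (negbTE ej) andbF mulr0.
Qed.

Lemma bil_basis A i j : bil A (basis_vec i) (basis_vec j) = A i j.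
Proof. by rewrite bil_basisr /basis_vec -rowE mxE. Qed.

Lemma raise_kn g A E X1 X2 X3 : raise g (kn A E) X1 X2 X3 =
  bil E X2 X3 *: (X1 *m A *m invmx g) + bil A X2 X3 *: (X1 *m E *m invmx g)
  - bil A X1 X3 *: (X2 *m E *m invmx g) - bil E X1 X3 *: (X2 *m A *m invmx g).
Proof.
rewrite /raise !scalemxAl -!mulmxDl -!mulmxBl -!scalemxAl; congr (_ *m _).
apply/rowP => j; rewrite /kn /kulkarni [LHS]mxE !bil_basisr.
move: (X1 *m A) (X1 *m E) (X2 *m A) (X2 *m E) => u v w z.
by rewrite !mxE; ring.
Qed.

Definition ricci_contraction g (T : 'rV[R]_m -> 'rV[R]_m -> 'rV[R]_m -> 'rV[R]_m -> R) :
    'M[R]_m :=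
  \matrix_(i, j) \sum_k raise g T (basis_vec k) (basis_vec i) (basis_vec j) 0 k.

Lemma ricci_contraction_kn g A E : ricci_contraction g (kn A E) =
  mtrace g A *: E + mtrace g E *: A - E *m invmx g *m A - A *m invmx g *m E.
Proof.
have row_trace B : \sum_k (basis_vec k *m B *m invmx g) 0 k = mtrace g B.
  by apply: eq_bigr => k _; rewrite -mulmxA -rowE mxE.
have row_mul B C i j : \sum_k bil B (basis_vec k) (basis_vec j) *
    (basis_vec i *m C *m invmx g) 0 k = (C *m invmx g *m B) i j.
  rewrite mxE; apply: eq_bigr => k _; rewrite bil_basis mulrC; congr (_ * _).
  by rewrite -mulmxA -rowE mxE.
have coord (a b c d : R) (u v w z : 'rV[R]_m) k :
    (a *: u + b *: v - c *: w - d *: z) 0 k = a * u 0 k + b * v 0 k - c * w 0 k - d * z 0 k.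
  by rewrite !mxE.
have entry (B C D F : 'M[R]_m) i j : (B + C - D - F) i j = B i j + C i j - D i j - F i j.
  by rewrite !mxE.
apply/matrixP => i j; rewrite entry -!row_mul !mxE.
under eq_bigr do rewrite raise_kn coord.
rewrite !sumrB big_split /= -!mulr_sumr (row_trace A) (row_trace E) !bil_basis.
by rewrite [E i j * _]mulrC [A i j * _]mulrC.
Qed.

End Contraction.

(** * Ricci tensor as a contraction, and curvature constant at a point *)

Section RicciOfRiemann.
Context {R : realType} {m : nat}.
Variable M : semi_riemannian R m.
Implicit Types p : M.

Lemma raise_Riem p X Y Z : raise (metric_at p) (Riem p) X Y Z = Rop p X Y Z.
Proof.
rewrite /raise -[RHS](mulmxK (metric_at_unit p)); congr (_ *m _).
by apply/rowP => j; rewrite mxE /Riem bil_basisr.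
Qed.

Lemma Ric_contraction p : Ric p = ricci_contraction (metric_at p) (Riem p).
Proof.
apply/matrixP => i j; rewrite !mxE.
by apply: eq_bigr => k _; rewrite raise_Riem.
Qed.

Lemma riem_comp_Riem p i j k l :
  riem_comp p i j k l = Riem p (basis_vec i) (basis_vec j) (basis_vec k) (basis_vec l).
Proof. by rewrite Riem_mlin4 mlin4_basis. Qed.

Lemma ricci_contraction_ext g (T T' : 'rV[R]_m -> 'rV[R]_m -> 'rV[R]_m -> 'rV[R]_m -> R) :
  (forall X1 X2 X3 X4, T X1 X2 X3 X4 = T' X1 X2 X3 X4) ->
  ricci_contraction g T = ricci_contraction g T'.
Proof. by move=> e; congr ricci_contraction; do 4 (apply: funext => ?); exact: e. Qed.

Lemma ricci_contraction_lin g (a b : R)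
    (T T' : 'rV[R]_m -> 'rV[R]_m -> 'rV[R]_m -> 'rV[R]_m -> R) :
  ricci_contraction g (fun X1 X2 X3 X4 => a * T X1 X2 X3 X4 + b * T' X1 X2 X3 X4) =
  a *: ricci_contraction g T + b *: ricci_contraction g T'.
Proof.
apply/matrixP => i j; rewrite !mxE !mulr_sumr -big_split; apply: eq_bigr => k _ /=.
rewrite /raise !mxE !mulr_sumr -big_split; apply: eq_bigr => l _ /=.
by rewrite !mxE mulrDl !mulrA.
Qed.

Lemma mtrace_metric (g : 'M[R]_m) : g \in unitmx -> mtrace g g = m%:R :> R.
Proof. by move=> gu; rewrite /mtrace mulmxV // mxtrace1. Qed.

(** The pointwise form of [constant_curvature]: [K] may change with [p], as it does on a general
    surface. *)
Definition has_curvature p (K : R) := forall X1 X2 X3 X4,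
  Riem p X1 X2 X3 X4 = K * Gtensor (metric_at p) X1 X2 X3 X4.

(** Contracting K G gives K (m - 1) g, and its trace is K m (m - 1). This lets scalar curvatures
    replace sectional ones, as in tau_1 and rho. *)
Lemma scal_has_curvature p K : has_curvature p K -> scal p = K * (m%:R * (m%:R - 1)).
Proof.
move=> pK; have gu := metric_at_unit p; pose g := metric_at p.
have -> : scal p = mtrace g ((K * (m%:R - 1)) *: g).
  rewrite /scal -/g; congr mtrace; rewrite Ric_contraction -/g.
  (* The zero summand brings the tensor into the two-term form of [ricci_contraction_lin]. *)
  rewrite (@ricci_contraction_ext g (Riem p) (fun X1 X2 X3 X4 =>
    (K / 2) * kn g g X1 X2 X3 X4 + 0 * kn g g X1 X2 X3 X4)); last first.
    by move=> *; rewrite pK /Gtensor mul0r addr0 mulrA.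
  rewrite ricci_contraction_lin ricci_contraction_kn (mtrace_metric gu) scale0r addr0.
  rewrite mulmxV // !mul1mx.
  by apply/matrixP => i j; rewrite !mxE; field.
by rewrite /mtrace -scalemxAl mxtraceZ mulmxV // mxtrace1; ring.
Qed.

Lemma riem_comp_has_curvature p K : has_curvature p K -> forall i j k l,
  riem_comp p i j k l = K * (metric_at p i l * metric_at p j k
    - metric_at p i k * metric_at p j l).
Proof.
by move=> pK i j k l; rewrite riem_comp_Riem pK Gtensor_mlin4 mlin4_basis.
Qed.

End RicciOfRiemann.

(** * Curvature of surfaces *)

Lemma mulmx2E (R : realType) (A B : 'M[R]_2) i j : (A *m B) i j = A i 0 * B 0 j + A i 1 * B 1 j.
Proof.
rewrite mxE !big_ord_recl big_ord0 addr0.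
by have -> : lift ord0 ord0 = 1 :> 'I_2 by exact: val_inj.
Qed.

Lemma ord2P (a : 'I_2) : a = 0 \/ a = 1.
Proof. by case: a => [[|[|//]] ?]; [left|right]; apply: val_inj. Qed.

Lemma det2E (R : realType) (A : 'M[R]_2) : \det A = A 0 0 * A 1 1 - A 0 1 * A 1 0.
Proof.
rewrite (expand_det_row _ 0) !big_ord_recl big_ord0 /cofactor !det_mx11 !mxE /=.
have -> : lift 0 0 = 1 :> 'I_2 by exact: val_inj.
have -> : lift 1 0 = 0 :> 'I_2 by exact: val_inj.
by rewrite addr0 expr0 expr1 mul1r mulN1r mulrN.
Qed.

(** The two antisymmetries leave c 0 1 1 0 as the single independent component, both for the Riemann
    tensor and for G, where it is the determinant of g. *)
Lemma has_curvature_dim2 (R : realType) (M : semi_riemannian R 2) (p : M) :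
  exists K, has_curvature p K.
Proof.
pose g := metric_at p; pose d := g 0 0 * g 1 1 - g 0 1 * g 0 1.
have g10 : g 1 0 = g 0 1 by rewrite /g -{1}(metric_at_tr p) mxE.
have d0 : d != 0.
  have := metric_at_unit p; rewrite unitmxE unitfE -/g; apply: contra => /eqP dE.
  by rewrite det2E g10 -/d dE.
pose c := riem_comp p; have s12 := riem_comp_skew12 p; have s34 := riem_comp_skew34 p.
have self_opp (u : R) : u = - u -> u = 0 by move=> ?; lra.
have z12 i k l : c i i k l = 0 by exact/self_opp/s12.
have z34 i j k : c i j k k = 0 by exact/self_opp/s34.
have c1001 : c 1 0 0 1 = c 0 1 1 0 by rewrite /c s12 s34 opprK.
have c1010 : c 1 0 1 0 = - c 0 1 1 0 by rewrite /c s12.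
have c0101 : c 0 1 0 1 = - c 0 1 1 0 by rewrite /c s34.
have [q qE] : exists q, c 0 1 1 0 = q * d by exists (c 0 1 1 0 / d); rewrite divfK.
exists q => X1 X2 X3 X4.
rewrite Riem_mlin4 Gtensor_mlin4 -mlin4Z -/c -/g; apply: eq_mlin4 => i j k l.
case: (ord2P i) => ->; case: (ord2P j) => ->; case: (ord2P k) => ->; case: (ord2P l) => ->.
all: rewrite ?z12 ?z34 ?c1001 ?c1010 ?c0101 ?qE ?g10 /d.
all: by move: (g 0 0) (g 0 1) (g 1 1) => x y z; ring.
Qed.

(** Dimension 2 is settled by [has_curvature_dim2], higher dimensions by the hypothesis. The lemma
    serves the base as well as the fiber. *)
Lemma has_curvature_scal (R : realType) (k : nat) (N : semi_riemannian R k) (q : N) :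
  (2 <= k)%N -> ((3 <= k)%N -> constant_curvature N) ->
  has_curvature q (scal q / (k%:R * (k%:R - 1))).
Proof.
move=> k2 Nc; have [K qK] : exists K, has_curvature q K.
  have [/Nc[K KN]|] := ltnP 2 k; first by exists K => X1 X2 X3 X4; exact: KN.
  move=> k2'; have ek : k = 2%N by apply/eqP; rewrite eqn_leq k2' k2.
  by move: N {Nc} q; rewrite ek => N q; exact: has_curvature_dim2.
rewrite (scal_has_curvature qK) mulfK //.
by rewrite mulf_neq0 ?subr_eq0 ?pnatr_eq0 ?pnatr_eq1 -?lt0n ?gtn_eqF // (leq_trans _ k2).
Qed.

(** * Riemann tensor of the warped product at a point *)

Section WarpedRiemann.
Context {R : realType} {m k : nat}.
Variables (M : semi_riemannian R m) (N : semi_riemannian R k) (F : M -> R).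
Hypotheses (F_smooth : smooth_fun F) (F_gt0 : forall p, 0 < F p).
Notation P := (warped_product N F_smooth F_gt0).
Variable p : P.
Let q1 : M := p.1.
Let q2 : N := p.2.

Definition warped_base : 'M[R]_(m + k) := block_mx (metric_at q1) 0 0 0.
Definition warped_fiber : 'M[R]_(m + k) := block_mx 0 0 0 (F q1 *: metric_at q2).
Definition warped_Ttensor : 'M[R]_(m + k) := block_mx (Ttensor F q1) 0 0 0.

Lemma warped_metric_at : metric_at p = warped_base + warped_fiber.
Proof. by rewrite /warped_base /warped_fiber add_block_mx !addr0 !add0r. Qed.

Lemma Riem_warped (K1 K2 : R) X1 X2 X3 X4 :
  has_curvature q1 K1 -> has_curvature q2 K2 ->
  Riem p X1 X2 X3 X4 = K1 * Gtensor warped_base X1 X2 X3 X4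
   + (K2 / F q1 - Delta1 F q1 / (4 * F q1 ^+ 2)) * Gtensor warped_fiber X1 X2 X3 X4
   - (2 * F q1)^-1 * kn warped_Ttensor warped_fiber X1 X2 X3 X4.
Proof.
move=> c1 c2.
pose U1 := chart_img (chart_at q1); pose U2 := chart_img (chart_at q2).
pose G1 := local_metric (chart_at q1); pose G2 := local_metric (chart_at q2).
pose phi := F \o chart_inv (chart_at q1).
pose x : 'rV[R]_(m + k) := chart_coord (chart_at p) p.
have xl : lsubmx x = chart_coord (chart_at q1) q1 by exact: row_mxKl.
have xr : rsubmx x = chart_coord (chart_at q2) q2 by exact: row_mxKr.
have Ux : mxprod U1 U2 x by split; rewrite ?xl ?xr; exact: chart_img_at.
have phix : phi (lsubmx x) = F q1.
  by rewrite xl /phi /= chart_coordK //; exact: chart_atP.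
have G1x : G1 (lsubmx x) = metric_at q1 by rewrite xl metric_atE.
have G2x : G2 (rsubmx x) = metric_at q2 by rewrite xr metric_atE.
have Tx a c : warped_T G1 phi a c (lsubmx x) = Ttensor F q1 a c.
  rewrite /warped_T phix xl !mxE big_ord1 !mxE; congr (_ - _ - _).
  by apply: eq_bigr => e _; rewrite mxE.
have Dx : warped_Delta G1 phi (lsubmx x) = Delta1 F q1.
  rewrite /warped_Delta G1x xl /Delta1 /mtrace /mxtrace exchange_big.
  apply: eq_bigr => l _; rewrite mxE; apply: eq_bigr => e _.
  by rewrite mxE big_ord1 !mxE [RHS]mulrC mulrA.
rewrite Riem_mlin4 !Gtensor_mlin4 kn_mlin4 -!mlin4Z -mlin4N -!mlin4D.
apply: eq_mlin4 => i j s t.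
(* In a product chart the local metric of the warped product computes to [warped_local]. *)
have -> : riem_comp p i j s t = curv_low (warped_local G1 G2 phi) x i j s t by [].
have := @warped_curv_low R m k G1 U1 G2 U2 phi (@open_chart_img _ _ M (chart_at q1))
  (@metric_smooth _ _ M _) (@local_metric_tr _ _ M _) (@local_metric_unit _ _ M _)
  (@open_chart_img _ _ N (chart_at q2))
  (@metric_smooth _ _ N _) (@local_metric_tr _ _ N _) (@local_metric_unit _ _ N _)
  (F_smooth (chart_at q1)) _ K1 K2 x i j s t Ux.
move=> ->.
- rewrite phix Dx G1x G2x -/warped_base -/warped_fiber.
  have -> : \matrix_(a, c) warped_T G1 phi a c (lsubmx x) = Ttensor F q1.
    by apply/matrixP => a c; rewrite mxE Tx.
  by [].
- by move=> y _; rewrite gt_eqF //; exact: F_gt0.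
- move=> a b c d; rewrite G1x -(riem_comp_has_curvature c1) /riem_comp.
  by rewrite xl.
- move=> a b c d; rewrite G2x -(riem_comp_has_curvature c2) /riem_comp.
  by rewrite xr.
Qed.

End WarpedRiemann.

Lemma Ttensor_tr (R : realType) (m : nat) (M : semi_riemannian R m) (F : M -> R) (p : M) :
  smooth_fun F -> (Ttensor F p)^T = Ttensor F p.
Proof.
move=> F_smooth; rewrite /Ttensor linearB linearZ /= trmx_mul trmxK; congr (_ - _).
apply/matrixP => a c; rewrite mxE /hessian.
rewrite [LHS]mxE.
rewrite [RHS]mxE.
apply: (congr2 (fun u v => u - v)).
  exact: (@partialC R m (chart_img (chart_at p)) _ _ _ _
    (@open_chart_img _ _ M (chart_at p)) (F_smooth (chart_at p) 2) (chart_img_at p)).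
apply: eq_bigr => e _; congr (_ * _).
exact: (christoffel_sym (@open_chart_img _ _ M (chart_at p)) (@local_metric_tr _ _ M _)
  c a e (chart_img_at p)).
Qed.

(** * Identities modulo the surface relations *)

Section CurvatureAlgebra.
Context {R : realType} {m : nat}.
Notation vec := 'rV[R]_m.
Variables H F S : vec -> vec -> R.
Variable e : R.
Hypotheses (HC : forall X Y, H X Y = H Y X) (FC : forall X Y, F X Y = F Y X)
  (SC : forall X Y, S X Y = S Y X).
Hypothesis HS : forall X1 X2 X3 X4, kulkarni H S X1 X2 X3 X4 = 0.
Hypothesis SS : forall X1 X2 X3 X4,
  kulkarni S S X1 X2 X3 X4 = - e * kulkarni H H X1 X2 X3 X4.

(** The linear family that contains R, C, G and all Kulkarni-Nomizu products of S, S^2 and g; the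
    halves make G equal to [KT 1 1 1 0]. *)
Definition KT (a b c d : R) (X1 X2 X3 X4 : vec) : R :=
  a * (2^-1 * kulkarni H H X1 X2 X3 X4) + b * kulkarni H F X1 X2 X3 X4
  + c * (2^-1 * kulkarni F F X1 X2 X3 X4) + d * kulkarni S F X1 X2 X3 X4.

(* D is the endomorphism field of [KT a b c d] for the metric H + F; only its
   pairings with H, F and S enter. *)
Definition KT_operator (a b c d : R) (D : vec -> vec -> vec -> vec) := forall X Y Z W,
  [/\ H (D X Y Z) W = a * (H Y Z * H X W - H X Z * H Y W)
        + b * (F Y Z * H X W - F X Z * H Y W) + d * (F Y Z * S X W - F X Z * S Y W),
      F (D X Y Z) W = b * (H Y Z * F X W - H X Z * F Y W)
        + c * (F Y Z * F X W - F X Z * F Y W) + d * (S Y Z * F X W - S X Z * F Y W) &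
      S (D X Y Z) W = a * (H Y Z * S X W - H X Z * S Y W)
        + b * (F Y Z * S X W - F X Z * S Y W) + d * e * (F Y Z * H X W - F X Z * H Y W)].

(** The endomorphisms of X wedge_A Y for A = u h + v s + w f, again known only through pairings. *)
Definition wedge_operator (u v w : R) (D : vec -> vec -> vec -> vec) :=
  forall X Y Z W, let A X Y := u * H X Y + v * S X Y + w * F X Y in
  [/\ H (D X Y Z) W = A Y Z * H X W - A X Z * H Y W,
      F (D X Y Z) W = A Y Z * F X W - A X Z * F Y W &
      S (D X Y Z) W = A Y Z * S X W - A X Z * S Y W].

(** [ring] does not know that h, f, s are symmetric; each value is rewritten with its arguments in
    one fixed order. *)
Ltac pairwise_sym X1 X2 X3 X4 X Y :=
  rewrite ?(HC X2 X1) ?(HC X3 X1) ?(HC X4 X1) ?(HC X X1) ?(HC Y X1) ?(HC X3 X2)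
   ?(HC X4 X2) ?(HC X X2) ?(HC Y X2) ?(HC X4 X3) ?(HC X X3) ?(HC Y X3) ?(HC X X4)
   ?(HC Y X4) ?(HC Y X)
   ?(FC X2 X1) ?(FC X3 X1) ?(FC X4 X1) ?(FC X X1) ?(FC Y X1) ?(FC X3 X2)
   ?(FC X4 X2) ?(FC X X2) ?(FC Y X2) ?(FC X4 X3) ?(FC X X3) ?(FC Y X3) ?(FC X X4)
   ?(FC Y X4) ?(FC Y X)
   ?(SC X2 X1) ?(SC X3 X1) ?(SC X4 X1) ?(SC X X1) ?(SC Y X1) ?(SC X3 X2)
   ?(SC X4 X2) ?(SC X X2) ?(SC Y X2) ?(SC X4 X3) ?(SC X X3) ?(SC Y X3) ?(SC X X4)
   ?(SC Y X4) ?(SC Y X).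

(** By [ricci_contraction_KT] the trace-free condition reads a + b k = 0, d = 0, 2 b + c (k - 1) =
    0. This is its solution with a = 1/2, k being the fiber dimension. *)
Definition weyl_unit k := KT 2^-1 (- (2 * k)^-1) (k * (k - 1))^-1 0.

(** Linearity in the endomorphism, checked on pairings because these alone determine [D] and [D0]
    here. It extracts rho from the action of C. *)
Lemma act4_KT_scale r a b c d D D0 a' b' c' d' X1 X2 X3 X4 X Y :
  KT_operator (r * a) (r * b) (r * c) (r * d) D -> KT_operator a b c d D0 ->
  act4 D (KT a' b' c' d') X1 X2 X3 X4 X Y = r * act4 D0 (KT a' b' c' d') X1 X2 X3 X4 X Y.
Proof.
move=> opD op0; have hD X Y Z W := let: And3 h _ _ := opD X Y Z W in h.
have fD X Y Z W := let: And3 _ h _ := opD X Y Z W in h.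
have sD X Y Z W := let: And3 _ _ h := opD X Y Z W in h.
have h0 X Y Z W := let: And3 h _ _ := op0 X Y Z W in h.
have f0 X Y Z W := let: And3 _ h _ := op0 X Y Z W in h.
have s0 X Y Z W := let: And3 _ _ h := op0 X Y Z W in h.
rewrite /act4 /KT /kulkarni.
rewrite !(HC _ (D _ _ _)) !(FC _ (D _ _ _)) !(SC _ (D _ _ _)).
rewrite !(HC _ (D0 _ _ _)) !(FC _ (D0 _ _ _)) !(SC _ (D0 _ _ _)).
by rewrite !hD !fD !sD !h0 !f0 !s0; ring.
Qed.

Lemma act4_wedge_lin r r' u v w u' v' w' D D1 D2 a b c d X1 X2 X3 X4 X Y :
  wedge_operator (r * u + r' * u') (r * v + r' * v') (r * w + r' * w') D ->
  wedge_operator u v w D1 -> wedge_operator u' v' w' D2 ->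
  act4 D (KT a b c d) X1 X2 X3 X4 X Y =
  r * act4 D1 (KT a b c d) X1 X2 X3 X4 X Y + r' * act4 D2 (KT a b c d) X1 X2 X3 X4 X Y.
Proof.
move=> opD op1 op2; have hD X Y Z W := let: And3 h _ _ := opD X Y Z W in h.
have fD X Y Z W := let: And3 _ h _ := opD X Y Z W in h.
have sD X Y Z W := let: And3 _ _ h := opD X Y Z W in h.
have h1 X Y Z W := let: And3 h _ _ := op1 X Y Z W in h.
have f1 X Y Z W := let: And3 _ h _ := op1 X Y Z W in h.
have s1 X Y Z W := let: And3 _ _ h := op1 X Y Z W in h.
have h2 X Y Z W := let: And3 h _ _ := op2 X Y Z W in h.
have f2 X Y Z W := let: And3 _ h _ := op2 X Y Z W in h.
have s2 X Y Z W := let: And3 _ _ h := op2 X Y Z W in h.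
rewrite /act4 /KT /kulkarni.
rewrite !(HC _ (D _ _ _)) !(FC _ (D _ _ _)) !(SC _ (D _ _ _)).
rewrite !(HC _ (D1 _ _ _)) !(FC _ (D1 _ _ _)) !(SC _ (D1 _ _ _)).
rewrite !(HC _ (D2 _ _ _)) !(FC _ (D2 _ _ _)) !(SC _ (D2 _ _ _)).
by rewrite !hD !fD !sD !h1 !f1 !s1 !h2 !f2 !s2; ring.
Qed.

(** Q(g, G) = 0: the endomorphism X wedge_g Y is skew for g, and G is built from g alone. *)
Lemma act4_wedge_Gtensor Dg X1 X2 X3 X4 X Y : wedge_operator 1 0 1 Dg ->
  act4 Dg (KT 1 1 1 0) X1 X2 X3 X4 X Y = 0.
Proof.
move=> opg; have hg X Y Z W := let: And3 h _ _ := opg X Y Z W in h.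
have fg X Y Z W := let: And3 _ h _ := opg X Y Z W in h.
have sg X Y Z W := let: And3 _ _ h := opg X Y Z W in h.
rewrite /act4 /KT /kulkarni.
rewrite !(HC _ (Dg _ _ _)) !(FC _ (Dg _ _ _)) !(SC _ (Dg _ _ _)) !hg !fg !sg.
pairwise_sym X1 X2 X3 X4 X Y.
by field.
Qed.

(* This is - Q(A, K). *)
Definition slot_sum (A : vec -> vec -> R) (K : vec -> vec -> vec -> vec -> R)
    (X1 X2 X3 X4 X Y : vec) : R :=
  A Y X1 * K X X2 X3 X4 - A X X1 * K Y X2 X3 X4
  + (A Y X2 * K X1 X X3 X4 - A X X2 * K X1 Y X3 X4)
  + (A Y X3 * K X1 X2 X X4 - A X X3 * K X1 X2 Y X4)
  + (A Y X4 * K X1 X2 X3 X - A X X4 * K X1 X2 X3 Y).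

(** This carries a relation among four arguments to six: any Q(A, .) of a vanishing tensor
    vanishes. *)
Lemma slot_sum0 A K X1 X2 X3 X4 X Y : (forall X1 X2 X3 X4, K X1 X2 X3 X4 = 0) ->
  slot_sum A K X1 X2 X3 X4 X Y = 0.
Proof. by move=> K0; rewrite /slot_sum !K0; ring. Qed.

Lemma slot_sum_FSS X1 X2 X3 X4 X Y : slot_sum F (fun X1 X2 X3 X4 =>
  kulkarni S S X1 X2 X3 X4 + e * kulkarni H H X1 X2 X3 X4) X1 X2 X3 X4 X Y = 0.
Proof. by apply: slot_sum0 => *; rewrite SS; ring. Qed.

Lemma slot_sum_FHS X1 X2 X3 X4 X Y : slot_sum F (kulkarni H S) X1 X2 X3 X4 X Y = 0.
Proof. exact: slot_sum0. Qed.

(* Q(S, h /\ h) = - 2 Q(h, h /\ S), and h /\ S vanishes. *)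
Lemma slot_sum_SHH X1 X2 X3 X4 X Y : slot_sum S (kulkarni H H) X1 X2 X3 X4 X Y = 0.
Proof.
transitivity (- 2 * slot_sum H (kulkarni H S) X1 X2 X3 X4 X Y).
  by rewrite /slot_sum /kulkarni; pairwise_sym X1 X2 X3 X4 X Y; ring.
by rewrite slot_sum0 ?mulr0.
Qed.

(* The multipliers passed to this lemma come from comparing coefficients. *)
Lemma eq_mod_slot_sums (c1 c2 c3 a b : R) X1 X2 X3 X4 X Y :
  a - b = c1 * slot_sum F (fun X1 X2 X3 X4 =>
      kulkarni S S X1 X2 X3 X4 + e * kulkarni H H X1 X2 X3 X4) X1 X2 X3 X4 X Y
    + c2 * slot_sum F (kulkarni H S) X1 X2 X3 X4 X Y
    + c3 * slot_sum S (kulkarni H H) X1 X2 X3 X4 X Y -> a = b.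
Proof.
rewrite slot_sum_FSS slot_sum_FHS slot_sum_SHH !mulr0 !addr0.
by move/eqP; rewrite subr_eq0 => /eqP.
Qed.

(** Both factors involve only h and f, so once arguments are ordered this is a plain polynomial
    identity. *)
Lemma weyl_weyl k D Dg X1 X2 X3 X4 X Y : k != 0 -> k - 1 != 0 ->
  KT_operator 2^-1 (- (2 * k)^-1) (k * (k - 1))^-1 0 D -> wedge_operator 1 0 1 Dg ->
  act4 D (weyl_unit k) X1 X2 X3 X4 X Y =
  - (2 * k)^-1 * act4 Dg (weyl_unit k) X1 X2 X3 X4 X Y.
Proof.
move=> k0 k1 opD opg.
have hD X Y Z W := let: And3 h _ _ := opD X Y Z W in h.
have fD X Y Z W := let: And3 _ h _ := opD X Y Z W in h.
have sD X Y Z W := let: And3 _ _ h := opD X Y Z W in h.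
have hg X Y Z W := let: And3 h _ _ := opg X Y Z W in h.
have fg X Y Z W := let: And3 _ h _ := opg X Y Z W in h.
have sg X Y Z W := let: And3 _ _ h := opg X Y Z W in h.
rewrite /weyl_unit /act4 /KT /kulkarni.
rewrite !(HC _ (D _ _ _)) !(FC _ (D _ _ _)) !(SC _ (D _ _ _)).
rewrite !(HC _ (Dg _ _ _)) !(FC _ (Dg _ _ _)) !(SC _ (Dg _ _ _)).
rewrite !hD !fD ?sD !hg !fg ?sg.
pairwise_sym X1 X2 X3 X4 X Y.
by field; rewrite k0 k1.
Qed.

Section WarpedProductTensors.
Variables (k al be ga ta : R).
Hypotheses (k0 : k != 0) (k1 : k - 1 != 0) (k2 : k + 1 != 0).
(** [A1], [- b] and [t1] are the coefficients of h, s and f in the Ricci tensor, see [point_Ric]. *)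
Let A1 := al - be * ta * k / 2.
Let b := be * k.
Let t1 := ga * (k - 1) - be * ta.
Let Rm := KT al (- (be * ta / 2)) ga (- be).
Let W := weyl_unit k.
Variables DR DW DS Dg : vec -> vec -> vec -> vec.
Hypotheses (opR : KT_operator al (- (be * ta / 2)) ga (- be) DR)
  (opW : KT_operator 2^-1 (- (2 * k)^-1) (k * (k - 1))^-1 0 DW)
  (opS : wedge_operator A1 (- b) t1 DS) (opg : wedge_operator 1 0 1 Dg).

Let hR X Y Z W := let: And3 h _ _ := opR X Y Z W in h.
Let fR X Y Z W := let: And3 _ h _ := opR X Y Z W in h.
Let sR X Y Z W := let: And3 _ _ h := opR X Y Z W in h.
Let hW X Y Z W := let: And3 h _ _ := opW X Y Z W in h.
Let fW X Y Z W := let: And3 _ h _ := opW X Y Z W in h.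
Let sW X Y Z W := let: And3 _ _ h := opW X Y Z W in h.
Let hS X Y Z W := let: And3 h _ _ := opS X Y Z W in h.
Let fS X Y Z W := let: And3 _ h _ := opS X Y Z W in h.
Let sS X Y Z W := let: And3 _ _ h := opS X Y Z W in h.
Let hg X Y Z W := let: And3 h _ _ := opg X Y Z W in h.
Let fg X Y Z W := let: And3 _ h _ := opg X Y Z W in h.
Let sg X Y Z W := let: And3 _ _ h := opg X Y Z W in h.

(** The factor on the right is L rho, see [LE]; stating the identity for W = C / rho keeps it
    polynomial in the curvature data. *)
Lemma riem_riem X1 X2 X3 X4 X Y :
  act4 DR Rm X1 X2 X3 X4 X Y - act4 DS Rm X1 X2 X3 X4 X Y =
  - (k * (k - 1) / (k + 1)) * (2 * al * ga + 2 * be ^+ 2 * e - be ^+ 2 * ta ^+ 2 / 2)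
    * act4 Dg W X1 X2 X3 X4 X Y.
Proof.
apply: (eq_mod_slot_sums (c1 := - (be ^+ 2 * (k - 1) / 2))
  (c2 := be * al - be ^+ 2 * ta * (k - 1) / 2) (c3 := - (b * al / 2))
  (X1 := X1) (X2 := X2) (X3 := X3) (X4 := X4) (X := X) (Y := Y)).
rewrite /slot_sum /W /Rm /weyl_unit /act4 /KT /kulkarni.
rewrite !(HC _ (DR _ _ _)) !(FC _ (DR _ _ _)) !(SC _ (DR _ _ _)).
rewrite !(HC _ (DS _ _ _)) !(FC _ (DS _ _ _)) !(SC _ (DS _ _ _)).
rewrite !(HC _ (Dg _ _ _)) !(FC _ (Dg _ _ _)) !(SC _ (Dg _ _ _)).
rewrite !hR !fR !sR !hS !fS !sS !hg !fg ?sg /A1 /b /t1.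
pairwise_sym X1 X2 X3 X4 X Y.
by field; rewrite k0 k1 k2.
Qed.

Let rho := 2 * (k - 1) / (k + 1) * (al + ga + be * ta).

(** Every term of the identity for C.R + R.C contains C exactly once, so rho is divided out and W
    stands for C. *)
Lemma weyl_riem_sum X1 X2 X3 X4 X Y :
  act4 DW Rm X1 X2 X3 X4 X Y + act4 DR W X1 X2 X3 X4 X Y =
  act4 DS W X1 X2 X3 X4 X Y
  + (- (k^-1 * (al + (k - 1) ^+ 2 * ga - (k - 1) * be * ta)) - rho / (2 * k))
    * act4 Dg W X1 X2 X3 X4 X Y.
Proof.
apply: (eq_mod_slot_sums (c1 := 0) (c2 := be / (2 * k)) (c3 := - (b / 4))
  (X1 := X1) (X2 := X2) (X3 := X3) (X4 := X4) (X := X) (Y := Y)).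
rewrite /slot_sum /rho /W /Rm /weyl_unit /act4 /KT /kulkarni.
rewrite !(HC _ (DR _ _ _)) !(FC _ (DR _ _ _)) !(SC _ (DR _ _ _)).
rewrite !(HC _ (DW _ _ _)) !(FC _ (DW _ _ _)) !(SC _ (DW _ _ _)).
rewrite !(HC _ (DS _ _ _)) !(FC _ (DS _ _ _)) !(SC _ (DS _ _ _)).
rewrite !(HC _ (Dg _ _ _)) !(FC _ (Dg _ _ _)) !(SC _ (Dg _ _ _)).
rewrite !hR !fR !sR !hS !fS !sS !hW !fW !sW !hg !fg ?sg /A1 /b /t1.
pairwise_sym X1 X2 X3 X4 X Y.
by field; rewrite k0 k1 k2.
Qed.

Let u := A1 - t1.
Variable DA : vec -> vec -> vec -> vec.
Hypothesis opA : wedge_operator u (- b) 0 DA.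
Let hA X Y Z W := let: And3 h _ _ := opA X Y Z W in h.

(** The middle term is g /\ Q(A, h) with A = S - t1 g = u h - b s. It is provisional:
    [ricci_square_wedge] trades it for g /\ Q(S, S^2). *)
Lemma weyl_riem X1 X2 X3 X4 X Y :
  act4 DW Rm X1 X2 X3 X4 X Y =
  (2 * k ^+ 2)^-1 * act4 DS (KT 1 1 1 0) X1 X2 X3 X4 X Y
  - (k + 1) / (2 * k ^+ 2) * kulkarni (fun U V => H U V + F U V)
      (fun U V => act2 DA H U V X Y) X1 X2 X3 X4
  - rho / (2 * k) * act4 Dg W X1 X2 X3 X4 X Y.
Proof.
apply: (eq_mod_slot_sums (c1 := 0) (c2 := be / (2 * k)) (c3 := b / (4 * k))
  (X1 := X1) (X2 := X2) (X3 := X3) (X4 := X4) (X := X) (Y := Y)).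
rewrite /slot_sum /rho /W /Rm /weyl_unit /act4 /act2 /KT /kulkarni.
rewrite !(HC _ (DW _ _ _)) !(FC _ (DW _ _ _)) !(SC _ (DW _ _ _)).
rewrite !(HC _ (DS _ _ _)) !(FC _ (DS _ _ _)) !(SC _ (DS _ _ _)).
rewrite !(HC _ (Dg _ _ _)) !(FC _ (Dg _ _ _)) !(SC _ (Dg _ _ _)).
rewrite !(HC _ (DA _ _ _)) !hA.
rewrite !hS !fS !sS !hW !fW !sW !hg !fg ?sg /u /A1 /b /t1.
pairwise_sym X1 X2 X3 X4 X Y.
by field; rewrite k0 k1 k2.
Qed.

(** [DD] belongs to t1^2 S - t1 S^2, whose f-part cancels. Expanding S = A + t1 g gives g /\ Q(S,
    S^2) = g /\ Q(A, A^2) + Q(t1^2 S - t1 S^2, G), and Cayley-Hamilton on the base, A^2 = 2 u A -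
    (u^2 - b^2 e) h, turns Q(A, A^2) into - (u^2 - b^2 e) Q(A, h). *)
Lemma ricci_square_wedge DD X1 X2 X3 X4 X Y :
  wedge_operator (t1 ^+ 2 * A1 - t1 * (A1 ^+ 2 + b ^+ 2 * e))
    (- (t1 ^+ 2 * b) + 2 * t1 * A1 * b) 0 DD ->
  act4 DD (KT 1 1 1 0) X1 X2 X3 X4 X Y
  - kulkarni (fun U V => H U V + F U V) (fun U V => act2 DS
      (fun X Y => (A1 ^+ 2 + b ^+ 2 * e) * H X Y - 2 * A1 * b * S X Y + t1 ^+ 2 * F X Y)
      U V X Y) X1 X2 X3 X4 =
  (u ^+ 2 - b ^+ 2 * e) * kulkarni (fun U V => H U V + F U V)
      (fun U V => act2 DA H U V X Y) X1 X2 X3 X4.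
Proof.
move=> opD; have hD X Y Z W := let: And3 h _ _ := opD X Y Z W in h.
have fD X Y Z W := let: And3 _ h _ := opD X Y Z W in h.
have sD X Y Z W := let: And3 _ _ h := opD X Y Z W in h.
rewrite /act4 /act2 /KT /kulkarni.
rewrite !(HC _ (DD _ _ _)) !(FC _ (DD _ _ _)) !(SC _ (DD _ _ _)).
rewrite !(HC _ (DS _ _ _)) !(FC _ (DS _ _ _)) !(SC _ (DS _ _ _)).
rewrite !(HC _ (DA _ _ _)) !hA.
rewrite !hS !fS !sS !hD !fD !sD /u /A1 /b /t1.
pairwise_sym X1 X2 X3 X4 X Y.
by field.
Qed.

End WarpedProductTensors.

End CurvatureAlgebra.

(** With e = - det s / det g, the first claim is Cayley-Hamilton for a trace-free endomorphism of a
    plane. Tensors antisymmetric in both pairs have one component there: for h/\s it is the trace of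
    s up to a factor, for s/\s it is the determinant of s. *)
Lemma tracefree2 (R : realType) (g s : 'M[R]_2) :
  g^T = g -> s^T = s -> g \in unitmx -> mtrace g s = 0 ->
  exists e, [/\ s *m invmx g *m s = e *: g,
    forall i j k l,
      g i l * s j k + g j k * s i l - g i k * s j l - g j l * s i k = 0 &
    forall i j k l,
      s i l * s j k - s i k * s j l = - e * (g i l * g j k - g i k * g j l)].
Proof.
move=> gT sT gu; have g10 : g 1 0 = g 0 1 by rewrite -{1}gT mxE.
have s10 : s 1 0 = s 0 1 by rewrite -{1}sT mxE.
pose d := g 0 0 * g 1 1 - g 0 1 * g 0 1.
have d0 : d != 0 by have := gu; rewrite unitmxE unitfE det2E g10.
pose gi : 'M[R]_2 := \matrix_(i, j) (d^-1 * (if i == j then if i == 0 then g 1 1 else g 0 0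
   else - g 0 1)).
have giE : invmx g = gi.
  apply: (can_inj (mulKmx gu)); rewrite mulmxV //; apply/matrixP => i j.
  rewrite mulmx2E !mxE.
  move: d0; rewrite /d => d0.
  by case: (ord2P i) => ->; case: (ord2P j) => ->; rewrite /= ?g10; field.
have gi00 : gi 0 0 = g 1 1 / d by rewrite mxE /= mulrC.
have gi01 : gi 0 1 = - g 0 1 / d by rewrite mxE /= mulrC.
have gi10 : gi 1 0 = - g 0 1 / d by rewrite mxE /= mulrC.
have gi11 : gi 1 1 = g 0 0 / d by rewrite mxE /= mulrC.
rewrite giE /mtrace giE /mxtrace !big_ord_recl big_ord0 addr0.
have -> : lift ord0 ord0 = 1 :> 'I_2 by exact: val_inj.
rewrite !mulmx2E gi00 gi01 gi10 gi11 s10 => tr0.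
have {}tr0 : s 0 0 * g 1 1 - 2 * (s 0 1 * g 0 1) + s 1 1 * g 0 0 = 0.
  by apply: (mulIf (invr_neq0 d0)); rewrite mul0r -tr0; ring.
exists (- ((s 0 0 * s 1 1 - s 0 1 * s 0 1) / d)).
(* [q] is - e as an atom, which clears the denominators for [ring] and [lra]. *)
have [q qE] : exists q, s 0 0 * s 1 1 - s 0 1 * s 0 1 = q * d.
  by exists ((s 0 0 * s 1 1 - s 0 1 * s 0 1) / d); rewrite divfK.
have -> : - ((s 0 0 * s 1 1 - s 0 1 * s 0 1) / d) = - q by rewrite qE mulfK.
split.
- apply/matrixP => i j; rewrite !mulmx2E [RHS]mxE.
  apply: (mulIf d0).
  (* Entrywise Cayley-Hamilton, multiplied by d: the trace times s minus the determinant of s times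
     g. *)
  transitivity (s i j * (s 0 0 * g 1 1 - 2 * (s 0 1 * g 0 1) + s 1 1 * g 0 0)
      - g i j * (s 0 0 * s 1 1 - s 0 1 * s 0 1)); last by rewrite tr0 qE; ring.
  by case: (ord2P i) => ->; case: (ord2P j) => ->;
    rewrite ?gi00 ?gi01 ?gi10 ?gi11 ?s10 ?g10; field.
- move=> i j k l; case: (ord2P i) => ->; case: (ord2P j) => ->; case: (ord2P k) => ->;
    case: (ord2P l) => ->; rewrite ?g10 ?s10; lra.
- move=> i j k l; move: qE; rewrite /d => qE.
  case: (ord2P i) => ->; case: (ord2P j) => ->; case: (ord2P k) => ->;
    case: (ord2P l) => ->; rewrite ?g10 ?s10; lra.
Qed.

Lemma bil_tr (R : realType) (m : nat) (A : 'M[R]_m) X Y : A^T = A -> bil A X Y = bil A Y X.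
Proof.
move=> AT; rewrite !bilE exchange_big; apply: eq_bigr => i _; apply: eq_bigr => j _.
by rewrite -{1}AT mxE [X 0 j * _]mulrC.
Qed.

Lemma bilD (R : realType) (m : nat) (A B : 'M[R]_m) X Y :
  bil (A + B) X Y = bil A X Y + bil B X Y.
Proof. by rewrite /bil mulmxDr mulmxDl mxE. Qed.

Lemma bilZ (R : realType) (m : nat) a (A : 'M[R]_m) X Y :
  bil (a *: A) X Y = a * bil A X Y.
Proof. by rewrite /bil -scalemxAr -scalemxAl mxE. Qed.

Lemma bil_lin (R : realType) (m : nat) (A : 'M[R]_m) a b X Z Y :
  bil A (a *: X - b *: Z) Y = a * bil A X Y - b * bil A Z Y.
Proof. by rewrite /bil mulmxBl mulmxBl -!scalemxAl !mxE. Qed.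

Lemma mtrace_msquare_tracefree (R : realType) (g s : 'M[R]_2) c e : g \in unitmx ->
  s *m invmx g *m s = e *: g -> mtrace g s = 0 ->
  mtrace g (msquare g (c *: g + s)) = 2 * c ^+ 2 + 2 * e.
Proof.
move=> gu sgs trs; have -> : msquare g (c *: g + s) = (c ^+ 2 + e) *: g + (2 * c) *: s.
  rewrite /msquare !mulmxDl !mulmxDr -!scalemxAl -!scalemxAr mulmxV // !mul1mx.
  rewrite mulmxKV // sgs.
  by apply/matrixP => i j; rewrite !mxE; ring.
rewrite /mtrace mulmxDl linearD /= -!scalemxAl !linearZ /= mulmxV // mxtrace1.
by rewrite -/(mtrace g s) trs; ring.
Qed.

(** * Algebra of the block tensors u h + v s + w f *)

Section BlockTensors.
Context {R : realType} {k : nat}.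
Variables (g1 T : 'M[R]_2) (g2 : 'M[R]_k).
Hypotheses (g1_sym : g1^T = g1) (g1_unit : g1 \in unitmx) (T_sym : T^T = T)
  (g2_sym : g2^T = g2) (g2_unit : g2 \in unitmx).

Let tau := mtrace g1 T.
Let s1 := T - (tau / 2) *: g1.
Let h : 'M[R]_(2 + k) := block_mx g1 0 0 0.
Let f : 'M[R]_(2 + k) := block_mx 0 0 0 g2.
Let s : 'M[R]_(2 + k) := block_mx s1 0 0 0.
Let g := h + f.

(** The span of h, s, f is closed under A g^-1 B, so Ricci tensors, their squares and traces become
    computations with triples of scalars. *)
Definition comb_mx u v w : 'M[R]_(2 + k) := block_mx (u *: g1 + v *: s1) 0 0 (w *: g2).

Let gE : g = block_mx g1 0 0 g2.
Proof. by rewrite /g /h /f add_block_mx !addr0 !add0r. Qed.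

Let hE : h = comb_mx 1 0 0.
Proof. by rewrite /comb_mx scale1r !scale0r addr0. Qed.
Let fE : f = comb_mx 0 0 1.
Proof. by rewrite /comb_mx scale1r !scale0r addr0. Qed.
Let sE : s = comb_mx 0 1 0.
Proof. by rewrite /comb_mx scale1r !scale0r add0r. Qed.

Lemma comb_mxE u v w : comb_mx u v w = u *: h + v *: s + w *: f.
Proof.
by rewrite /comb_mx /h /s /f !scale_block_mx !scaler0 !add_block_mx !addr0 !add0r.
Qed.

Lemma comb_metric : g = comb_mx 1 0 1.
Proof. by rewrite gE /comb_mx !scale1r scale0r addr0. Qed.

Lemma comb_mxD u v w u' v' w' :
  comb_mx u v w + comb_mx u' v' w' = comb_mx (u + u') (v + v') (w + w').
Proof. by rewrite /comb_mx add_block_mx !addr0 addrACA -!scalerDl. Qed.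

Lemma comb_mxZ a u v w : a *: comb_mx u v w = comb_mx (a * u) (a * v) (a * w).
Proof. by rewrite !comb_mxE !scalerDr !scalerA. Qed.

Lemma comb_mxN u v w : - comb_mx u v w = comb_mx (- u) (- v) (- w).
Proof. by rewrite -scaleN1r comb_mxZ !mulN1r. Qed.

Let s1_sym : s1^T = s1.
Proof. by rewrite /s1 linearB linearZ /= T_sym g1_sym. Qed.

Let trs : mtrace g1 s1 = 0.
Proof.
rewrite /s1 /mtrace mulmxBl linearB /= -/(mtrace g1 T) -scalemxAl linearZ /=.
by rewrite mulmxV // mxtrace1 /tau divfK ?subrr // pnatr_eq0.
Qed.

Lemma comb_mx_tr u v w : (comb_mx u v w)^T = comb_mx u v w.
Proof.
by rewrite /comb_mx tr_block_mx !trmx0 linearD /= !linearZ /= g1_sym g2_sym s1_sym.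
Qed.

Let ginv : invmx g = block_mx (invmx g1) 0 0 (invmx g2).
Proof. by rewrite gE invmx_block_diag. Qed.

Lemma comb_mx_mtrace u v w : mtrace g (comb_mx u v w) = 2 * u + k%:R * w.
Proof.
rewrite /mtrace ginv mulmx_block !(mulmx0, mul0mx, addr0, add0r) mxtrace_block.
rewrite mulmxDl linearD /= -!scalemxAl !linearZ /= -/(mtrace g1 s1) trs mulr0 addr0.
by rewrite !mulmxV // !mxtrace1 mulrC [w * _]mulrC.
Qed.

Let H := bil h.
Let F := bil f.
Let S := bil s.

Lemma bil_comb u v w X Y : bil (comb_mx u v w) X Y = u * H X Y + v * S X Y + w * F X Y.
Proof. by rewrite comb_mxE !bilD !bilZ. Qed.

Lemma wedge_op_comb u v w : wedge_operator H F S u v w (wedge_op (comb_mx u v w)).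
Proof.
by move=> X Y Z W /=; rewrite /wedge_op !bil_comb; split; exact: bil_lin.
Qed.

Lemma bil_base_sym X Y : H X Y = H Y X.
Proof. by apply: bil_tr; rewrite hE comb_mx_tr. Qed.
Lemma bil_fiber_sym X Y : F X Y = F Y X.
Proof. by apply: bil_tr; rewrite fE comb_mx_tr. Qed.
Lemma bil_tracefree_sym X Y : S X Y = S Y X.
Proof. by apply: bil_tr; rewrite sE comb_mx_tr. Qed.

(** From here on s is known only through the scalar [e] and these relations; the last one links [e]
    to tr(T^2), which is needed for L. *)
Lemma block_tracefree : exists e, [/\ (forall u v w u' v' w',
    comb_mx u v w *m invmx g *m comb_mx u' v' w' =
    comb_mx (u * u' + v * v' * e) (u * v' + v * u') (w * w')),
  (forall X1 X2 X3 X4, kulkarni H S X1 X2 X3 X4 = 0),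
  (forall X1 X2 X3 X4, kulkarni S S X1 X2 X3 X4 = - e * kulkarni H H X1 X2 X3 X4) &
  mtrace g1 (msquare g1 T) = tau ^+ 2 / 2 + 2 * e].
Proof.
have [e [sgs hs ss]] := tracefree2 g1_sym s1_sym g1_unit trs.
exists e; split.
- move=> u v w u' v' w'; rewrite ginv /comb_mx !mulmx_block.
  rewrite !(mulmx0, mul0mx, addr0, add0r); congr block_mx; last first.
    by rewrite -!scalemxAl -!scalemxAr mulmxV // mul1mx scalerA.
  rewrite !mulmxDl !mulmxDr -!scalemxAl -!scalemxAr !mulmxV // !mul1mx !mulmxKV // sgs.
  by rewrite !scalerA; apply/matrixP => i j; rewrite !mxE; ring.
(* The zero components are written 0 * 0 so that [mlin4Z] can extract the factor 0. *)
{ move=> X1 X2 X3 X4; rewrite [LHS]kn_mlin4 (eq_mlin4 (b := fun _ _ _ _ => 0 * 0)).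
    by rewrite mlin4Z mul0r.
  move=> i j p q; rewrite mulr0 /h /s.
  case: (split_ordP i) => a ->; case: (split_ordP j) => b ->;
    case: (split_ordP p) => c ->; case: (split_ordP q) => d ->;
    rewrite !(block_mxEul, block_mxEur, block_mxEdl, block_mxEdr); try exact: hs.
  all: by rewrite !mxE; ring. }
{ move=> X1 X2 X3 X4; rewrite [LHS]kn_mlin4 [kulkarni H H _ _ _ _]kn_mlin4 -mlin4Z.
  apply: eq_mlin4 => i j p q; rewrite /h /s.
  case: (split_ordP i) => a ->; case: (split_ordP j) => b ->;
    case: (split_ordP p) => c ->; case: (split_ordP q) => d ->;
    rewrite !(block_mxEul, block_mxEur, block_mxEdl, block_mxEdr).
  { have := ss a b c d; move: (s1 a d) (s1 b c) (s1 a c) (s1 b d)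
      (g1 a d) (g1 b c) (g1 a c) (g1 b d) => *; lra. }
  all: by rewrite !mxE; ring. }
- have {1}-> : T = (tau / 2) *: g1 + s1 by rewrite /s1 addrC subrK.
  by rewrite (mtrace_msquare_tracefree _ g1_unit sgs trs); field.
Qed.

Variable e : R.
Hypotheses (comb_mul : forall u v w u' v' w',
    comb_mx u v w *m invmx g *m comb_mx u' v' w' =
    comb_mx (u * u' + v * v' * e) (u * v' + v * u') (w * w'))
  (HS : forall X1 X2 X3 X4, kulkarni H S X1 X2 X3 X4 = 0)
  (SS : forall X1 X2 X3 X4, kulkarni S S X1 X2 X3 X4 = - e * kulkarni H H X1 X2 X3 X4).

Let K := KT H F S.

Lemma KT_kn a b c d X1 X2 X3 X4 : K a b c d X1 X2 X3 X4 =
  (a / 2) * kn h h X1 X2 X3 X4 + b * kn h f X1 X2 X3 X4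
  + ((c / 2) * kn f f X1 X2 X3 X4 + d * kn s f X1 X2 X3 X4).
Proof. by rewrite /K /KT /kn -/H -/F -/S !mulrA addrA. Qed.

(** Pairing a raised vector with h, f or s produces the products A g^-1 E evaluated by [comb_mul]; s
    g^-1 s = e h is the source of the factor e. *)
Lemma KT_operator_raise a b c d : KT_operator H F S e a b c d (raise g (K a b c d)).
Proof.
have bilC A E X W : bil E (X *m A *m invmx g) W = bil (A *m invmx g *m E) X W.
  by rewrite /bil !mulmxA.
have bil4 A a1 a2 a3 a4 (x1 x2 x3 x4 W : 'rV[R]_(2 + k)) :
    bil A (a1 *: x1 + a2 *: x2 - a3 *: x3 - a4 *: x4) W =
    a1 * bil A x1 W + a2 * bil A x2 W - a3 * bil A x3 W - a4 * bil A x4 W.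
  by rewrite /bil !mulmxBl !mulmxDl -!scalemxAl !mxE.
have bilS A a1 a2 a3 a4 (x1 x2 x3 x4 W : 'rV[R]_(2 + k)) :
    bil A (a1 *: x1 + a2 *: x2 + (a3 *: x3 + a4 *: x4)) W =
    a1 * bil A x1 W + a2 * bil A x2 W + (a3 * bil A x3 W + a4 * bil A x4 W).
  by rewrite /bil !mulmxDl -!scalemxAl !mxE.
move=> X Y Z W.
have -> : raise g (K a b c d) X Y Z = (a / 2) *: raise g (kn h h) X Y Z
    + b *: raise g (kn h f) X Y Z + ((c / 2) *: raise g (kn f f) X Y Z
    + d *: raise g (kn s f) X Y Z).
  rewrite /raise !scalemxAl -!mulmxDl; congr (_ *m _).
  by apply/rowP => j; rewrite !mxE KT_kn.
rewrite !raise_kn; split; [rewrite -[LHS]/(bil h _ _)|rewrite -[LHS]/(bil f _ _)|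
  rewrite -[LHS]/(bil s _ _)]; rewrite bilS !bil4 !bilC hE fE sE !comb_mul !bil_comb.
all: generalize (H Y Z) (H X Z) (H X W) (H Y W) (F Y Z) (F X Z) (F X W) (F Y W)
  (S Y Z) (S X Z) (S X W) (S Y W).

all: move=> *; by field.
Qed.

Lemma ricci_contraction_KT a b c d : ricci_contraction g (K a b c d) =
  comb_mx (a + b * k%:R) (d * k%:R) (2 * b + c * (k%:R - 1)).
Proof.
have -> : K a b c d = fun X1 X2 X3 X4 =>
    1 * (fun X1 X2 X3 X4 => (a / 2) * kn h h X1 X2 X3 X4 + b * kn h f X1 X2 X3 X4) X1 X2 X3 X4
    + 1 * (fun X1 X2 X3 X4 => (c / 2) * kn f f X1 X2 X3 X4 + d * kn s f X1 X2 X3 X4) X1 X2 X3 X4.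
  by do 4 (apply: funext => ?); rewrite KT_kn !mul1r.
rewrite !ricci_contraction_lin !scale1r !ricci_contraction_kn.
rewrite hE fE sE !comb_mx_mtrace !comb_mul !comb_mxZ !comb_mxN !comb_mxD.
rewrite !comb_mxZ !comb_mxD.
by congr comb_mx; field.
Qed.

(** The two sides differ by a multiple of h/\s plus a multiple of s/\s + e h/\h, both of which
    vanish. *)
Lemma kn_comb u v w u' v' w' X1 X2 X3 X4 :
  kn (comb_mx u v w) (comb_mx u' v' w') X1 X2 X3 X4 =
  K (2 * (u * u' - e * v * v')) (u * w' + w * u') (2 * w * w') (v * w' + w * v') X1 X2 X3 X4.
Proof.
apply/eqP; rewrite -subr_eq0; apply/eqP.
transitivity ((u * v' + v * u') * kulkarni H S X1 X2 X3 X4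
  + v * v' * (kulkarni S S X1 X2 X3 X4 + e * kulkarni H H X1 X2 X3 X4)); last first.
  by rewrite HS SS mulNr addNr !mulr0 addr0.
rewrite /kn /K /KT /kulkarni !bil_comb.
by generalize (H X1 X4) (H X2 X3) (H X1 X3) (H X2 X4) (F X1 X4) (F X2 X3) (F X1 X3)
  (F X2 X4) (S X1 X4) (S X2 X3) (S X1 X3) (S X2 X4) => *; field.
Qed.

Lemma Gtensor_KT X1 X2 X3 X4 : Gtensor g X1 X2 X3 X4 = K 1 1 1 0 X1 X2 X3 X4.
Proof. rewrite /Gtensor comb_metric kn_comb /K /KT.
by generalize (kulkarni H H X1 X2 X3 X4) (kulkarni H F X1 X2 X3 X4)
  (kulkarni F F X1 X2 X3 X4) (kulkarni S F X1 X2 X3 X4) => *; field. Qed.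

End BlockTensors.

(** * The warped product at a point *)

Section WarpedPoint.
Context {R : realType} {n : nat}.
Hypothesis n_ge4 : (4 <= n)%N.
Variables (M : semi_riemannian R 2) (N : semi_riemannian R (n - 2)) (F : M -> R).
Hypotheses (F_smooth : smooth_fun F) (F_gt0 : forall q, 0 < F q)
  (N_cst : (5 <= n)%N -> constant_curvature N).
Notation P := (warped_product N F_smooth F_gt0).
Variable p : P.

Let k : R := n%:R - 2.
Let g1 := metric_at p.1.
Let g2 := F p.1 *: metric_at p.2.
Let T := Ttensor F p.1.
Let tau := trT F p.1.
Let al := scal p.1 / 2.
Let be := (2 * F p.1)^-1.
Let ga := scal p.2 / (k * (k - 1) * F p.1) - Delta1 F p.1 / (4 * F p.1 ^+ 2).
Let H := bil (block_mx g1 0 0 0 : 'M[R]_(2 + (n - 2))).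
Let Fi := bil (block_mx 0 0 0 g2 : 'M[R]_(2 + (n - 2))).
Let S := bil (block_mx (T - (tau / 2) *: g1) 0 0 0 : 'M[R]_(2 + (n - 2))).
Let cmb := comb_mx g1 T g2.
Let K := KT H Fi S.
Let A1 := al - be * tau * k / 2.
Let b := be * k.
Let t1 := ga * (k - 1) - be * tau.
Let rho := 2 * (k - 1) / (k + 1) * (al + ga + be * tau).

Let kE : (n - 2)%:R = k.
Proof. by rewrite natrB // (leq_trans _ n_ge4). Qed.
Let k_ge2 : 2 <= k.
Proof. by rewrite -kE ler_nat leq_subRL // (leq_trans _ n_ge4). Qed.
Let nE : (2 + (n - 2))%:R = k + 2 :> R.
Proof. by rewrite natrD kE addrC. Qed.
Let nk : n%:R = k + 2 :> R.
Proof. by rewrite /k subrK. Qed.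
Let k0 : k != 0. Proof. by rewrite gt_eqF //; have := k_ge2; lra. Qed.
Let k1 : k - 1 != 0. Proof. by rewrite gt_eqF //; have := k_ge2; lra. Qed.
Let k2 : k + 1 != 0. Proof. by rewrite gt_eqF //; have := k_ge2; lra. Qed.
Let F0 : F p.1 != 0. Proof. by rewrite gt_eqF. Qed.

Lemma point_g1_sym : g1^T = g1. Proof. exact: metric_at_tr. Qed.
Lemma point_g1_unit : g1 \in unitmx. Proof. exact: metric_at_unit. Qed.
Lemma point_g2_sym : g2^T = g2.
Proof. by rewrite /g2 linearZ /= metric_at_tr. Qed.
Lemma point_g2_unit : g2 \in unitmx.
Proof. by rewrite unitmxZ ?metric_at_unit // unitfE. Qed.
Lemma point_T_sym : T^T = T. Proof. exact: Ttensor_tr. Qed.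

Lemma point_metric : metric_at p = cmb 1 0 1.
Proof. by rewrite warped_metric_at /cmb -comb_metric. Qed.

(** tau_1 is the coefficient of f in S, so subtracting tau_1 g removes the fiber part; see
    [point_A]. *)
Lemma point_tau1 : warp_tau1 N F p = t1.
Proof.
rewrite /warp_tau1 /t1 /ga /be /tau nk; move: (k) k0 k1 (F p.1) F0 => x x0 x1 y y0.
by field; rewrite ?x0 ?x1 ?y0.
Qed.

Lemma point_rho : warp_rho N F p = rho.
Proof.
rewrite /warp_rho /rho /al /ga /be /tau nk.
move: (k) k0 k1 k2 (F p.1) F0 => x x0 x1 x2 y y0.
by field; rewrite ?x0 ?x1 ?x2 ?y0.
Qed.

Lemma point_Riem : Riem p = K al (- (be * tau / 2)) ga (- be).
Proof.
have c1 : has_curvature p.1 (scal p.1 / (2 * (2 - 1))) by exact: has_curvature_scal.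
have c2 : has_curvature p.2 (scal p.2 / (k * (k - 1))).
  rewrite -kE; apply: has_curvature_scal => [|n5].
    by rewrite leq_subRL // (leq_trans _ n_ge4).
  by apply: N_cst; move: n5; rewrite leq_subRL // (leq_trans _ n_ge4).
have TE X Y : bil (warped_Ttensor p) X Y = tau / 2 * H X Y + S X Y.
  rewrite /H /S -bilZ -bilD; congr bil.
  by rewrite /warped_Ttensor scale_block_mx add_block_mx !scaler0 !addr0 addrC subrK.
apply: funext => X1; apply: funext => X2; apply: funext => X3; apply: funext => X4.
rewrite (Riem_warped _ _ _ _ c1 c2) /Gtensor /kn.
have -> : kulkarni (bil (warped_Ttensor p)) (bil (warped_fiber p)) X1 X2 X3 X4 =
    tau / 2 * kulkarni H Fi X1 X2 X3 X4 + kulkarni S Fi X1 X2 X3 X4.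
  rewrite /kulkarni !TE -/Fi.
  generalize (H X1 X4) (H X2 X3) (H X1 X3) (H X2 X4) (S X1 X4) (S X2 X3) (S X1 X3)
    (S X2 X4) (Fi X1 X4) (Fi X2 X3) (Fi X1 X3) (Fi X2 X4) => *; ring.
rewrite -/H -/Fi /K /KT /al /ga /be /tau.
generalize (kulkarni H H X1 X2 X3 X4) (kulkarni H Fi X1 X2 X3 X4)
  (kulkarni Fi Fi X1 X2 X3 X4) (kulkarni S Fi X1 X2 X3 X4) => hh hf ff sf.
move: (k) k0 k1 (F p.1) F0 => x x0 x1 y y0.
by field; rewrite ?x0 ?x1 ?y0.
Qed.

Variable e : R.
Let g : 'M[R]_(2 + (n - 2)) := block_mx g1 0 0 0 + block_mx 0 0 0 g2.
Hypotheses (e_mul : forall u v w u' v' w',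
    cmb u v w *m invmx g *m cmb u' v' w' =
    cmb (u * u' + v * v' * e) (u * v' + v * u') (w * w'))
  (HS : forall X1 X2 X3 X4, kulkarni H S X1 X2 X3 X4 = 0)
  (SS : forall X1 X2 X3 X4, kulkarni S S X1 X2 X3 X4 = - e * kulkarni H H X1 X2 X3 X4)
  (trT2E : trT2 F p.1 = tau ^+ 2 / 2 + 2 * e).

Let gE : metric_at p = g.
Proof. exact: warped_metric_at. Qed.

Let u := A1 - t1.
Let W := weyl_unit H Fi S k.
(** tr(A^2) - (tr A)^2 for A = u h - b s, that is, minus twice the determinant of the base block of
    A relative to [g1]. *)
Let theta := 2 * b ^+ 2 * e - 2 * u ^+ 2.

Lemma point_Ric : Ric p = cmb A1 (- b) t1.
Proof.
rewrite Ric_contraction gE point_Riem.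
rewrite (ricci_contraction_KT point_g1_unit point_g2_unit e_mul) kE.
by congr comb_mx; rewrite /A1 /b /t1; field.
Qed.

Lemma point_scal : scal p = 2 * A1 + k * t1.
Proof.
by rewrite /scal point_Ric gE (comb_mx_mtrace _ point_g1_unit point_g2_unit) kE.
Qed.

Lemma point_Ric2 : Ric2 p = cmb (A1 ^+ 2 + b ^+ 2 * e) (- (2 * A1 * b)) (t1 ^+ 2).
Proof.
by rewrite /Ric2 /msquare point_Ric gE e_mul; congr comb_mx; ring.
Qed.

Lemma point_A : Ric p - t1 *: metric_at p = cmb u (- b) 0.
Proof.
rewrite point_Ric point_metric /cmb comb_mxZ comb_mxN comb_mxD.
by congr comb_mx; rewrite /u; ring.
Qed.

(** The factor rho is left inside each coefficient, even in rho * 0, to match the hypothesis of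
    [act4_KT_scale]. *)
Lemma point_Weyl_KT : Weyl p =
  K (rho * 2^-1) (rho * - (2 * k)^-1) (rho * (k * (k - 1))^-1) (rho * 0).
Proof.
apply: funext => X1; apply: funext => X2; apply: funext => X3; apply: funext => X4.
rewrite /Weyl point_scal nE addrK point_Ric point_Riem {1}point_metric.
rewrite (kn_comb _ HS SS) gE (Gtensor_KT _ HS SS) -/H -/Fi -/S /K /KT.
have -> : k + 2 - 1 = k + 1 by ring.
generalize (kulkarni H H X1 X2 X3 X4) (kulkarni H Fi X1 X2 X3 X4)
  (kulkarni Fi Fi X1 X2 X3 X4) (kulkarni S Fi X1 X2 X3 X4) => hh hf ff sf.
rewrite /rho /A1 /b /t1; move: (k) k0 k1 k2 (al) (be) (ga) (tau).
move=> x x0 x1 x2 ? ? ? ?.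
by field; rewrite ?x0 ?x1 ?x2.
Qed.

Lemma point_Weyl X1 X2 X3 X4 : Weyl p X1 X2 X3 X4 = rho * W X1 X2 X3 X4.
Proof. by rewrite point_Weyl_KT /W /weyl_unit /K /KT !mulrDr !mulrA. Qed.

Let DW := raise g (K 2^-1 (- (2 * k)^-1) (k * (k - 1))^-1 0).
Let DR := raise g (K al (- (be * tau / 2)) ga (- be)).
Let DS := wedge_op (Ric p).
Let Dg := wedge_op (metric_at p).
Let DA := wedge_op (cmb u (- b) 0).
Let Rm := K al (- (be * tau / 2)) ga (- be).
Let HC := bil_base_sym point_g1_sym point_T_sym point_g2_sym.
Let FC := bil_fiber_sym point_g1_sym point_T_sym point_g2_sym.
Let SC := bil_tracefree_sym point_g1_sym point_T_sym point_g2_sym.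

Let opW : KT_operator H Fi S e 2^-1 (- (2 * k)^-1) (k * (k - 1))^-1 0 DW.
Proof. exact: KT_operator_raise. Qed.
Let opR : KT_operator H Fi S e al (- (be * tau / 2)) ga (- be) DR.
Proof. exact: KT_operator_raise. Qed.
Let opS : wedge_operator H Fi S A1 (- b) t1 DS.
Proof. by rewrite /DS point_Ric; exact: wedge_op_comb. Qed.
Let opg : wedge_operator H Fi S 1 0 1 Dg.
Proof. by rewrite /Dg point_metric; exact: wedge_op_comb. Qed.
Let opA : wedge_operator H Fi S u (- b) 0 DA.
Proof. exact: wedge_op_comb. Qed.

Variables X1 X2 X3 X4 X Y : 'rV[R]_(2 + (n - 2)).

Let act4_Weyl D : act4 D (Weyl p) X1 X2 X3 X4 X Y = rho * act4 D W X1 X2 X3 X4 X Y.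
Proof. by rewrite /act4 !point_Weyl -!mulrDr mulrN. Qed.

Let dot_Weyl a' b' c' d' : dot (metric_at p) (Weyl p) (K a' b' c' d') X1 X2 X3 X4 X Y =
  rho * act4 DW (K a' b' c' d') X1 X2 X3 X4 X Y.
Proof.
rewrite /dot gE point_Weyl_KT.
by apply: (act4_KT_scale HC FC SC) opW; exact: KT_operator_raise.
Qed.

Let Gg := act4 Dg W X1 X2 X3 X4 X Y.
Let GS := act4 DS W X1 X2 X3 X4 X Y.

Let Q4_metric_Weyl : Q4 (metric_at p) (Weyl p) X1 X2 X3 X4 X Y = rho * Gg.
Proof. exact: act4_Weyl. Qed.

Let Q4_Ric_Weyl : Q4 (Ric p) (Weyl p) X1 X2 X3 X4 X Y = rho * GS.
Proof. exact: act4_Weyl. Qed.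

Lemma point_weyl_weyl : dot (metric_at p) (Weyl p) (Weyl p) X1 X2 X3 X4 X Y =
  - (rho / (2 * k)) * Q4 (metric_at p) (Weyl p) X1 X2 X3 X4 X Y.
Proof.
rewrite Q4_metric_Weyl {2}point_Weyl_KT dot_Weyl -point_Weyl_KT act4_Weyl.
rewrite (weyl_weyl HC FC SC X1 X2 X3 X4 X Y k0 k1 opW opg) -/W -/Gg.
by move: (Gg) (rho) (k) k0 => ? ? x x0; field.
Qed.

Let L := warp_L N F p.
Let l := - (k * (k - 1) / (k + 1)) * (2 * al * ga + 2 * be ^+ 2 * e - be ^+ 2 * tau ^+ 2 / 2).

(** In L the trace terms of tau_1 + tr(T) / (2F) cancel to (k - 1) ga, and [trT2E] expresses tr(T^2)
    by [e]; multiplying by rho removes the quotient. *)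
Let LE : rho != 0 -> L * rho = l.
Proof.
move=> rho0; rewrite /L /warp_L point_rho point_tau1 trT2E -/tau nk /l /t1 /al /be.
move: (rho) rho0 (k) k0 k1 k2 (F p.1) F0 (ga) (tau).
by move=> r r0 x x0 x1 x2 y y0 ? ?; field; rewrite x2 r0 y0.
Qed.

Lemma point_riem_riem : rho != 0 ->
  dot (metric_at p) (Riem p) (Riem p) X1 X2 X3 X4 X Y
    - Q4 (Ric p) (Riem p) X1 X2 X3 X4 X Y =
  L * Q4 (metric_at p) (Weyl p) X1 X2 X3 X4 X Y.
Proof.
move=> rho0; rewrite Q4_metric_Weyl mulrA LE // point_Riem /dot gE.
exact: (riem_riem HC FC SC HS SS k0 k1 k2 opR opS opg X1 X2 X3 X4 X Y).
Qed.

Let nu := - (k^-1 * (al + (k - 1) ^+ 2 * ga - (k - 1) * be * tau)) - rho / (2 * k).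

Let weyl_riem_sumE :
  dot (metric_at p) (Weyl p) (Riem p) X1 X2 X3 X4 X Y
    + dot (metric_at p) (Riem p) (Weyl p) X1 X2 X3 X4 X Y = rho * (GS + nu * Gg).
Proof.
rewrite point_Riem dot_Weyl /dot gE act4_Weyl -mulrDr; congr (_ * _).
exact: (weyl_riem_sum HC FC SC HS SS k0 k1 k2 opR opW opS opg X1 X2 X3 X4 X Y).
Qed.

(** Splits the coefficient found in [weyl_riem_sum] into the parts of L, of L_C and a remainder in
    theta. The remainder is what Q(g, E) contributes in (i) and what becomes 1 / tau2 in (ii). *)
Let nuE : nu * rho =
  l - rho / (2 * k) * rho + (k - 1) / (k * (k + 1)) * theta.
Proof.
rewrite /nu /l /theta /u /rho /A1 /b /t1.
move: (k) k0 k1 k2 (al) (be) (ga) (tau) => x x0 x1 x2 ? ? ? ?.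
by field; rewrite ?x0 ?x2.
Qed.

Let E Z1 Z2 Z3 Z4 := (n%:R - 2) / 2 * kn (Ric p) (Ric p) Z1 Z2 Z3 Z4
  - scal p * kn (metric_at p) (Ric p) Z1 Z2 Z3 Z4
  + kn (metric_at p) (Ric2 p) Z1 Z2 Z3 Z4.
Let mu := (mtrace (metric_at p) (Ric2 p) - scal p ^+ 2) / (n%:R - 1).

(** The Ricci contraction of [E] is (tr(S^2) - kappa^2) g and that of G is (n - 1) g, so E - mu G is
    trace-free and hence a multiple of W. *)
Let EE Z1 Z2 Z3 Z4 : E Z1 Z2 Z3 Z4 = - (k * (k - 1) / (k + 1) * theta) * W Z1 Z2 Z3 Z4
  + mu * Gtensor (metric_at p) Z1 Z2 Z3 Z4.
Proof.
rewrite /E /mu point_scal point_Ric2 point_Ric -/k gE.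
rewrite (comb_mx_mtrace _ point_g1_unit point_g2_unit) kE nk (Gtensor_KT _ HS SS) -gE.
rewrite point_metric !(kn_comb _ HS SS) -/H -/Fi -/S /W /weyl_unit /KT.
generalize (kulkarni H H Z1 Z2 Z3 Z4) (kulkarni H Fi Z1 Z2 Z3 Z4)
  (kulkarni Fi Fi Z1 Z2 Z3 Z4) (kulkarni S Fi Z1 Z2 Z3 Z4) => hh hf ff sf.
rewrite /theta /u; have -> : k + 2 - 1 = k + 1 by ring.
move: (k) k0 k1 k2 (A1) (b) (t1) => x x0 x1 x2 ? ? ?.
by field; rewrite ?x0 ?x1 ?x2.
Qed.

Let Q4_metric_E : Q4 (metric_at p) E X1 X2 X3 X4 X Y =
  - (k * (k - 1) / (k + 1) * theta) * Gg.
Proof.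
have G0 : act4 Dg (Gtensor (metric_at p)) X1 X2 X3 X4 X Y = 0.
  have -> : Gtensor (metric_at p) = K 1 1 1 0.
    by rewrite gE; do 4 (apply: funext => ?); exact: (Gtensor_KT _ HS SS).
  exact: (act4_wedge_Gtensor HC FC SC).
have lin r r' (T1 T2 T3 : 'rV[R]_(2 + (n - 2)) -> _) :
    (forall Z1 Z2 Z3 Z4, T1 Z1 Z2 Z3 Z4 = r * T2 Z1 Z2 Z3 Z4 + r' * T3 Z1 Z2 Z3 Z4) ->
    act4 Dg T1 X1 X2 X3 X4 X Y =
    r * act4 Dg T2 X1 X2 X3 X4 X Y + r' * act4 Dg T3 X1 X2 X3 X4 X Y.
  by move=> T123; rewrite /act4 !T123; ring.
by rewrite /Q4 (lin _ _ _ _ _ EE) G0 mulr0 addr0.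
Qed.

Lemma point_weyl_riem_sum : rho != 0 ->
  dot (metric_at p) (Weyl p) (Riem p) X1 X2 X3 X4 X Y
    + dot (metric_at p) (Riem p) (Weyl p) X1 X2 X3 X4 X Y =
  Q4 (Ric p) (Weyl p) X1 X2 X3 X4 X Y
  + (L + - (rho / (2 * k))) * Q4 (metric_at p) (Weyl p) X1 X2 X3 X4 X Y
  - k ^- 2 * Q4 (metric_at p) E X1 X2 X3 X4 X Y.
Proof.
move=> rho0; rewrite weyl_riem_sumE Q4_Ric_Weyl Q4_metric_Weyl Q4_metric_E.
rewrite mulrDr [rho * (nu * _)]mulrA [rho * nu]mulrC nuE.
rewrite [(L + _) * _]mulrA [(L + _) * rho]mulrDl LE //.
move: (k) k0 k2 (GS) (Gg) (rho) (l) (theta) => x x0 x2 ? ? ? ? ?.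
by field; rewrite ?x0 ?x2.
Qed.

Let A := Ric p - warp_tau1 N F p *: metric_at p.
Let tau2 := (mtrace (metric_at p) (msquare (metric_at p) A) - mtrace (metric_at p) A ^+ 2)^-1.

Let AE : A = cmb u (- b) 0.
Proof. by rewrite /A point_tau1 point_A. Qed.

Let tau2E : tau2 = theta^-1.
Proof.
rewrite /tau2 AE /msquare gE e_mul !(comb_mx_mtrace _ point_g1_unit point_g2_unit).
by congr (_^-1); rewrite /theta; ring.
Qed.

(** Rank 2 makes the base block u g1 - b s1 invertible. Its product with the conjugate u g1 + b s1
    is - theta / 2 times g1, so theta = 0 would kill the conjugate; its trace then gives u = 0,
    hence b s1 = 0 and A = 0. *)
Lemma point_rank : \rank A = 2%N -> theta != 0.
Proof.
rewrite AE /cmb /comb_mx scale0r rank_diag_block_mx mxrank0 addn0 => rkA.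
pose s1 := T - (tau / 2) *: g1.
have uA : u *: g1 + - b *: s1 \in unitmx by rewrite -row_free_unit /row_free rkA.
apply/negP => /eqP th0.
have E2 : (u *: g1 + - b *: s1) *m invmx g1 *m (u *: g1 + b *: s1) = 0.
  have := congr1 ulsubmx (e_mul u (- b) 0 u b 0).
  rewrite /g add_block_mx !addr0 !add0r.
  rewrite invmx_block_diag ?point_g1_unit ?point_g2_unit // /cmb /comb_mx !mulmx_block.
  rewrite !block_mxKul !(mulmx0, mul0mx, addr0) -/s1 => ->.
  have -> : u * u + - b * b * e = - theta / 2 by rewrite /theta; field.
  have -> : u * b + - b * u = 0 by ring.
  by rewrite th0 oppr0 mul0r !scale0r addr0.
have B0 : u *: g1 + b *: s1 = 0.
  have := congr1 (fun B => g1 *m (invmx (u *: g1 + - b *: s1) *m B)) E2.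
  by rewrite !mulmx0 -mulmxA mulKmx // mulKVmx ?point_g1_unit.
have u0 : u = 0.
  have := congr1 (mtrace g1) B0; rewrite /mtrace mul0mx mxtrace0.
  rewrite mulmxDl linearD /= -!scalemxAl !linearZ /= mulmxV ?point_g1_unit // mxtrace1.
  rewrite /s1 mulmxBl linearB /= -scalemxAl linearZ /= mulmxV ?point_g1_unit // mxtrace1.
  rewrite -/(mtrace g1 T) -/(trT F p.1) -/tau divfK ?pnatr_eq0 // subrr mulr0 addr0.
  by move/eqP; rewrite mulf_eq0 pnatr_eq0 orbF => /eqP.
have : u *: g1 + - b *: s1 = 0.
  by move: B0; rewrite u0 !scale0r !add0r scaleNr => ->; rewrite oppr0.
by move=> A0; move: rkA; rewrite A0 mxrank0.
Qed.

Lemma point_Weyl_Ricci Z1 Z2 Z3 Z4 : rho != 0 -> theta != 0 ->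
  Weyl p Z1 Z2 Z3 Z4 = - ((n%:R - 1) * rho * tau2 / ((n%:R - 3) * (n%:R - 2))) *
    (E Z1 Z2 Z3 Z4 - mu * Gtensor (metric_at p) Z1 Z2 Z3 Z4).
Proof.
move=> rho0 th0; rewrite point_Weyl EE addrK tau2E nk.
move: (k) k0 k1 k2 (W Z1 Z2 Z3 Z4) (rho) (theta) th0 => x x0 x1 x2 w r th th0.
have -> : x + 2 - 1 = x + 1 by ring.
have -> : x + 2 - 3 = x - 1 by ring.
have -> : x + 2 - 2 = x by ring.
by field; rewrite ?x0 ?x1 ?x2 ?th0.
Qed.

Lemma point_riem_weyl_sum : rho != 0 -> theta != 0 ->
  dot (metric_at p) (Riem p) (Weyl p) X1 X2 X3 X4 X Y
    + dot (metric_at p) (Weyl p) (Riem p) X1 X2 X3 X4 X Y =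
  Q4 (Ric p) (Weyl p) X1 X2 X3 X4 X Y
  + (L - rho / (2 * (n%:R - 2)) + (n%:R - 3) / ((n%:R - 2) * (n%:R - 1) * rho * tau2))
    * Q4 (metric_at p) (Weyl p) X1 X2 X3 X4 X Y.
Proof.
move=> rho0 th0; rewrite addrC weyl_riem_sumE Q4_Ric_Weyl Q4_metric_Weyl tau2E nk.
have -> : L = l / rho by rewrite -LE // mulfK.
have -> : nu = (l - rho / (2 * k) * rho + (k - 1) / (k * (k + 1)) * theta) / rho.
  by rewrite -nuE mulfK.
move: (k) k0 k1 k2 (GS) (Gg) (rho) rho0 (l) (theta) th0 => x x0 x1 x2 ? ? r r0 ? th th0.
have -> : x + 2 - 1 = x + 1 by ring.
have -> : x + 2 - 3 = x - 1 by ring.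
have -> : x + 2 - 2 = x by ring.
by field; rewrite ?x0 ?x2 ?r0 ?th0.
Qed.

(** [ricci_square_wedge] is solved for g /\ Q(A, h) and substituted into [weyl_riem]. The division
    by theta creates [tau2], and the part Q(t1^2 S - t1 S^2, G) joins the term in Q(S, G). *)
Lemma point_weyl_riem : rho != 0 -> theta != 0 ->
  dot (metric_at p) (Weyl p) (Riem p) X1 X2 X3 X4 X Y =
  (n%:R - 2) ^- 2 * Q4 ((rho / 2 + (n%:R - 1) * rho * t1 ^+ 2 * tau2) *: Ric p
      - ((n%:R - 1) * rho * t1 * tau2) *: Ric2 p) (Gtensor (metric_at p)) X1 X2 X3 X4 X Y
  - (n%:R - 1) * rho * tau2 / (n%:R - 2) ^+ 2
    * kn4 (metric_at p) (Q2 (Ric p) (Ric2 p)) X1 X2 X3 X4 X Y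
  - rho / (2 * (n%:R - 2)) * Q4 (metric_at p) (Weyl p) X1 X2 X3 X4 X Y.
Proof.
move=> rho0 th0; rewrite Q4_metric_Weyl point_Riem dot_Weyl.
pose KA := kulkarni (fun U V => H U V + Fi U V) (fun U V => act2 DA H U V X Y) X1 X2 X3 X4.
have -> : act4 DW Rm X1 X2 X3 X4 X Y =
    (2 * k ^+ 2)^-1 * act4 DS (K 1 1 1 0) X1 X2 X3 X4 X Y
    - (k + 1) / (2 * k ^+ 2) * KA - rho / (2 * k) * Gg.
  exact: (weyl_riem HC FC SC HS SS k0 k1 k2 opW opS opg opA X1 X2 X3 X4 X Y).
rewrite -/k.
have -> : n%:R - 1 = k + 1 by rewrite nk; ring.
have -> : Gtensor (metric_at p) = K 1 1 1 0.
  by rewrite gE; do 4 (apply: funext => ?); exact: (Gtensor_KT _ HS SS).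
(* The operator of t1^2 S - t1 S^2. *)
pose DD := wedge_op (cmb (t1 ^+ 2 * A1 - t1 * (A1 ^+ 2 + b ^+ 2 * e))
    (- (t1 ^+ 2 * b) + 2 * t1 * A1 * b) 0).
have opD : wedge_operator H Fi S (t1 ^+ 2 * A1 - t1 * (A1 ^+ 2 + b ^+ 2 * e))
    (- (t1 ^+ 2 * b) + 2 * t1 * A1 * b) 0 DD by exact: wedge_op_comb.
have -> : Q4 ((rho / 2 + (k + 1) * rho * t1 ^+ 2 * tau2) *: Ric p
    - ((k + 1) * rho * t1 * tau2) *: Ric2 p) (K 1 1 1 0) X1 X2 X3 X4 X Y =
    rho / 2 * act4 DS (K 1 1 1 0) X1 X2 X3 X4 X Y
    + (k + 1) * rho * tau2 * act4 DD (K 1 1 1 0) X1 X2 X3 X4 X Y.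
  apply: (act4_wedge_lin HC FC SC) opS opD.
  rewrite point_Ric point_Ric2 /cmb !comb_mxZ comb_mxN comb_mxD.
  set c := comb_mx _ _ _ _ _ _; set c' := wedge_operator _ _ _ _ _ _.
  suff -> : c = comb_mx g1 T g2 (rho / 2 * A1 + (k + 1) * rho * tau2 *
      (t1 ^+ 2 * A1 - t1 * (A1 ^+ 2 + b ^+ 2 * e))) (rho / 2 * - b + (k + 1) * rho * tau2 *
      (- (t1 ^+ 2 * b) + 2 * t1 * A1 * b)) (rho / 2 * t1 + (k + 1) * rho * tau2 * 0).
    exact: wedge_op_comb.
  by rewrite /c; congr comb_mx; ring.
have gHF : bil (metric_at p) = fun U V => H U V + Fi U V.
  apply: funext => U; apply: funext => V.
  by rewrite point_metric bil_comb !mul1r mul0r addr0.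
have S2E : bil (Ric2 p) = fun U V => (A1 ^+ 2 + b ^+ 2 * e) * H U V
    - 2 * A1 * b * S U V + t1 ^+ 2 * Fi U V.
  by apply: funext => U; apply: funext => V; rewrite point_Ric2 bil_comb mulNr.
have sq := ricci_square_wedge HC FC SC opS opA X1 X2 X3 X4 X Y opD.
have -> : kn4 (metric_at p) (Q2 (Ric p) (Ric2 p)) X1 X2 X3 X4 X Y =
    act4 DD (K 1 1 1 0) X1 X2 X3 X4 X Y
    + theta / 2 * KA.
  rewrite /kn4 /Q2 gHF S2E.
  (* Uses u^2 - b^2 e = - theta / 2. *)
  have solve (z zn za : R) : z - zn = (u ^+ 2 - b ^+ 2 * e) * za -> zn = z + theta / 2 * za.
    by move=> zE; rewrite -[LHS](subKr z) zE /theta; field.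
  by apply: solve; exact: sq.
rewrite tau2E.
generalize KA (act4 DD (K 1 1 1 0) X1 X2 X3 X4 X Y)
   (act4 DS (K 1 1 1 0) X1 X2 X3 X4 X Y) => z1 z2 z3.
move: (k) k0 k1 k2 (Gg) (rho) (theta) th0 => x x0 x1 x2 ? r th th0.
by field; rewrite ?x0 ?th0.
Qed.

Lemma point_rho_neq0 : U_C P p -> rho != 0.
Proof.
move=> [Z1 [Z2 [Z3 [Z4 C0]]]]; apply/eqP => rho0; apply: C0.
by rewrite point_Weyl rho0 mul0r.
Qed.

(** Here S = A1 h + t1 f as bilinear forms, and A1 differs from t1 on U_S. So h and f are
    combinations of S and g, and so is W through its products of h and f. *)
Lemma point_Weyl_degenerate l' : ulsubmx (Ric p) = l' *: metric_at p.1 -> U_S P p ->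
  exists abc : R * R * R, forall Z1 Z2 Z3 Z4, Weyl p Z1 Z2 Z3 Z4 =
    abc.1.1 * kn (Ric p) (Ric p) Z1 Z2 Z3 Z4
    + abc.1.2 * kn (metric_at p) (Ric p) Z1 Z2 Z3 Z4
    + abc.2 * kn (metric_at p) (metric_at p) Z1 Z2 Z3 Z4.
Proof.
move=> Sl pS.
have S_neq : Ric p <> (scal p / (2 + (n - 2))%:R) *: metric_at p by exact: pS.
have cmbS : cmb A1 (- b) t1 = cmb l' 0 t1.
  rewrite -point_Ric -[LHS](submxK (Ric p)) Sl point_Ric /cmb /comb_mx.
  by rewrite block_mxKur block_mxKdl block_mxKdr scale0r addr0.
have A1l : A1 = l'.
  have := congr1 (mtrace g) cmbS.
  rewrite !(comb_mx_mtrace _ point_g1_unit point_g2_unit) => /addIr.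
  by apply: mulfI; rewrite pnatr_eq0.
have bS Z1 Z2 : b * S Z1 Z2 = 0.
  have := congr1 (fun B => bil B Z1 Z2) cmbS.
  rewrite !bil_comb A1l => /addIr /addrI; rewrite mul0r mulNr => /eqP.
  by rewrite oppr_eq0 => /eqP.
(* Otherwise S = A1 g with A1 = kappa / n, against [pS]. *)
have d0 : A1 - t1 != 0.
  apply/eqP => /subr0_eq At; apply: S_neq.
  rewrite nE point_scal At point_Ric cmbS -A1l At point_metric /cmb comb_mxZ.
  have k20 : k + 2 != 0 by rewrite gt_eqF //; have := k_ge2; lra.
  by congr comb_mx; move: (k) k20 => x x0; field.
(* Obtained by putting h = (S - t1 g) / (A1 - t1) and f = (A1 g - S) / (A1 - t1) into
   [weyl_unit]. *)
exists (rho * (4^-1 + (2 * k)^-1 + (2 * (k * (k - 1)))^-1) / (A1 - t1) ^+ 2,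
  - rho * (t1 / 2 + (A1 + t1) / (2 * k) + A1 / (k * (k - 1))) / (A1 - t1) ^+ 2,
  rho * (t1 ^+ 2 / 4 + A1 * t1 / (2 * k) + A1 ^+ 2 / (2 * (k * (k - 1)))) / (A1 - t1) ^+ 2).
move=> Z1 Z2 Z3 Z4 /=; rewrite point_Weyl.
have SE U V : bil (Ric p) U V = A1 * H U V + t1 * Fi U V.
  by rewrite point_Ric bil_comb -/S mulNr bS subr0.
have gHF U V : bil (metric_at p) U V = H U V + Fi U V.
  by rewrite point_metric bil_comb !mul1r mul0r addr0.
rewrite /W /weyl_unit /KT mul0r addr0 /kn /kulkarni !SE !gHF.
generalize (H Z1 Z4) (H Z2 Z3) (H Z1 Z3) (H Z2 Z4) (Fi Z1 Z4) (Fi Z2 Z3) (Fi Z1 Z3)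
  (Fi Z2 Z4) => h1 h2 h3 h4 f1 f2 f3 f4.
move: (k) k0 k1 (A1) (t1) d0 (rho) => x x0 x1 y z d0 r.
by field; rewrite ?x0 ?x1 ?d0.
Qed.

End WarpedPoint.

(** The function tau_2 is introduced only where A has rank 2, which is why the formulas of (ii) on V
    carry that condition. *)
Theorem theorem7p1 (R : realType) (n : nat) (n_ge4 : (4 <= n)%N)
    (M : semi_riemannian R 2) (M_mfd : manifold_axioms M)
    (N : semi_riemannian R (n - 2)) (N_mfd : manifold_axioms N)
    (F : M -> R) (F_smooth : smooth_fun F) (F_gt0 : forall q, 0 < F q)
    (N_cst : (5 <= n)%N -> constant_curvature N) :
  let P := warped_product N F_smooth F_gt0 in
  let g := fun p : P => metric_at p in
  let S := fun p : P => Ric p in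
  let S2 := fun p : P => Ric2 p in
  let kappa := fun p : P => scal p in
  let Rm := fun p : P => Riem p in
  let C := fun p : P => Weyl p in
  let G := fun p : P => Gtensor (g p) in
  let tau1 := fun p : P => warp_tau1 N F p in
  let rho := fun p : P => warp_rho N F p in
  let L := fun p : P => warp_L N F p in
  let L_C := fun p : P => - (rho p / (2 * (n%:R - 2))) in
  let A := fun p : P => S p - tau1 p *: g p in
  let tau2 := fun p : P =>
    (mtrace (g p) (msquare (g p) (A p)) - mtrace (g p) (A p) ^+ 2)^-1 in
  let E := fun (p : P) (X1 X2 X3 X4 : 'rV[R]_(2 + (n - 2))) =>
    (n%:R - 2) / 2 * kn (S p) (S p) X1 X2 X3 X4
    - kappa p * kn (g p) (S p) X1 X2 X3 X4
    + kn (g p) (S2 p) X1 X2 X3 X4 in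
  let D := fun p : P =>
    (rho p / 2 + (n%:R - 1) * rho p * tau1 p ^+ 2 * tau2 p) *: S p
    - ((n%:R - 1) * rho p * tau1 p * tau2 p) *: S2 p in
  let V := [set p : P | [/\ U_S P p, U_C P p &
    ~ exists l : R, ulsubmx (S p) = l *: metric_at p.1]] in
  (* (i) *)
  (forall p, U_C P p -> forall X1 X2 X3 X4 X Y,
    [/\ dot (g p) (C p) (C p) X1 X2 X3 X4 X Y =
          L_C p * Q4 (g p) (C p) X1 X2 X3 X4 X Y,
        dot (g p) (Rm p) (Rm p) X1 X2 X3 X4 X Y
          - Q4 (S p) (Rm p) X1 X2 X3 X4 X Y =
          L p * Q4 (g p) (C p) X1 X2 X3 X4 X Y &
        dot (g p) (C p) (Rm p) X1 X2 X3 X4 X Y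
          + dot (g p) (Rm p) (C p) X1 X2 X3 X4 X Y =
          Q4 (S p) (C p) X1 X2 X3 X4 X Y
          + (L p + L_C p) * Q4 (g p) (C p) X1 X2 X3 X4 X Y
          - (n%:R - 2) ^- 2 * Q4 (g p) (E p) X1 X2 X3 X4 X Y]) /\
  (* (ii) *)
  (forall p, V p -> \rank (A p) = 2%N ->
    (forall X1 X2 X3 X4, C p X1 X2 X3 X4 =
      - ((n%:R - 1) * rho p * tau2 p / ((n%:R - 3) * (n%:R - 2))) *
      (E p X1 X2 X3 X4
       - (mtrace (g p) (S2 p) - kappa p ^+ 2) / (n%:R - 1)
         * G p X1 X2 X3 X4)) /\
    (forall X1 X2 X3 X4 X Y,
      [/\ dot (g p) (Rm p) (C p) X1 X2 X3 X4 X Y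
            + dot (g p) (C p) (Rm p) X1 X2 X3 X4 X Y =
            Q4 (S p) (C p) X1 X2 X3 X4 X Y
            + (L p - rho p / (2 * (n%:R - 2))
               + (n%:R - 3)
                 / ((n%:R - 2) * (n%:R - 1) * rho p * tau2 p))
              * Q4 (g p) (C p) X1 X2 X3 X4 X Y,
          dot (g p) (C p) (Rm p) X1 X2 X3 X4 X Y =
            (n%:R - 2) ^- 2 * Q4 (D p) (G p) X1 X2 X3 X4 X Y
            - (n%:R - 1) * rho p * tau2 p / (n%:R - 2) ^+ 2
              * kn4 (g p) (Q2 (S p) (S2 p)) X1 X2 X3 X4 X Y
            - rho p / (2 * (n%:R - 2)) * Q4 (g p) (C p) X1 X2 X3 X4 X Y &
          dot (g p) (Rm p) (C p) X1 X2 X3 X4 X Y =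
            Q4 (S p) (C p) X1 X2 X3 X4 X Y
            + (L p + (n%:R - 3)
                 / ((n%:R - 2) * (n%:R - 1) * rho p * tau2 p))
              * Q4 (g p) (C p) X1 X2 X3 X4 X Y
            + (n%:R - 1) * rho p * tau2 p / (n%:R - 2) ^+ 2
              * kn4 (g p) (Q2 (S p) (S2 p)) X1 X2 X3 X4 X Y
            - (n%:R - 2) ^- 2 * Q4 (D p) (G p) X1 X2 X3 X4 X Y])) /\
  (exists a b c : P -> R, forall p, ((U_S P `&` U_C P) `\` V) p ->
    forall X1 X2 X3 X4, C p X1 X2 X3 X4 =
      a p * kn (S p) (S p) X1 X2 X3 X4
      + b p * kn (g p) (S p) X1 X2 X3 X4
      + c p * kn (g p) (g p) X1 X2 X3 X4).
Proof.
move=> P g S S2 kappa Rm C G tau1 rho L L_C A tau2 E D V.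
have tracefree (p : P) := block_tracefree (point_g1_sym p) (point_g1_unit p)
  (point_T_sym p) (point_g2_unit p).
split; [|split].
- move=> p pC X1 X2 X3 X4 X Y; have [e [e_mul HS SS trT2E]] := tracefree p.
  have rho0 := point_rho_neq0 n_ge4 N_cst e_mul HS SS pC.
  rewrite /L_C /rho (point_rho n_ge4 p); split.
  + exact: (point_weyl_weyl n_ge4 N_cst e_mul HS SS).
  + exact: (point_riem_riem n_ge4 N_cst e_mul HS SS trT2E).
  + exact: (point_weyl_riem_sum n_ge4 N_cst e_mul HS SS trT2E).
- move=> p [_ pC _] rkA; have [e [e_mul HS SS trT2E]] := tracefree p.
  have rho0 := point_rho_neq0 n_ge4 N_cst e_mul HS SS pC.
  have th0 := point_rank n_ge4 N_cst e_mul rkA.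
  have sumE X1 X2 X3 X4 X Y :=
    point_riem_weyl_sum n_ge4 N_cst e_mul HS SS trT2E X1 X2 X3 X4 X Y rho0 th0.
  have CR X1 X2 X3 X4 X Y :=
    point_weyl_riem n_ge4 N_cst e_mul HS SS X1 X2 X3 X4 X Y rho0 th0.
  rewrite -(point_rho n_ge4 p) -(point_tau1 n_ge4 p) in sumE CR.
  split=> [X1 X2 X3 X4|X1 X2 X3 X4 X Y].
    rewrite /rho (point_rho n_ge4 p).
    exact: (point_Weyl_Ricci n_ge4 N_cst e_mul HS SS).
  split; [exact: sumE|exact: CR|].
  (* R.C is the sum formula minus C.R; the terms rho / (2 (n - 2)) Q(g, C) cancel. *)
  have := sumE X1 X2 X3 X4 X Y; rewrite CR => /(canRL (addrK _)) ->.
  rewrite -/(L p) -/(rho p) -/(tau2 p) -/(D p) -/(S p) -/(S2 p).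
  rewrite -/(g p) -/(C p) -/(G p).
  generalize (Q4 (S p) (C p) X1 X2 X3 X4 X Y) (Q4 (g p) (C p) X1 X2 X3 X4 X Y)
    (Q4 (D p) (G p) X1 X2 X3 X4 X Y) (kn4 (g p) (Q2 (S p) (S2 p)) X1 X2 X3 X4 X Y)
    (L p) (rho p / (2 * (n%:R - 2)))
    ((n%:R - 3) / ((n%:R - 2) * (n%:R - 1) * rho p * tau2 p))
    ((n%:R - 1) * rho p * tau2 p / (n%:R - 2) ^+ 2) ((n%:R - 2 : R) ^- 2).
  by move=> *; ring.
- have /choice[abc abcE] (p : P) : exists abc : R * R * R,
      ((U_S P `&` U_C P) `\` V) p -> forall X1 X2 X3 X4, C p X1 X2 X3 X4 =
      abc.1.1 * kn (S p) (S p) X1 X2 X3 X4 + abc.1.2 * kn (g p) (S p) X1 X2 X3 X4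
      + abc.2 * kn (g p) (g p) X1 X2 X3 X4.
    (* Choice needs a triple at every point; off the set the default is (0, 0, 0). *)
    have [[[pS pC] nV]|] := pselect (((U_S P `&` U_C P) `\` V) p); last by exists (0, 0, 0).
    have [l Sl] : exists l : R, ulsubmx (S p) = l *: metric_at p.1.
      by apply: contrapT => nl; apply: nV.
    have [e [e_mul HS SS _]] := tracefree p.
    have [abc abcE] := point_Weyl_degenerate n_ge4 N_cst e_mul HS SS Sl pS.
    by exists abc.
  exists (fun p => (abc p).1.1), (fun p => (abc p).1.2), (fun p => (abc p).2).
  exact: abcE.
Qed.
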